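(* For every $t\ge 0$, $$\frac{d\mathbb Q}{dP}\bigg|_{\mathcal F_t}=\frac{Z(t)}{Z(0)}\qquad\text{and}\qquad \frac{d\hat{\mathbb P}}{d\mathbb P}\bigg|_{\mathcal G_t}=\frac{\zeta(t)}{\zeta(0)}.$$
   Context: **Branching Markov process.** Let $(J,\mathcal B)$ be a measurable space, $\Xi=(\Xi_t)_{t\ge 0}$ a Markov process in $J$, $R:J\to[0,\infty)$ a measurable function, and for each $x\in J$ let $A(x)$ be a random variable in $\{0,1,2,\dots\}$ with $P(A(x)=k)=p_k(x)$ and finite mean $m(x)=\sum_k k\,p_k(x)$. In the branching Markov process each particle $u$ moves in $J$ as an independent copy of $\Xi$ started from its birth position; if alive at time $t$ at position $X_u(t)$ it dies in $[t,t+dt)$ with probability $R(X_u(t))\,dt+o(dt)$; on dying at location $y$ it is replaced by $1+A_u$ particles positioned at $y$, where $A_u$ is an independent copy of $A(y)$; once born, particles evolve independently. **Marked trees with spines.** Let $\Omega=\{\emptyset\}\cup\bigcup_{n\ge1}\mathbb N^n$, $\mathbb N=\{1,2,\dots\}$, be the set of finite words, with concatenation $uv$; $v<u$ means that $v$ is a strict ancestor of $u$ (i.e. $u=vw$ with $w\ne\emptyset$), and $v\le u$ means $v<u$ or $v=u$. A Galton-Watson tree is a set $\tau\subset\Omega$ with $\emptyset\in\tau$; $uv\in\tau\Rightarrow u\in\tau$; and for each $u\in\tau$ there is $A_u\in\{0,1,2,\dots\}$ with $uj\in\tau\iff 1\le j\le 1+A_u$. A marked tree $(\tau,M)=(\tau,X,\sigma)$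 assigns to each $u\in\tau$ a lifetime $\sigma_u\in\mathbb R^+$ and a path $X_u:[S_u-\sigma_u,S_u)\to J$, where $S_u=\sum_{v\le u}\sigma_v$ is the death (fission) time; at time $S_u$ the particle $u$ has disappeared and its children are alive. The path is extended to $[0,S_u)$ by $X_u(t)=X_v(t)$ for the ancestor $v<u$ with $S_v-\sigma_v\le t<S_v$. $N_t=\{u\in\tau:S_u-\sigma_u\le t<S_u\}$ is the set of particles alive at time $t$. A spine $\xi\in\partial\tau$ is an infinite line of descent $\{\emptyset,u_1,u_2,\dots\}$ in $\tau$. $\tilde{\mathcal T}$ is the set of all $(\tau,M,\xi)$ with $(\tau,M)$ a marked tree and $\xi\in\partial\tau$. There is no explosion: for every $t\ge 0$ each line of descent has exactly one node alive at time $t$; for the spine this node is $\mathrm{node}_t(\xi)$. The symbol $\xi_t$ denotes, according to context, either this node (as in $\{\xi_t=u\}$, $v<\xi_t$) or its spatial position $X_{\mathrm{node}_t(\xi)}(t)\in J$ (as in $R(\xi_s)$). **Filtrations on $\tilde{\mathcal T}$.** $\mathcal F_t=\sigma\big((u,X_u,\sigma_u):S_u\le t;\ (u,X_u(s):s\in[S_u-\sigma_u,t]):t\in[S_u-\sigma_u,S_u)\big)$; $\tilde{\mathcal F}_t=\sigma(\mathcal F_t,\mathrm{node}_t(\xi))$ (the branching process and the spine nodes up to time $t$); $\mathcal G_t=\sigma(\xi_s:0\le s\le t)$ (spatial positions of the spine only). $\mathcal F_\infty,\tilde{\mathcal F}_\infty,\mathcal G_\infty$ are generated by the respective unions over $t$.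 **Measures.** Fix a starting point $x\in J$; superscripts $x$ are suppressed. $P=P^x$ is the probability measure on $(\tilde{\mathcal T},\mathcal F_\infty)$ under which $\mathbb X_t=\{X_u(t):u\in N_t\}$ is the branching Markov process above started from one particle at $x$. Every $\tilde{\mathcal F}_t$-measurable $f$ can be written $f=\sum_{u\in N_t}f_u\mathbf 1_{(\xi_t=u)}$ with each $f_u$ being $\mathcal F_t$-measurable. The probability measure $\tilde P=\tilde P^x$ on $(\tilde{\mathcal T},\tilde{\mathcal F}_\infty)$ is defined by $\int f\,d\tilde P=\int\sum_{u\in N_t}f_u\prod_{v<u}\frac1{1+A_v}\,dP$ for each (nonnegative or bounded) $\tilde{\mathcal F}_t$-measurable $f$. $\mathbb P:=\tilde P|_{\mathcal G_\infty}$. **Martingales.** $\zeta(t)$ is a given strictly positive $\mathcal G_t$-adapted $\tilde P$-martingale, represented as $\zeta(t)=\sum_{u\in N_t}\zeta_u(t)\mathbf 1_{(\xi_t=u)}$ with $\zeta_u(t)$ $\mathcal F_t$-measurable. Define $$Z(t)=\sum_{u\in N_t}e^{-\int_0^t m(X_u(s))R(X_u(s))\,ds}\,\zeta_u(t),\qquad \tilde\zeta(t)=\prod_{v<\xi_t}(1+A_v)\;e^{-\int_0^t m(\xi_s)R(\xi_s)\,ds}\;\zeta(t).$$ The integrals in the exponents are finite, so these processes are strictly positive; $\tilde\zeta$ is an $\tilde{\mathcal F}_t$-adapted $\tilde P$-martingale. At time $0$ the only particle is $\emptyset$, so $Z(0)=\zeta(0)=\tilde\zeta(0)$. **Changed measures.**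 $\tilde{\mathbb Q}$ is the probability measure on $(\tilde{\mathcal T},\tilde{\mathcal F}_\infty)$ with $\frac{d\tilde{\mathbb Q}}{d\tilde P}\big|_{\tilde{\mathcal F}_t}=\tilde\zeta(t)/\tilde\zeta(0)$ for all $t\ge0$; $\mathbb Q:=\tilde{\mathbb Q}|_{\mathcal F_\infty}$ and $\hat{\mathbb P}:=\tilde{\mathbb Q}|_{\mathcal G_\infty}$. *)

(* Defs.v *)
From HB Require Import structures.
From mathcomp Require Import all_boot all_order all_algebra.
From mathcomp Require Import all_classical all_reals all_analysis.

Set Implicit Arguments.
Unset Strict Implicit.
Unset Printing Implicit Defensive.
Import Order.TTheory GRing.Theory Num.Theory.
Import numFieldNormedType.Exports.
Local Open Scope classical_set_scope.
Local Open Scope ring_scope.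

(* The space of trajectories of a Markov process in its canonical form, stable
   under the shift operators.  Times are nonnegative reals: the values of a
   trajectory at negative times are never looked at. *)
Record path_class (R : realType) (d : measure_display)
    (J : measurableType d) := PathClass {
  trajectory : set (R -> J);
  trajectory_nonempty : trajectory !=set0;
  trajectory_shift : forall (w : R -> J) (t : R), 0 <= t ->
    trajectory w -> trajectory (fun s => w (t + s)) }.

Section Paths.
Context {R : realType} {d : measure_display} {J : measurableType d}.
Variable W : path_class R J.

Definition sample_path : Type := {w : R -> J | trajectory W w}.

Definition path_fun (w : sample_path) : R -> J := sval w.

Definition sample_path0 : sample_path :=
  exist _ (sval (cid (trajectory_nonempty W)))
          (svalP (cid (trajectory_nonempty W))).

HB.instance Definition _ := gen_eqMixin sample_path.
HB.instance Definition _ := gen_choiceMixin sample_path.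
HB.instance Definition _ := isPointed.Build sample_path sample_path0.

Definition path_shift (t : {nonneg R}) (w : sample_path) : sample_path :=
  exist _ (fun s => path_fun w (t%:num + s))
          (trajectory_shift (ge0 t) (svalP w)).

Definition cylinders_upto (t : R) : set (set sample_path) :=
  [set E | exists s (B : set J), [/\ 0 <= s <= t, measurable B &
     E = [set w | B (path_fun w s)]]].

Definition cylinders : set (set sample_path) :=
  \bigcup_(t in [set t : R | 0 <= t]) cylinders_upto t.

Definition pathT := g_sigma_algebraType cylinders.

(* (s, w) |-> w s restricted to [0, t] is jointly measurable, the second
   factor carrying the sigma-algebra of the path up to time t.  This makes the
   integrals of rate functions along the paths meaningful. *)
Definition progressively_measurable : Prop :=
  forall (t : R) (B : set J), 0 <= t -> measurable B ->
    measurable [set z : R * g_sigma_algebraType (cylinders_upto t) |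
                 0 <= z.1 <= t /\ B (path_fun z.2 z.1)].

Definition is_markov_process (Xi : R.-pker J ~> pathT) : Prop :=
  (forall (y : J) (B : set J), measurable B ->
     Xi y [set w | B (path_fun w 0)] = \d_y B) /\
  (forall (y : J) (t : {nonneg R}) (A E : set sample_path),
     <<s cylinders_upto t%:num >> A -> <<s cylinders >> E ->
     Xi y (A `&` path_shift t @^-1` E) =
     (\int[Xi y]_(w in A) Xi (path_fun w t%:num) E)%E).

End Paths.

Coercion path_fun : sample_path >-> Funclass.

Definition is_offspring_law (R : realType) (d : measure_display)
    (J : measurableType d) (p : nat -> J -> R) : Prop :=
  [/\ forall k, measurable_fun setT (p k),
      forall k y, 0 <= p k y,
      forall y, (\sum_(0 <= k <oo) (p k y)%:E = 1)%E &
      forall y, (\sum_(0 <= k <oo) (k%:R * p k y)%:E < +oo)%E].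

Definition offspring_mean (R : realType) (J : Type) (p : nat -> J -> R)
    (y : J) : R :=
  fine (\sum_(0 <= k <oo) (k%:R * p k y)%:E)%E.

Section Words.
Context {R : realType}.
Implicit Types (u v : seq nat) (life : seq nat -> R) (t : R).

Definition strict_ancestors u : seq (seq nat) :=
  [seq take k u | k <- iota 0 (size u)].

Definition ancestors u : seq (seq nat) := rcons (strict_ancestors u) u.

Definition fission_time life u : R := \sum_(v <- ancestors u) life v.

Definition birth_time life u : R := fission_time life u - life u.

Definition alive_at life t u : bool :=
  (birth_time life u <= t) && (t < fission_time life u).

(* The path of u extended backwards along its ancestors. *)
Definition extended_path (J : Type) life (seg : seq nat -> R -> J) u t : J :=
  seg (head u [seq v <- ancestors u | alive_at life t v]) t.

Definition line_of_descent (tree : set (seq nat)) (l : nat -> seq nat) : Prop :=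
  [/\ l 0%N = [::], forall n, tree (l n) &
      forall n, exists j, l n.+1 = rcons (l n) j].

End Words.

(* Words on {1, 2, ...}; brood u is A_u, so that u has 1 + A_u children.  Only
   paths along lines of descent that are initial pieces of trajectories of W
   are allowed, so that rates can be integrated along them.  The values of
   brood and life off the tree, and those of seg u outside [S_u - sigma_u, S_u),
   are junk that no event below can see. *)
Record marked_tree (R : realType) (d : measure_display) (J : measurableType d)
    (W : path_class R J) := MarkedTree {
  tree : set (seq nat);
  brood : seq nat -> nat;
  life : seq nat -> R;
  seg : seq nat -> R -> J;
  tree_root : tree [::];
  tree_prefix : forall u v, tree (u ++ v) -> tree u;
  tree_children : forall u j, tree u ->
    (tree (rcons u j) <-> (1 <= j <= 1 + brood u)%N);
  life_gt0 : forall u, tree u -> 0 < life u;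
  seg_trajectory : forall u, tree u -> exists w : sample_path W,
    forall s, 0 <= s < fission_time life u -> extended_path life seg u s = w s;
  no_explosion : forall l, line_of_descent tree l -> forall t, 0 <= t ->
    exists! n, alive_at life t (l n) }.

Record spined_tree (R : realType) (d : measure_display) (J : measurableType d)
    (W : path_class R J) := SpinedTree {
  spined_marked :> marked_tree W;
  spine : nat -> seq nat;
  spine_line : line_of_descent (tree spined_marked) spine }.

Section TreePointed.
Context {R : realType} {d : measure_display} {J : measurableType d}.
Variable W : path_class R J.

Lemma size_ancestors u : size (ancestors u) = (size u).+1.
Proof. by rewrite /ancestors /strict_ancestors size_rcons size_map size_iota. Qed.

Lemma fission_time_cst1 u : fission_time (fun=> 1 : R) u = (size u).+1%:R.
Proof.
by rewrite /fission_time big_const_seq count_predT size_ancestors iter_addr_0.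
Qed.

Lemma alive_at_cst1 t u :
  alive_at (fun=> 1 : R) t u = ((size u)%:R <= t) && (t < (size u).+1%:R).
Proof.
by rewrite /alive_at /birth_time fission_time_cst1 -[in X in X <= _]addn1 natrD addrK.
Qed.

Lemma size_line (T : set (seq nat)) l n : line_of_descent T l -> size (l n) = n.
Proof.
case=> l0 _ lS; elim: n => [|n IHn]; first by rewrite l0.
by have [j ->] := lS n; rewrite size_rcons IHn.
Qed.

(* The tree in which every particle lives for one unit of time and has exactly
   one child. *)
Program Definition marked_tree0 : marked_tree W :=
  @MarkedTree R d J W [set u | all (pred1 1%N) u] (fun=> 0%N) (fun=> 1)
    (fun=> sample_path0 W) _ _ _ _ _ _.
Next Obligation. by []. Qed.
Next Obligation. by move=> /= u v; rewrite all_cat => /andP[]. Qed.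
Next Obligation.
move=> /= u j uT; rewrite all_rcons uT andbT addn0 -eqn_leq eq_sym /=.
by split=> /eqP ->.
Qed.
Next Obligation. by []. Qed.
Next Obligation. by move=> /= u _; exists (sample_path0 W). Qed.
Next Obligation.
move=> /= l lT t t0; exists (Num.truncn t); split.
  rewrite alive_at_cst1 (size_line _ lT).
  exact: truncn_itv.
move=> n; rewrite alive_at_cst1 (size_line _ lT) => /truncn_def.
by [].
Qed.

Definition spined_tree0 : spined_tree W.
Proof.
apply: (@SpinedTree _ _ _ W marked_tree0 (fun n => nseq n 1%N)); split=> //.
- by move=> n /=; rewrite all_nseq /= orbT.
- by move=> n; exists 1%N; elim: n => [|n /= IHn] //; rewrite -IHn.
Defined.

HB.instance Definition _ := gen_eqMixin (spined_tree W).
HB.instance Definition _ := gen_choiceMixin (spined_tree W).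
HB.instance Definition _ := isPointed.Build (spined_tree W) spined_tree0.

End TreePointed.

Section TreeTheory.
Context {R : realType} {d : measure_display} {J : measurableType d}.
Variable W : path_class R J.
Implicit Types (w : spined_tree W) (u v : seq nat) (s t : R).

Definition fission w u : R := fission_time (life w) u.
Definition birth w u : R := birth_time (life w) u.

Definition population w t : set (seq nat) :=
  [set u | tree w u /\ alive_at (life w) t u].

Definition position w u t : J := extended_path (life w) (seg w) u t.

Definition node w t : seq nat :=
  xget [::] [set u | range (spine w) u /\ alive_at (life w) t u].

Definition spine_position w t : J := position w (node w t) t.

Definition fission_position w u : J := seg w (rcons u 1%N) (fission w u).

Definition birth_position (x : J) w u : J :=
  if size u is n.+1 then fission_position w (take n u) else x.

(* At every time t >= 0 the population is finite and the spine passes through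
   exactly one of its members, so that the sums over the population below are
   genuine finite sums and the default value of xget in node is never used. *)

Lemma fission_le_birth w u v : tree w v -> (size u < size v)%N ->
  take (size u) v = u -> fission w u <= birth w v.
Proof.
move=> vT uv takev.
rewrite /birth /birth_time /fission /fission_time {2}/ancestors.
rewrite -cats1 big_cat big_seq1 /= addrK.
suff -> : strict_ancestors v =
    ancestors u ++ [seq take k v | k <- iota (size u).+1 (size v - (size u).+1)].
  rewrite big_cat /= lerDl big_map; apply: sumr_ge0 => k _.
  by apply/ltW/life_gt0; apply: (@tree_prefix _ _ _ _ w _ (drop k v)); rewrite cat_take_drop.
rewrite /strict_ancestors -{1}(subnKC uv) iotaD map_cat add0n; congr (_ ++ _).
rewrite -addn1 iotaD map_cat add0n /= /ancestors /strict_ancestors -cats1 takev.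
congr (_ ++ _); apply/eq_in_map => k; rewrite mem_iota /= add0n => ku.
by rewrite -[in RHS]takev take_takel // ltnW.
Qed.

Lemma finite_population w t : 0 <= t -> finite_set (population w t).
Proof.
move=> t0.
pose below u := [set v | population w t v /\ take (size u) v = u].
have step u : tree w u -> infinite_set (below u) ->
    exists j, tree w (rcons u j) /\ infinite_set (below (rcons u j)).
  move=> uT; apply: contra_notP => /forallNP noj.
  apply: (@sub_finite_set _ _ ([set u] `|`
    \bigcup_(j in [set j | (j < (brood w u).+2)%N /\ tree w (rcons u j)])
      below (rcons u j))).
    move=> v [vP takev]; have [->|vu] := eqVneq v u; [by left|right].
    have uv : (size u < size v)%N.
      rewrite ltnNge; apply/negP => vs; move/eqP: vu; apply.
      by rewrite -takev take_oversize.
    have E : take (size u).+1 v = rcons u (nth 0%N v (size u)).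
      by rewrite (take_nth 0%N) // takev.
    have T : tree w (rcons u (nth 0%N v (size u))).
      apply: (@tree_prefix _ _ _ _ w _ (drop (size u).+1 v)).
      by rewrite -E cat_take_drop; case: vP.
    exists (nth 0%N v (size u)) => /=.
      by split=> //; have /andP[_] := (tree_children _ uT).1 T; rewrite add1n.
    by split=> //; rewrite size_rcons.
  rewrite finite_setU; split; first exact: finite_set1.
  apply: bigcup_finite.
    by apply: (sub_finite_set _ (finite_II (brood w u).+2)) => j [].
  move=> j [_ jT]; apply: contrapT => jI; exact: (noj j).
apply: contrapT => popI.
pose big u := tree w u /\ infinite_set (below u).
have big0 : big [::].
  split; first exact: tree_root.
  apply: contra_not popI; apply: sub_finite_set => v vP.
  by split=> //; rewrite take0.
pose next (u : {u | big u}) : {u | big u} :=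
  let c := cid (step _ (svalP u).1 (svalP u).2) in
  exist _ (rcons (sval u) (sval c)) (svalP c).
pose l n := sval (iter n next (exist _ _ big0)).
have lT : line_of_descent (tree w) l.
  split=> // n; first by rewrite /l; case: (iter _ _ _) => ? [].
  by rewrite /l /=; eexists.
have [n [/andP[_ tn] _]] := no_explosion lT t0.
have [_ lI] : big (l n.+1) by exact: (svalP (iter n.+1 next (exist _ _ big0))).
apply: lI; suff -> : below (l n.+1) = set0 by exact: finite_set0.
apply/seteqP; split=> // v [[vT /andP[bv _]] takev].
have [j lS] : exists j, l n.+1 = rcons (l n) j by case: lT.
have sv : (size (l n) < size v)%N.
  rewrite ltnNge; apply/negP => vs; have := congr1 size takev.
  rewrite lS size_rcons take_oversize => [sE|]; last exact: leqW.
  by rewrite sE ltnn in vs.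
have tv : take (size (l n)) v = l n.
  have := congr1 (take (size (l n))) takev.
  by rewrite lS size_rcons take_takel // -cats1 take_size_cat.
have := fission_le_birth vT sv tv; rewrite leNgt => /negP; apply.
exact: le_lt_trans bv tn.
Qed.

Lemma node_spec w t : 0 <= t ->
  [/\ range (spine w) (node w t), population w t (node w t) &
     forall u, range (spine w) u -> population w t u -> u = node w t].
Proof.
move=> t0; have [n [an nU]] := no_explosion (spine_line w) t0.
have [sn tn] : range (spine w) (node w t) /\ alive_at (life w) t (node w t).
  apply: (@xgetPex _ [::]
    [set u | range (spine w) u /\ alive_at (life w) t u]).
  by exists (spine w n); split=> //; exists n.
split=> //; first by split=> //; case: sn => k _ <-; case: (spine_line w).
move: sn tn => [k _ <-] ak _ [i _ <-] [_ ai].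
by rewrite -(nU _ ak) -(nU _ ai).
Qed.

Definition filt_F_generators t : set (set (spined_tree W)) :=
  [set E | exists u (C : set R), measurable C /\
     E = [set w : spined_tree W | [/\ tree w u, fission w u <= t & C (life w u)]]] `|`
  [set E | exists u s (B : set J), measurable B /\
     E = [set w : spined_tree W | [/\ tree w u, fission w u <= t,
                      birth w u <= s < fission w u & B (seg w u s)]]] `|`
  [set E | exists u s (B : set J), measurable B /\
     E = [set w : spined_tree W | [/\ population w t u, birth w u <= s <= t &
                                     B (seg w u s)]]].

Definition filt_F t : set (set (spined_tree W)) := <<s filt_F_generators t >>.

Definition filt_Ft t : set (set (spined_tree W)) :=
  <<s filt_F_generators t `|`
      [set E | exists u, E = [set w : spined_tree W | node w t = u]] >>.

Definition filt_G t : set (set (spined_tree W)) :=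
  <<s [set E | exists s (B : set J), [/\ 0 <= s <= t, measurable B &
         E = [set w : spined_tree W | B (spine_position w s)]]] >>.

Definition at_infinity (H : R -> set (set (spined_tree W))) :=
  \bigcup_(t in [set t : R | 0 <= t]) H t.

(* A finite-dimensional test on the life of one particle: its lifetime is in
   lt_life, it has 1 + lt_brood children, its position at its fission is in
   lt_end, and at the ages lt_age i (if still alive) its position is in
   lt_at i. *)
Record life_test := LifeTest {
  lt_life : set R;
  lt_brood : nat;
  lt_end : set J;
  lt_num : nat;
  lt_age : 'I_lt_num -> R;
  lt_at : 'I_lt_num -> set J }.

Definition measurable_test (e : life_test) : Prop :=
  [/\ measurable (lt_life e), measurable (lt_end e),
      forall i, 0 <= @lt_age e i & forall i, measurable (@lt_at e i)].

Definition passes (e : life_test) (sigma : R) (a : nat) (y : J)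
    (X : R -> J) : Prop :=
  [/\ lt_life e sigma, a = lt_brood e, lt_end e y &
      forall i, @lt_age e i < sigma -> lt_at i (X (@lt_age e i))].

Definition particle_passes w u (e : life_test) : Prop :=
  passes e (life w u) (brood w u) (fission_position w u)
    (fun s => seg w u (birth w u + s)).

(* The probability that a particle driven by the path X passes e: it dies in dr
   with probability rate (X r) exp (- int_0^r rate (X q) dq) dr, and then has
   1 + k children with probability p k (X r). *)
Definition life_law_along (rate : J -> R) (p : nat -> J -> R) (e : life_test)
    (X : sample_path W) : \bar R :=
  (\int[lebesgue_measure]_(r in [set r : R | (0 <= r)%R /\
                                passes e r (lt_brood e) (X r) X])
     ((rate (X r) * p (lt_brood e) (X r))%:E *
      expeR (- \int[lebesgue_measure]_(q in `[0%R, r]%classic)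
                 (rate (X q))%:E)))%E.

Definition life_law (Xi : R.-pker J ~> pathT W) (rate : J -> R)
    (p : nat -> J -> R) (y : J) (e : life_test) : \bar R :=
  (\int[Xi y]_X life_law_along rate p e X)%E.

Definition generations_lt (n : nat) : set (set (spined_tree W)) :=
  <<s [set E | exists u e, [/\ (size u < n)%N, measurable_test e &
         E = [set w : spined_tree W | tree w u /\ particle_passes w u e]]] >>.

(* Given the generations < n, the particles of generation n have independent
   lives, each distributed as life_law from its own birth position. *)
Definition is_branching_markov (Xi : R.-pker J ~> pathT W) (rate : J -> R)
    (p : nat -> J -> R) (x : J)
    (P : probability (g_sigma_algebraType (at_infinity filt_F)) R) : Prop :=
  forall (n : nat) (U : seq (seq nat)) (e : seq nat -> life_test)
      (E : set (spined_tree W)),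
    uniq U -> (forall u, u \in U -> size u = n) ->
    (forall u, u \in U -> measurable_test (e u)) ->
    generations_lt n E ->
    P (E `&` [set w : spined_tree W | forall u, u \in U ->
                tree w u /\ particle_passes w u (e u)]) =
    (\int[P]_(w in E `&`
                 [set w : spined_tree W | forall u, u \in U -> tree w u])
       \prod_(u <- U) life_law Xi rate p (birth_position x w u) (e u))%E.

Definition measurable_wrt (H : set (set (spined_tree W)))
    (f : spined_tree W -> R) : Prop :=
  forall B : set R, measurable B -> H (f @^-1` B).

Definition restricts_to (H : set (set (spined_tree W)))
    (mu nu : set (spined_tree W) -> \bar R) : Prop :=
  forall A, H A -> nu A = mu A.

(* f is a version of d nu / d mu on the sub-sigma-algebra H. *)
Definition is_density (K : set (set (spined_tree W)))
    (H : set (set (spined_tree W)))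
    (mu : {measure set (g_sigma_algebraType K) -> \bar R})
    (nu : set (spined_tree W) -> \bar R) (f : spined_tree W -> R) : Prop :=
  measurable_wrt H f /\
  forall A, H A -> nu A = (\int[mu]_(w in A) (f w)%:E)%E.

Definition is_martingale (K : set (set (spined_tree W)))
    (mu : {measure set (g_sigma_algebraType K) -> \bar R})
    (H : R -> set (set (spined_tree W))) (M : R -> spined_tree W -> R) : Prop :=
  [/\ forall t, 0 <= t -> measurable_wrt (H t) (M t),
      forall t, 0 <= t -> mu.-integrable setT (fun w => (M t w)%:E) &
      forall s t A, 0 <= s <= t -> H s A ->
        (\int[mu]_(w in A) (M t w)%:E = \int[mu]_(w in A) (M s w)%:E)%E].

Definition spine_representation t (f : spined_tree W -> R)
    (fu : seq nat -> spined_tree W -> R) : Prop :=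
  (forall u, measurable_wrt (filt_F t) (fu u)) /\
  (forall w, f w = \sum_(u \in population w t) fu u w * (node w t == u)%:R).

Definition is_spine_measure
    (P : probability (g_sigma_algebraType (at_infinity filt_F)) R)
    (Pt : probability (g_sigma_algebraType (at_infinity filt_Ft)) R) : Prop :=
  forall t (f : spined_tree W -> R) (fu : seq nat -> spined_tree W -> R),
    0 <= t -> measurable_wrt (filt_Ft t) f ->
    (forall w, 0 <= f w) \/ (exists M : R, forall w, `|f w| <= M) ->
    spine_representation t f fu ->
    (\int[Pt]_w (f w)%:E =
     \int[P]_w (\sum_(u \in population w t) fu u w *
                  \prod_(v <- strict_ancestors u) (1 + (brood w v)%:R)^-1)%:E)%E.

Definition mean_rate (rate : J -> R) (p : nat -> J -> R) (y : J) : R :=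
  offspring_mean p y * rate y.

Definition additive_martingale (rate : J -> R) (p : nat -> J -> R)
    (zeta_u : R -> seq nat -> spined_tree W -> R) t w : R :=
  \sum_(u \in population w t)
    expR (- \int[lebesgue_measure]_(s in `[0, t])
              mean_rate rate p (position w u s)) * zeta_u t u w.

Definition spine_martingale (rate : J -> R) (p : nat -> J -> R)
    (zeta : R -> spined_tree W -> R) t w : R :=
  \prod_(v <- strict_ancestors (node w t)) (1 + (brood w v)%:R) *
  expR (- \int[lebesgue_measure]_(s in `[0, t])
            mean_rate rate p (spine_position w s)) * zeta t w.

End TreeTheory.

(* Main.v *)
Require Import Defs.
From HB Require Import structures.
From mathcomp Require Import all_boot all_order all_algebra.
From mathcomp Require Import all_classical all_reals all_analysis.
From mathcomp Require Import measurable_realfun.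

Set Implicit Arguments.
Unset Strict Implicit.
Unset Printing Implicit Defensive.
Import Order.TTheory GRing.Theory Num.Theory.
Import numFieldNormedType.Exports.
Local Open Scope classical_set_scope.
Local Open Scope ring_scope.

(* By the definition of the spine measure, the integral under Pt of
   1_A spine_martingale, A in F_t, is the integral under P of a sum over the
   population in which the factor prod 1 / (1 + A_v) cancels the fertility factor of
   spine_martingale; what remains is 1_A Z(t).

   For A in G_t the claim amounts to E~[prod (1 + A_v) exp (- int m R) | G_t] = 1.
   Under P it says that sum_u 1_E(X_u) exp (- int_0^t m R(X_u)) and
   sum_u 1_E(X_u) prod_(v < u) 1 / (1 + A_v) have the same expectation, for every
   event E of the paths up to time t.  Both sums are split according to the line of
   descent of u: the child indices and the brood sizes along it.  By induction on the
   generation, using the branching property, the Markov property and a monotone class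
   argument, the path of u and its fission times have the law of Xi together with the
   density prod R p_a exp (- int R) on the simplex of the fission times.  Summed over
   all the lines with n fissions before t, these simplex integrals are
   (int_0^t (1 + m) R)^n / n! in the first case, as sum_a (1 + a) p_a = 1 + m, and
   (int_0^t R)^n / n! in the second, as sum_a p_a = 1; summed over n and multiplied by
   the weights, both give exp (int_0^t R). *)

(** * Integration functionals *)

(** Three obstacles shape the second identity. The branching property speaks of complete lives, from
    birth to fission, and never of a fixed time. A particle alive at [t] is therefore treated as one
    that splits after [t]; this produces a factor [late_fission], common to the two expectations, of
    which only the vanishing for an infinite cumulated rate has to be known. Next, a life is
    described by the age of the particle and its path before death, whereas the claim concerns
    absolute times. Birth time, lifetime and killed path are hence kept together in the space
    [killedT]: its generating tests are those of the branching property, and its sigma-algebra also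
    contains the events that mix the three. Finally, trajectories have no regularity beyond
    progressive measurability; each evaluation at a random time is reduced to it, if necessary
    through a rational time before the death of the path. Conditional expectations are avoided: an
    event of G_t is an event about the path of the spine node, so it makes sense for every living
    particle. *)

Lemma mule_limn {R : realType} (w : \bar R) (u : (\bar R)^nat) :
  (0 <= w)%E -> (forall n, 0 <= u n)%E -> nondecreasing_seq u ->
  (w * limn u = limn (fun n => w * u n))%E.
Proof.
move=> w0 u0 ndu; have cu := ereal_nondecreasing_is_cvgn ndu.
case: w w0 => [w _|_|//]; first by apply/esym/cvg_lim => //; exact: cvgeZl.
(* For [w = +oo] multiplication is not continuous at 0. By monotonicity either [u] vanishes
   identically, or it is positive from some rank on and both sides are [+oo]. *)
have [uE0|/existsNP[k uk]] := pselect (forall n, u n = 0%E).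
  have -> : u = cst 0%E by apply/funext.
  rewrite lim_cst // mule0; apply/esym/cvg_lim => //; apply: cvg_near_cst.
  exact: nearW.
have uk0 : (0 < u k)%E by rewrite lt_def u0 andbT; apply/eqP.
rewrite gt0_mulye; last first.
  by apply: (lt_le_trans uk0); apply: lime_ge => //; exists k => // n /= kn; exact: ndu.
apply/esym/cvg_lim => //; apply: cvg_near_cst; exists k => // n /= kn.
by rewrite gt0_mulye //; apply: (lt_le_trans uk0); exact: ndu.
Qed.

Section IntegrationFunctional.
Context {R : realType} d (S : measurableType d).
Local Open Scope ereal_scope.

(* Iterated integrals against kernels and densities are compared as functionals,
   without first constructing the measures that represent them. *)
Record integration_functional (L : (S -> \bar R) -> \bar R) : Prop := {
  intf_ge0 : forall f : S -> \bar R, measurable_fun setT f -> (forall z, 0 <= f z) -> 0 <= L f;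
  intfD : forall f g : S -> \bar R, measurable_fun setT f -> measurable_fun setT g ->
    (forall z, 0 <= f z) -> (forall z, 0 <= g z) ->
    L (fun z => f z + g z) = L f + L g;
  intfZ : forall (k : R) (f : S -> \bar R), (0 <= k)%R -> measurable_fun setT f ->
    (forall z, 0 <= f z) -> L (fun z => k%:E * f z) = k%:E * L f;
  le_intf : forall f g : S -> \bar R, measurable_fun setT f -> measurable_fun setT g ->
    (forall z, 0 <= f z) -> (forall z, f z <= g z) -> L f <= L g;
  intf_limn : forall f : (S -> \bar R)^nat, (forall n, measurable_fun setT (f n)) ->
    (forall n z, 0 <= f n z) ->
    (forall z, {homo f ^~ z : n m / (n <= m)%N >-> n <= m}) ->
    L (fun z => limn (f ^~ z)) = limn (fun n => L (f n)) }.

Variables L1 L2 : (S -> \bar R) -> \bar R.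
Hypotheses (IL1 : integration_functional L1) (IL2 : integration_functional L2).

Let ind (A : set S) : S -> \bar R := fun z => (\1_A z)%:E.

Let mind A : measurable A -> measurable_fun setT (ind A).
Proof. by move=> mA; apply/measurable_EFinP; exact: measurable_indic. Qed.

Let ind0 A z : 0 <= ind A z.
Proof. by rewrite lee_fin. Qed.

Lemma intf0 L : integration_functional L -> L (cst 0) = 0.
Proof.
move=> IL; rewrite -[RHS](mul0e (L (cst 0))) -(intfZ IL) //.
by congr L; apply/funext => z; rewrite mul0e.
Qed.

Lemma intf_bigsetU L (F : (set S)^nat) n : integration_functional L ->
  (forall k, measurable (F k)) -> trivIset setT F ->
  L (ind (\big[setU/set0]_(i < n) F i)) = \sum_(i < n) L (ind (F i)).
Proof.
move=> IL mF tF; elim: n => [|n IHn].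
  rewrite !big_ord0 -[RHS](intf0 IL); congr L; apply/funext => z /=.
  by rewrite /ind indic0.
rewrite !big_ord_recr /= -IHn -(intfD IL); last 4 first.
- by apply: mind; apply: bigsetU_measurable.
- exact: mind.
- exact: ind0.
- exact: ind0.
congr L; apply/funext => z; rewrite /ind -EFinD; congr EFin.
rewrite !indicE in_setU.
have : ~ (z \in \big[setU/set0]_(i < n) F i /\ z \in F n).
  move=> [/set_mem + /set_mem zn]; rewrite -bigcup_mkord => -[k /= kn zk].
  have kE : k = n by apply: (tF k n) => //; exists z.
  by rewrite kE ltnn in kn.
by case: (z \in _); case: (z \in _) => //= h; rewrite ?addr0 ?add0r //; exfalso; apply: h.
Qed.

(** Dynkin's pi-lambda argument. The finite total mass of [L1] is what allows the mass of [A] to be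
    cancelled when passing to the complement. *)
Lemma intf_eq_measurable (G : set (set S)) :
  (@measurable _ S) = <<s G >> -> setI_closed G -> L1 (ind setT) < +oo ->
  L1 (ind setT) = L2 (ind setT) ->
  (forall A, G A -> L1 (ind A) = L2 (ind A)) ->
  forall A, measurable A -> L1 (ind A) = L2 (ind A).
Proof.
move=> mG GI fin LT LG A; rewrite {1}mG; move: A.
apply: (dynkin_induction mG GI) => //.
- move=> A mA LA.
  have E L : integration_functional L -> L (ind setT) = L (ind A) + L (ind (~` A)).
    move=> IL; rewrite -(intfD IL); last 4 first.
    + exact: mind.
    + by apply: mind; apply: measurableC.
    + exact: ind0.
    + exact: ind0.
    congr L; apply/funext => z; rewrite /ind -EFinD; congr EFin.
    by rewrite !indicE in_setC in_setT; case: (z \in A); rewrite /= ?addr0 ?add0r.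
  have E1 := E _ IL1; have E2 := E _ IL2.
  have h1 : 0 <= L1 (ind A) by apply: (intf_ge0 IL1) => //; exact: mind.
  have h2 : 0 <= L1 (ind (~` A)).
    by apply: (intf_ge0 IL1) => //; apply: mind; exact: measurableC.
  have fA : L1 (ind A) \is a fin_num.
    rewrite ge0_fin_numE //; apply: le_lt_trans fin.
    by rewrite E1 leeDl.
  have : L1 (ind A) + L1 (ind (~` A)) = L1 (ind A) + L2 (ind (~` A)).
    by rewrite -E1 LT E2 LA.
  by move=> /(congr1 (fun y => y - L1 (ind A))); rewrite !(addeC (L1 (ind A))) !addeK.
- move=> F mF tF LF.
  have E L : integration_functional L ->
      L (ind (\bigcup_k F k)) = limn (fun n => \sum_(i < n) L (ind (F i))).
    move=> IL.
    transitivity (limn (fun n => L (ind (\big[setU/set0]_(i < n) F i)))).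
      rewrite -(intf_limn IL); last 3 first.
      + by move=> n; apply: mind; apply: bigsetU_measurable.
      + by move=> n; exact: ind0.
      + move=> z n m nm; rewrite /ind lee_fin !indicE ler_nat.
        have : \big[setU/set0]_(i < n) F i `<=` \big[setU/set0]_(i < m) F i.
          by apply: subset_bigsetU.
        move=> sub; case: (boolP (z \in \big[setU/set0]_(i < n) F i)) => // /set_mem zn.
        by rewrite (mem_set (sub _ zn)).
      congr L; apply/funext => z; apply/esym/cvg_lim => //.
      apply: cvg_near_cst.
      case: (pselect ((\bigcup_k F k) z)) => [zU|zU].
        have [k _ zk] := zU; exists k.+1 => // n /= kn.
        rewrite /ind !indicE (mem_set zU) mem_set //.
        by rewrite -bigcup_mkord; exists k.
      exists 0%N => // n _; rewrite /ind !indicE (memNset zU) memNset //.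
      by rewrite -bigcup_mkord => -[k _ zk]; apply: zU; exists k.
    by congr (limn _); apply/funext => n; rewrite intf_bigsetU.
  rewrite (E _ IL1) (E _ IL2); congr (limn _); apply/funext => n.
  by apply: eq_bigr => i _; rewrite LF.
Qed.

Import HBNNSimple.

Let intf_fimfun L (f : {nnsfun S >-> R}) : integration_functional L ->
  L (fun z => (f z)%:E) =
  \sum_(y <- finmap.enum_fset (fset_set (range f))) y%:E * L (ind (f @^-1` [set y])).
Proof.
move=> IL.
have r0 y : y \in finmap.enum_fset (fset_set (range f)) -> (0 <= y)%R.
  by rewrite in_fset_set // => /set_mem [z _ <-].
transitivity (L (fun z => \sum_(y <- finmap.enum_fset (fset_set (range f))) y%:E * ind (f @^-1` [set y]) z)).
  congr L; apply/funext => z; rewrite {1}fimfunE /= fsbig_finite //= -sumEFin.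
  by apply: eq_bigr => y _; rewrite EFinM.
move: r0; elim: (finmap.enum_fset (fset_set (range f))) => [_|y s IHs r0].
  rewrite big_nil -[RHS](intf0 IL); congr L; apply/funext => z /=; by rewrite big_nil.
have y0 : (0 <= y)%R by apply: r0; rewrite inE eqxx.
have r0' y' : y' \in s -> (0 <= y')%R by move=> ys; apply: r0; rewrite inE ys orbT.
have mi y' : measurable_fun setT (ind (f @^-1` [set y'])) by exact: mind.
rewrite big_cons -IHs // -(intfZ IL) // -(intfD IL).
- by congr L; apply/funext => z; rewrite big_cons.
- by apply: emeasurable_funM.
- apply: emeasurable_sum => y'; exact: emeasurable_funM.
- by move=> z; apply: mule_ge0.
- move=> z; rewrite big_seq; apply: sume_ge0 => y' /r0' y'0; exact: mule_ge0.
Qed.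

(** Linearity reaches simple functions and monotone convergence the nonnegative ones. Kept apart
    from the pi-lambda step so as to apply to functionals of infinite total mass, such as those
    weighted by an arbitrary nonnegative function. *)
Lemma intf_eq_fun : (forall A, measurable A -> L1 (ind A) = L2 (ind A)) ->
  forall f, measurable_fun setT f -> (forall z, 0 <= f z) -> L1 f = L2 f.
Proof.
move=> LA f mf f0.
pose g := nnsfun_approx measurableT mf.
have E L : integration_functional L -> L f = limn (fun n => L (fun z => (g n z)%:E)).
  move=> IL; rewrite -(intf_limn IL); last 3 first.
  - by move=> n; apply/measurable_EFinP.
  - by move=> n z; rewrite lee_fin.
  - by move=> z n m nm; rewrite lee_fin; exact/lefP/nd_nnsfun_approx.
  congr L; apply/funext => z; apply/esym/cvg_lim => //.
  exact: cvg_nnsfun_approx.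
rewrite (E _ IL1) (E _ IL2); congr (limn _); apply/funext => n.
rewrite !intf_fimfun //; apply: eq_bigr => y _; congr (_ * _).
exact: LA.
Qed.

Lemma intf_unique (G : set (set S)) :
  (@measurable _ S) = <<s G >> -> setI_closed G -> L1 (ind setT) < +oo ->
  L1 (ind setT) = L2 (ind setT) ->
  (forall A, G A -> L1 (ind A) = L2 (ind A)) ->
  forall f, measurable_fun setT f -> (forall z, 0 <= f z) -> L1 f = L2 f.
Proof.
move=> mG GI fin LT LG; apply: intf_eq_fun.
exact: (intf_eq_measurable mG GI fin LT LG).
Qed.

End IntegrationFunctional.

Section IntegrationFunctionalTheory.
Context {R : realType} d d' (S : measurableType d) (T : measurableType d').
Local Open Scope ereal_scope.

Lemma intf_integral (mu : {measure set T -> \bar R}) (D : set T) (phi : T -> S) :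
  measurable D -> measurable_fun D phi ->
  integration_functional (fun f => \int[mu]_(x in D) f (phi x)).
Proof.
move=> mD mphi.
have mc f : measurable_fun setT f -> measurable_fun D (fun x => f (phi x) : \bar R).
  by move=> mf; exact: measurableT_comp mf mphi.
split.
- by move=> f _ f0; exact: integral_ge0.
- by move=> f g mf mg f0 g0; apply: ge0_integralD => //; exact: mc.
- by move=> k f k0 mf f0; apply: ge0_integralZl_EFin => //; exact: mc.
- move=> f g mf mg f0 fg; apply: ge0_le_integral => //; exact: mc.
- move=> f mf f0 ndf; apply: (@monotone_convergence _ _ _ mu _ mD (fun n x => f n (phi x))).
  + by move=> n; exact: mc.
  + by move=> n x _; exact: f0.
  + by move=> x _; exact: ndf.
Qed.

(** Mixing a measurable family of functionals against a density gives a functional again, as for the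
    composition of a measure with a kernel. The nested integrals over paths, birth times and fission
    times are assembled from it. *)
Lemma intf_bind (mu : {measure set T -> \bar R}) (D : set T) (w : T -> \bar R)
    (L : T -> (S -> \bar R) -> \bar R) :
  measurable D -> measurable_fun D w -> (forall x, 0 <= w x) ->
  (forall x, integration_functional (L x)) ->
  (forall f, measurable_fun setT f -> (forall z, 0 <= f z) ->
     measurable_fun D (fun x => L x f)) ->
  integration_functional (fun f => \int[mu]_(x in D) (w x * L x f)).
Proof.
move=> mD mw w0 IL mL.
have mwL f : measurable_fun setT f -> (forall z, 0 <= f z) ->
    measurable_fun D (fun x => w x * L x f).
  by move=> mf f0; apply: emeasurable_funM => //; exact: mL.
have L0 x f : measurable_fun setT f -> (forall z, 0 <= f z) -> 0 <= L x f.
  by move=> mf f0; exact: (intf_ge0 (IL x)).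
have wL0 x f : measurable_fun setT f -> (forall z, 0 <= f z) -> 0 <= w x * L x f.
  by move=> mf f0; rewrite mule_ge0 // L0.
split.
- by move=> f mf f0; apply: integral_ge0 => x _; exact: wL0.
- move=> f g mf mg f0 g0; rewrite -ge0_integralD //; last 4 first.
  + by move=> x _; exact: wL0.
  + exact: mwL.
  + by move=> x _; exact: wL0.
  + exact: mwL.
  apply: eq_integral => x _; rewrite (intfD (IL x)) // ge0_muleDr //; exact: L0.
- move=> k f k0 mf f0; rewrite -ge0_integralZl_EFin //; last 2 first.
  + by move=> x _; exact: wL0.
  + exact: mwL.
  apply: eq_integral => x _; rewrite (intfZ (IL x)) //.
  by rewrite muleCA.
- move=> f g mf mg f0 fg.
  have g0 z : 0 <= g z by apply: le_trans (f0 z) (fg z).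
  apply: ge0_le_integral => //.
  + by move=> x _; exact: wL0.
  + exact: mwL.
  + exact: mwL.
  + by move=> x _; rewrite lee_wpmul2l // (le_intf (IL x)).
- move=> f mf f0 ndf.
  have ndL x n m : (n <= m)%N -> L x (f n) <= L x (f m).
    by move=> nm; apply: (le_intf (IL x)) => // z; exact: ndf.
  rewrite -[RHS](@monotone_convergence _ _ _ mu _ mD (fun n x => w x * L x (f n))); last 3 first.
  + by move=> n; exact: mwL.
  + by move=> n x _; exact: wL0.
  + by move=> x _ n m nm; rewrite lee_wpmul2l // ndL.
  apply: eq_integral => x _; rewrite (intf_limn (IL x)) // mule_limn //.
  - by move=> n; exact: L0.
  - by move=> n m; exact: ndL.
Qed.

End IntegrationFunctionalTheory.

(** * Iterated integrals *)

Section LebesgueIntervals.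
Context {R : realType}.
Local Open Scope ereal_scope.
Local Notation leb := (@lebesgue_measure R).

(** Moves the interval into the integrand, so that Tonelli applies when the endpoints depend on
    another variable of integration. *)
Lemma integral_itv_if (f : R -> \bar R) a b :
  \int[leb]_(x in `[a, b]%classic) f x =
  \int[leb]_x (if (a <= x <= b)%R then f x else 0).
Proof.
rewrite integral_mkcond; apply: eq_integral => x _; rewrite patchE.
by rewrite mem_setE in_itv.
Qed.

(** The pushforward under the translation agrees with Lebesgue measure on half-open intervals, which
    determine the latter. *)
Lemma integral_shift (f : R -> \bar R) (c : R) : measurable_fun setT f ->
  (forall r, 0 <= f r) -> \int[leb]_x f (x + c)%R = \int[leb]_x f x.
Proof.
move=> mf f0.
pose phi : measurableTypeR R -> measurableTypeR R := fun x => (x + c)%R.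
have mphi : measurable_fun setT phi by exact: measurable_funD.
transitivity (\int[pushforward leb phi]_x f x).
  by rewrite ge0_integral_pushforward.
apply: eq_measure_integral => A mA _.
apply/esym; apply: (@lebesgue_measure_unique R (pushforward leb phi)) => //.
move=> _ [[a b]] /= _ <-; rewrite /pushforward.
have -> : phi @^-1` `]a, b] = `](a - c)%R, (b - c)%R]%classic.
  by apply/seteqP; split => x /=; rewrite !in_itv /= /phi ltrBlDr lerBrDr.
rewrite !lebesgue_measure_itv /= !lte_fin ltrD2r.
by case: ifP => // _; rewrite -!EFinB; congr EFin; rewrite opprB addrA subrK.
Qed.

Lemma measurable_fun_integral_itv d (Z : measurableType d) (a b : Z -> R)
    (h : Z * R -> \bar R) : measurable_fun setT a -> measurable_fun setT b ->
  measurable_fun setT h -> (forall z, 0 <= h z) ->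
  measurable_fun setT (fun z => \int[leb]_(s in `[a z, b z]%classic) h (z, s)).
Proof.
move=> ma mb mh h0.
pose k (q : Z * R) := if (a q.1 <= q.2)%R && (q.2 <= b q.1)%R then h q else 0.
have k0 q : 0 <= k q by rewrite /k; case: ifP.
have mk : measurable_fun setT k.
  apply: measurable_fun_ifT => //.
  apply: measurable_and; apply: measurable_fun_ler; try exact: measurable_snd.
    exact: measurableT_comp ma measurable_fst.
  exact: measurableT_comp mb measurable_fst.
rewrite (_ : (fun z => _) = (fun z => \int[leb]_s k (z, s))); last first.
  by apply/funext => z; rewrite integral_itv_if.
exact: (@measurable_fun_fubini_tonelli_F _ _ _ _ _ leb k mk k0).
Qed.

(** The integral of [f s_1 * ... * f s_n] over the ordered simplex [0 <= s_n <= ... <= s_1 <= r];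
    the outermost variable is the latest time. *)
Fixpoint iterated_integral (f : R -> \bar R) n (r : R) : \bar R :=
  if n is n'.+1 then
    \int[leb]_(s in `[0%R, r]%classic) (f s * iterated_integral f n' s)
  else 1.

Section IteratedIntegral.
Variable f : R -> \bar R.
Hypotheses (mf : measurable_fun setT f) (f0 : forall r, 0 <= f r).
Local Notation I := (iterated_integral f).

Lemma iterated_integral_rec n r :
  I n.+1 r = \int[leb]_(s in `[0%R, r]%classic) (f s * I n s).
Proof. by []. Qed.

Lemma iterated_integral_ge0 n r : 0 <= I n r.
Proof.
by elim: n r => //= n IHn r; apply: integral_ge0 => s _; rewrite mule_ge0.
Qed.

Lemma measurable_iterated_integral n : measurable_fun setT (I n).
Proof.
elim: n => [|n IHn] /=; first exact: measurable_cst.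
apply: (@measurable_fun_integral_itv _ R (cst 0%R) idfun (fun q => f q.2 * I n q.2)) => //.
- exact: measurable_id.
- by apply: emeasurable_funM; apply: measurableT_comp => //; exact: measurable_snd.
- by move=> z; rewrite mule_ge0 // iterated_integral_ge0.
Qed.

Let mfI n : measurable_fun setT (fun s => f s * I n s).
Proof. by apply: emeasurable_funM => //; exact: measurable_iterated_integral. Qed.

Let fI0 n s : 0 <= f s * I n s.
Proof. by rewrite mule_ge0 // iterated_integral_ge0. Qed.

Lemma iterated_integral_split s r : (0 <= s <= r)%R ->
  I 1 r = I 1 s + \int[leb]_(q in `[s, r]%classic) f q.
Proof.
move=> /andP[s0 sr] /=.
rewrite (@itv_bndbnd_setU _ _ (BLeft 0%R) (BLeft s)) ?bnd_simp //.
rewrite ge0_integral_setU //; last 3 first.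
- by apply: measurable_funTS; exact: (mfI 0).
- by move=> x _; exact: (fI0 0).
- rewrite disj_set2E; apply/eqP/seteqP; split => // x [] /=.
  by rewrite !in_itv /= => /andP[_ xs] /andP[]; rewrite leNgt xs.
congr (_ + _).
  by apply: integral_itv_bndo_bndc; apply: measurable_funTS; exact: (mfI 0).
by apply: eq_integral => q _; rewrite mule1.
Qed.

(* Tonelli on the triangle {s <= q <= r} replaces the integration by parts that
   would need the derivative of the running integral I 1. *)
Lemma iterated_integralS n r : (0 <= r)%R ->
  n.+1%:R%:E * I n.+1 r = I 1 r * I n r.
Proof.
elim: n r => [|n IHn] r r0; first by rewrite mul1e /= mule1.
have tri : \int[leb]_(s in `[0%R, r]%classic)
      (f s * I n s * \int[leb]_(q in `[s, r]%classic) f q) = I n.+2 r.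
  transitivity (\int[leb]_s \int[leb]_q
      (if [&& (0 <= s)%R, (s <= q)%R & (q <= r)%R] then f q * (f s * I n s) else 0)).
    rewrite integral_itv_if; apply: eq_integral => s _.
    case: ifPn => [/andP[s0 sr]|sr].
      rewrite muleC -ge0_integralZr //; last exact: measurable_funTS.
      rewrite integral_itv_if; apply: eq_integral => q _.
      by rewrite s0.
    rewrite integral0_eq // => q _; case: ifPn => // /and3P[s0 sq qr].
    by move: sr; rewrite s0 (le_trans sq).
  pose h (z : R * R) := if [&& (0 <= z.1)%R, (z.1 <= z.2)%R & (z.2 <= r)%R]
    then f z.2 * (f z.1 * I n z.1) else 0.
  transitivity (\int[leb]_q \int[leb]_s h (s, q)).
    apply: (@fubini_tonelli _ _ _ _ _ leb leb h).
      apply: measurable_fun_ifT => //.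
        by apply: measurable_and; last apply: measurable_and;
          apply: measurable_fun_ler => //; exact: measurable_fst || exact: measurable_snd.
      apply: emeasurable_funM; first exact: measurableT_comp mf measurable_snd.
      exact: measurableT_comp (mfI n) measurable_fst.
    by move=> z; rewrite /h; case: ifP => // _; rewrite mule_ge0.
  rewrite iterated_integral_rec [RHS]integral_itv_if; apply: eq_integral => q _.
  case: ifPn => [/andP[q0 qr]|qr].
    rewrite iterated_integral_rec -ge0_integralZl //; last by apply: measurable_funTS; exact: mfI.
    rewrite integral_itv_if; apply: eq_integral => s _.
    by rewrite /h /= qr andbT.
  rewrite integral0_eq // => s _; rewrite /h /=; case: ifPn => // /and3P[s0 sq qr'].
  by move: qr; rewrite qr' (le_trans s0).
(* One copy of [I n.+2 r] is, by [tri], the integral of [f s * I n s] against the tail of [f] over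
   [[s, r]]. The other [n.+1] copies are, by induction, its integral against [I 1 s]. Head and tail
   add up to the constant [I 1 r]. *)
rewrite -natr1 EFinD ge0_muleDl ?lee_fin // mul1e -{2}tri.
have -> : n.+1%:R%:E * I n.+2 r = \int[leb]_(s in `[0%R, r]%classic) (f s * I n s * I 1 s).
  rewrite iterated_integral_rec -ge0_integralZl //; last by apply: measurable_funTS; exact: mfI.
  apply: eq_integral => s; rewrite inE /= in_itv /= => /andP[s0 _].
  by rewrite muleCA IHn // [I 1 s * _]muleC muleA.
rewrite -ge0_integralD //.
- have -> : I 1 r * I n.+1 r = \int[leb]_(s in `[0%R, r]%classic) (I 1 r * (f s * I n s)).
    rewrite ge0_integralZl //; first by apply: measurable_funTS; exact: mfI.
    exact: iterated_integral_ge0.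
  apply: eq_integral => s; rewrite inE /= in_itv /= => s0r.
  rewrite -ge0_muleDr; [|exact: (iterated_integral_ge0 1)|exact: integral_ge0].
  by rewrite -iterated_integral_split // muleC.
- by move=> s _; rewrite mule_ge0 // iterated_integral_ge0.
- apply: measurable_funTS; apply: emeasurable_funM; first exact: mfI.
  exact: measurable_iterated_integral.
- by move=> s _; rewrite mule_ge0 //; apply: integral_ge0.
- apply: measurable_funTS; apply: emeasurable_funM; first exact: mfI.
  have mtail : measurable_fun setT (fun x : R => \int[leb]_(q in `[x, r]%classic) f q).
    apply: (@measurable_fun_integral_itv _ R idfun (cst r) (fun q => f q.2)) => //.
    + exact: measurable_id.
    + exact: measurableT_comp mf measurable_snd.
  exact: mtail.
Qed.

Lemma sum_iterated_integral r : (0 <= r)%R -> I 1 r < +oo ->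
  \sum_(0 <= n <oo) I n r = (expR (fine (I 1 r)))%:E.
Proof.
move=> r0 Ir; set F := fine (I 1 r).
have IF : I 1 r = F%:E by rewrite fineK // ge0_fin_numE // iterated_integral_ge0.
have E n : I n r = (exp_coeff F n)%:E.
  elim: n => [|n IHn]; first by rewrite /exp_coeff /= expr0 fact0 divr1.
  have n0 : n.+1%:R != 0%R :> R by rewrite pnatr_eq0.
  have := iterated_integralS n r0; rewrite IHn IF => /(congr1 (fun y => (n.+1%:R^-1)%:E * y)).
  rewrite muleA -!EFinM mulVf // mul1e => ->; congr EFin.
  rewrite /exp_coeff /= factS natrM invfM exprS -!mulrA mulrCA; congr (_ * _)%R.
  by rewrite mulrCA.
transitivity (limn (EFin \o series (exp_coeff F))).
  congr (limn _); apply/funext => n /=; rewrite /series /= -sumEFin.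
  by apply: eq_bigr => k _; exact: E.
by rewrite -EFin_lim //; exact: is_cvg_series_exp_coeff.
Qed.

End IteratedIntegral.
End LebesgueIntervals.

(** * Sums over lines of descent *)

Section LineSums.
Context {R : realType}.
Local Open Scope ereal_scope.
Local Notation leb := (@lebesgue_measure R).
Implicit Types (l : seq (nat * nat)) (F G : seq (nat * nat) -> \bar R).

Lemma nneseriesZr (u : nat -> \bar R) (y : \bar R) :
  (forall n, 0 <= u n) -> 0 <= y ->
  \sum_(0 <= n <oo) (u n * y) = (\sum_(0 <= n <oo) u n) * y.
Proof.
move=> u0 y0; rewrite [RHS]muleC mule_limn //.
- congr (limn _); apply/funext => n; rewrite ge0_sume_distrr //.
  by apply: eq_bigr => k _; rewrite muleC.
- by move=> n; exact: sume_ge0.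
- exact: ereal_nondecreasing_series.
Qed.

(* A line of descent is the list, last particle first, of the pairs (j, a) such
   that an ancestor has 1 + a children and the next one is the child j + 1. *)
Definition fits l := all (fun ja => (ja.1 <= ja.2)%N) l.

(** Nested series, one brood size and one child index per generation, so that a sum over lines can
    be evaluated generation by generation; only lines that fit are produced. *)
Fixpoint sum_lines n F : \bar R :=
  if n is n'.+1 then
    \sum_(0 <= a <oo) \sum_(j < a.+1) sum_lines n' (fun l => F ((val j, a) :: l))
  else F [::].

Lemma eq_sum_lines n F G :
  (forall l, size l = n -> fits l -> F l = G l) -> sum_lines n F = sum_lines n G.
Proof.
elim: n F G => [|n IHn] F G FG /=; first exact: FG.
apply: eq_eseriesr => a _; apply: eq_bigr => j _; apply: IHn => l sl fl.
by apply: FG; rewrite /= ?sl // -ltnS ltn_ord.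
Qed.

Lemma sum_lines_ge0 n F : (forall l, 0 <= F l) -> 0 <= sum_lines n F.
Proof.
elim: n F => [|n IHn] F F0 /=; first exact: F0.
by apply: nneseries_ge0 => a _ _; apply: sume_ge0 => j _; exact: IHn.
Qed.

Lemma sum_lines0 n : sum_lines n (fun=> 0) = 0.
Proof.
elim: n => //= n IHn; rewrite eseries0 // => a _ _; by rewrite big1.
Qed.

Lemma sum_linesD n F G : (forall l, 0 <= F l) -> (forall l, 0 <= G l) ->
  sum_lines n (fun l => F l + G l) = sum_lines n F + sum_lines n G.
Proof.
elim: n F G => [|n IHn] F G F0 G0 //=.
rewrite -nneseriesD => [|a _ _|a _ _]; last 2 first.
- by apply: sume_ge0 => j _; exact: sum_lines_ge0.
- by apply: sume_ge0 => j _; exact: sum_lines_ge0.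
apply: eq_eseriesr => a _; rewrite -big_split; apply: eq_bigr => j _.
exact: IHn.
Qed.

Lemma sum_linesZr n F y : (forall l, 0 <= F l) -> 0 <= y ->
  sum_lines n (fun l => F l * y) = sum_lines n F * y.
Proof.
elim: n F => [|n IHn] F F0 y0 //=.
rewrite -nneseriesZr // => [|a]; last first.
  by apply: sume_ge0 => j _; exact: sum_lines_ge0.
apply: eq_eseriesr => a _; rewrite ge0_sume_distrl => [|j _]; last exact: sum_lines_ge0.
by apply: eq_bigr => j _; rewrite IHn.
Qed.

(** A line of the right length that fits occurs exactly once in the nested sum. This turns a sum
    over living particles into a sum over lines. *)
Lemma sum_lines_delta n l0 (c : \bar R) : 0 <= c ->
  sum_lines n (fun l => if l == l0 then c else 0) =
  if (size l0 == n) && fits l0 then c else 0.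
Proof.
move=> c0; elim: n l0 => [|n IHn] l0 /=; first by case: l0.
case: l0 => [|[j0 a0] l0] /=; first by rewrite eseries0 // => a _ _; rewrite big1 // => j _; exact: sum_lines0.
rewrite eqSS; set v := if _ then c else 0.
have v0 : 0 <= v by rewrite /v; case: ifP.
transitivity (\sum_(0 <= a <oo) if a == a0 then v else 0).
  apply: eq_eseriesr => a _; have [->|aa0] := eqVneq a a0; last first.
    rewrite big1 // => j _; rewrite -[RHS](sum_lines0 n); apply: eq_sum_lines => l _ _.
    by rewrite eqseq_cons xpair_eqE (negbTE aa0) andbF.
  have E (j : 'I_a0.+1) : sum_lines n (fun l => if (val j, a0) :: l == (j0, a0) :: l0 then c else 0) =
      if val j == j0 then (if (size l0 == n) && fits l0 then c else 0) else 0.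
    have [jj0|jj0] := eqVneq (val j) j0.
      rewrite -IHn; apply: eq_sum_lines => l _ _.
      by rewrite eqseq_cons xpair_eqE jj0 !eqxx.
    rewrite -[RHS](sum_lines0 n); apply: eq_sum_lines => l _ _.
    by rewrite eqseq_cons xpair_eqE (negbTE jj0).
  rewrite (eq_bigr _ (fun j _ => E j)) /v.
  have [ja|ja] := leqP j0 a0; last first.
    rewrite andbF big1 // => j _; case: eqP => // jE.
    by rewrite -jE ltnNge -ltnS ltn_ord in ja.
  rewrite (bigD1 (Ordinal (ja : (j0 < a0.+1)%N))) //= eqxx big1 ?adde0 // => j.
  by rewrite -val_eqE /= => /negbTE ->.
apply: cvg_lim => //; apply: cvg_near_cst; exists a0.+1 => // m /= am.
by rewrite -big_mkcond big_nat1_eq am.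
Qed.

(** Measurability and interchange go together, since each step of the induction uses the
    measurability of the inner sums. *)
Lemma ge0_integral_sum_lines d (T : measurableType d)
    (mu : {measure set T -> \bar R}) (D : set T) n
    (F : seq (nat * nat) -> T -> \bar R) : measurable D ->
  (forall l, measurable_fun D (F l)) -> (forall l x, 0 <= F l x) ->
  measurable_fun D (fun x => sum_lines n (F ^~ x)) /\
  \int[mu]_(x in D) sum_lines n (F ^~ x) =
  sum_lines n (fun l => \int[mu]_(x in D) F l x).
Proof.
move=> mD; elim: n F => [|n IHn] F mF F0 //=.
have mS a j := (IHn (fun l => F ((j, a) :: l)) (fun l => mF _) (fun l x => F0 _ x)).1.
have IS a j := (IHn (fun l => F ((j, a) :: l)) (fun l => mF _) (fun l x => F0 _ x)).2.
have S0 a j x : 0 <= sum_lines n (fun l => F ((j, a) :: l) x) by exact: sum_lines_ge0.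
have mSS a : measurable_fun D (fun x => \sum_(j < a.+1) sum_lines n (fun l => F ((val j, a) :: l) x)).
  by apply: emeasurable_sum => j; exact: mS.
split.
  apply: (@ge0_emeasurable_sum _ _ _ D (fun a x => \sum_(j < a.+1) sum_lines n (fun l => F ((val j, a) :: l) x)) xpredT) => //.
  by move=> a x _ _; apply: sume_ge0.
rewrite integral_nneseries // => [|a x _]; last exact: sume_ge0.
apply: eq_eseriesr => a _; rewrite ge0_integral_sum //.
by apply: eq_bigr => j _; rewrite IS.
Qed.

(* The rate h a of a fission into 1 + a children is integrated over the
   simplex of successive fission times. *)
Fixpoint line_integral (h : nat -> R -> R) l (s : R) : \bar R :=
  if l is ja :: l' then
    \int[leb]_(r in `[0%R, s]%classic) ((h ja.2 r)%:E * line_integral h l' r)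
  else 1.

Definition line_weight (g : nat -> R) l : R := (\prod_(ja <- l) g ja.2)%R.

Lemma line_integral_ge0 h l s : (forall a r, 0 <= h a r)%R -> 0 <= line_integral h l s.
Proof.
move=> h0; elim: l s => //= ja l IHl s; apply: integral_ge0 => r _.
by rewrite mule_ge0 // lee_fin.
Qed.

Lemma measurable_line_integral d (Z : measurableType d) (h : nat -> Z * R -> R) l :
  (forall a, measurable_fun setT (h a)) -> (forall a z, 0 <= h a z)%R ->
  measurable_fun setT (fun z : Z * R => line_integral (fun a r => h a (z.1, r)) l z.2).
Proof.
move=> mh h0; elim: l => [|ja l IHl] /=; first exact: measurable_cst.
have m1 : measurable_fun setT (fun q : (Z * R) * R => (q.1.1, q.2)).
  apply/measurable_fun_pairP; split => /=.
    exact: measurableT_comp measurable_fst measurable_fst.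
  exact: measurable_snd.
apply: (@measurable_fun_integral_itv R _ _ (cst 0%R) snd
  (fun q => (h ja.2 (q.1.1, q.2))%:E * line_integral (fun a r => h a (q.1.1, r)) l q.2)) => //.
- apply: emeasurable_funM.
    by apply/measurable_EFinP; exact: measurableT_comp (mh _) m1.
  exact: measurableT_comp IHl m1.
- by move=> z; rewrite mule_ge0 ?lee_fin // line_integral_ge0.
Qed.

(** Neither the weight nor the integral sees the child index [j], so a fission into [1 + a] children
    counts [a.+1] times; the sum over [a] is then taken inside the integral and only one total rate
    is left. *)
Lemma sum_line_integral (g : nat -> R) (h : nat -> R -> R) n s :
  (forall a, 0 <= g a)%R -> (forall a, measurable_fun setT (h a)) ->
  (forall a r, 0 <= h a r)%R ->
  sum_lines n (fun l => (line_weight g l)%:E * line_integral h l s) =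
  iterated_integral
    (fun r => \sum_(0 <= a <oo) (a.+1%:R * g a * h a r)%:E) n s.
Proof.
move=> g0 mh h0.
have W0 l : (0 <= line_weight g l)%R by apply: prodr_ge0.
have mJ l : measurable_fun setT (line_integral h l).
  have mpair : measurable_fun setT (fun r : R => (tt, r)).
    exact: pair1_measurable.
  have mh' a : measurable_fun setT (fun q : unit * R => h a q.2).
    exact: measurableT_comp (mh a) measurable_snd.
  have := measurable_line_integral l mh' (fun a q => h0 a q.2).
  by move=> /measurableT_comp /(_ mpair).
elim: n s => [|n IHn] s /=; first by rewrite /line_weight big_nil mule1.
have mWJ a l : measurable_fun setT
    (fun r => (g a * h a r * line_weight g l)%:E * line_integral h l r).
  apply: emeasurable_funM => //; apply/measurable_EFinP.
  by apply: measurable_funM => //; apply: measurable_funM.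
have mhJ a l : measurable_fun setT (fun r => (h a r)%:E * line_integral h l r).
  by apply: emeasurable_funM => //; apply/measurable_EFinP.
have WJ0 a l r : 0 <= (g a * h a r * line_weight g l)%:E * line_integral h l r.
  by rewrite mule_ge0 ?line_integral_ge0 // lee_fin !mulr_ge0.
have IS a := @ge0_integral_sum_lines _ _ leb `[0%R, s]%classic n
  (fun l r => (g a * h a r * line_weight g l)%:E * line_integral h l r)
  (measurable_itv _) (fun l => measurable_funTS (mWJ a l)) (WJ0 a).
have S0 a r : 0 <= sum_lines n (fun l => (g a * h a r * line_weight g l)%:E * line_integral h l r).
  by apply: sum_lines_ge0 => l; exact: WJ0.
transitivity (\sum_(0 <= a <oo) \int[leb]_(r in `[0%R, s]%classic)
    (a.+1%:R%:E * sum_lines n (fun l => (g a * h a r * line_weight g l)%:E * line_integral h l r))).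
  apply: eq_eseriesr => a _.
  rewrite ge0_integralZl //; last exact: (IS a).1.
  rewrite (IS a).2; set v := sum_lines _ _.
  have v0 : 0 <= v by apply: sum_lines_ge0 => l; apply: integral_ge0 => r _; exact: WJ0.
  have E (j : 'I_a.+1) : sum_lines n (fun l => (line_weight g ((val j, a) :: l))%:E *
      (\int[leb]_(r in `[0%R, s]%classic) ((h a r)%:E * line_integral h l r))) = 1 * v.
    rewrite mul1e; apply: eq_sum_lines => l _ _.
    rewrite -ge0_integralZl //; last 3 first.
    - by apply: measurable_funTS; exact: mhJ.
    - by move=> r _; rewrite mule_ge0 ?line_integral_ge0 // lee_fin.
    - by rewrite lee_fin /line_weight prodr_ge0.
    apply: eq_integral => r _; rewrite /line_weight big_cons muleA -EFinM.
    by congr (_%:E * _); rewrite mulrAC.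
  rewrite (eq_bigr _ (fun j _ => E j)) -ge0_sume_distrl //.
  by rewrite sumEFin sumr_const card_ord.
rewrite -integral_nneseries //; last 2 first.
- by move=> a; apply: emeasurable_funM => //; exact: (IS a).1.
- by move=> a r _; rewrite mule_ge0.
apply: eq_integral => r _; rewrite -IHn -nneseriesZr; last 2 first.
- by move=> a; rewrite lee_fin !mulr_ge0.
- by apply: sum_lines_ge0 => l; rewrite mule_ge0 ?lee_fin // line_integral_ge0.
apply: eq_eseriesr => a _; rewrite -mulrA EFinM -muleA; congr (_ * _).
rewrite muleC -sum_linesZr //; last by rewrite lee_fin mulr_ge0.
  by apply: eq_sum_lines => l _ _; rewrite [RHS]muleC muleA -EFinM.
by move=> l; rewrite mule_ge0 ?lee_fin // line_integral_ge0.
Qed.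

End LineSums.

(** * Trajectories *)

Section PathEvaluation.
Context {R : realType} {d : measure_display} {J : measurableType d}.
Variables (W : path_class R J) (HW : progressively_measurable W).
Local Notation cyl_upto T := (@cylinders_upto R d J W T).
Local Notation cyl := (@cylinders R d J W).

Lemma measurable_fun_g_sigma d' (Z : measurableType d') (T : pointedType)
    (G : set (set T)) (D : set Z) (f : Z -> g_sigma_algebraType G) :
  measurable D -> (forall A, G A -> measurable (D `&` f @^-1` A)) ->
  measurable_fun D f.
Proof.
move=> mD mG; apply: (@measurability _ _ Z (g_sigma_algebraType G) D f G) => // _ [A GA <-].
exact: mG.
Qed.

Lemma measurable_fun_pairW d0 d1 d2 (Z : measurableType d0) (T1 : measurableType d1)
    (T2 : measurableType d2) (D : set Z) (f : Z -> T1) (g : Z -> T2) :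
  measurable_fun D f -> measurable_fun D g ->
  measurable_fun D (fun z => (f z, g z)).
Proof.
move=> mf mg mD; apply: (measurability _ (measurable_prod_measurableType T1 T2)) => //.
move=> _ [_ [A mA [B mB <-]] <-].
rewrite (_ : _ `&` _ = (D `&` f @^-1` A) `&` (D `&` g @^-1` B)).
  by apply: measurableI; [exact: mf|exact: mg].
by apply/seteqP; split => z /= => [[Dz [Az Bz]]|[[Dz Az] [_ Bz]]].
Qed.

(** Evaluation at a random time factors through [z |-> (tau z, X z)], to which progressive
    measurability applies; about [X] only the positions at deterministic times up to [T] have to be
    measurable. *)
Lemma measurable_eval d' (Z : measurableType d') (D : set Z) (tau : Z -> R)
    (X : Z -> sample_path W) (T : R) (B : set J) :
  0 <= T -> measurable D -> measurable_fun D tau ->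
  (forall s B, 0 <= s <= T -> measurable B ->
     measurable (D `&` [set z | B (X z s)])) ->
  measurable B ->
  measurable (D `&` [set z | 0 <= tau z <= T /\ B (X z (tau z))]).
Proof.
move=> T0 mD mtau mX mB.
have mX' : measurable_fun D (X : Z -> g_sigma_algebraType (cyl_upto T)).
  apply: measurable_fun_g_sigma => // _ [s [B' [sT mB' ->]]]; exact: mX.
exact: (measurable_fun_pairW mtau mX') mD _ (HW T0 mB).
Qed.

(** The path is observable before [sigma] only. A rational [q] is inserted between [tau] and
    [sigma]: on the event [q < sigma] the path up to [q] is measurable, so [measurable_eval] applies
    with [T = q], and countably many [q] suffice. *)
Lemma measurable_eval_killed d' (Z : measurableType d') (D : set Z)
    (sigma tau : Z -> R) (X : Z -> sample_path W) (B : set J) :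
  measurable D -> measurable_fun D sigma -> measurable_fun D tau ->
  (forall s B, 0 <= s -> measurable B ->
     measurable (D `&` [set z | s < sigma z /\ B (X z s)])) ->
  measurable B ->
  measurable (D `&` [set z | 0 <= tau z < sigma z /\ B (X z (tau z))]).
Proof.
move=> mD msigma mtau mX mB.
pose DT (q : rat) := D `&` [set z | ratr q < sigma z].
have mDT q : measurable (DT q).
  rewrite /DT -[[set z | _]]/(sigma @^-1` [set y | ratr q < y]).
  apply: msigma => //.
  rewrite (_ : [set y | _] = `]ratr q, +oo[%classic) //.
  by apply/seteqP; split => y /=; rewrite in_itv /= andbT.
rewrite (_ : _ `&` _ = \bigcup_(q : rat)
    (if (0 <= ratr q :> R) then
      DT q `&` [set z | 0 <= tau z <= ratr q /\ B (X z (tau z))] else set0)).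
  apply: bigcupT_measurable_rat => q; case: ifPn => // q0.
  apply: measurable_eval => //.
    by apply: measurable_funS mtau => // z [].
  move=> s B' /andP[s0 sq] mB'.
  rewrite (_ : _ `&` _ = DT q `&` (D `&` [set z | s < sigma z /\ B' (X z s)])).
    by apply: measurableI => //; exact: mX.
  apply/seteqP; split => z /=.
    by move=> [[Dz qz] Bz]; do !split=> //; exact: le_lt_trans qz.
  by move=> [[Dz qz] [_ [_ Bz]]].
apply/seteqP; split => z /=.
  move=> [Dz [/andP[t0 ts] Bz]].
  have [q] := rat_in_itvoo ts; rewrite in_itv /= => /andP[tq qs].
  exists q => //; rewrite (le_trans t0 (ltW tq)); split => //.
  by rewrite /= t0 (ltW tq).
move=> [q _]; case: ifPn => // q0 [[Dz qz] [/andP[t0 tq] Bz]].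
by split => //; rewrite t0 (le_lt_trans tq).
Qed.

(** The path is regarded as killed at [tau + 1], later than the evaluation time; this covers an
    unbounded [tau]. *)
Lemma measurable_fun_eval d' (Z : measurableType d') (tau : Z -> R)
    (X : Z -> pathT W) :
  measurable_fun setT X -> measurable_fun setT tau -> (forall z, 0 <= tau z) ->
  measurable_fun setT (fun z => path_fun (X z) (tau z)).
Proof.
move=> mX mtau tau0 _ B mB.
have := @measurable_eval_killed _ Z setT (fun z => tau z + 1) tau X B measurableT
  (measurable_funD mtau (@measurable_cst _ _ _ R setT 1)) mtau.
rewrite (_ : [set z | 0 <= tau z < tau z + 1 /\ _] = (fun z => path_fun (X z) (tau z)) @^-1` B).
  apply=> // s B' s0 mB'.
  rewrite (_ : [set z | _] = (fun z => tau z + 1) @^-1` `]s, +oo[%classic `&`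
                             X @^-1` [set w | B' (path_fun w s)]).
    rewrite setIA; apply: measurableI.
      apply: (measurable_funD mtau (@measurable_cst _ _ _ R setT 1)) => //.
    rewrite -[X in measurable X]setTI; apply: mX => //.
    apply: sub_sigma_algebra; exists s => //; exists s, B'; split=> //.
    by rewrite s0 lexx.
  by apply/seteqP; split => z /=; rewrite in_itv /= andbT.
apply/seteqP; split => z /=; first by case.
by move=> Bz; rewrite tau0 ltrDl ltr01.
Qed.

Lemma measurable_fun_eval_upto d' (Z : measurableType d') (T : R) (tau : Z -> R)
    (X : Z -> g_sigma_algebraType (cyl_upto T)) : 0 <= T ->
  measurable_fun setT X -> measurable_fun setT tau ->
  (forall z, 0 <= tau z <= T) ->
  measurable_fun setT (fun z => path_fun (X z) (tau z)).
Proof.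
move=> T0 mX mtau tauT _ B mB.
have := @measurable_eval _ Z setT tau X T B T0 measurableT mtau.
rewrite (_ : [set z | 0 <= tau z <= T /\ _] = (fun z => path_fun (X z) (tau z)) @^-1` B).
  apply=> // s B' sT mB'; apply: (mX measurableT [set w | B' (path_fun w s)]).
  by apply: sub_sigma_algebra; exists s, B'.
apply/seteqP; split => z /=; first by case.
by move=> Bz; rewrite tauT.
Qed.

Lemma sub_cylinders_upto (T : R) (A : set (sample_path W)) : 0 <= T ->
  <<s cyl_upto T >> A -> <<s cyl >> A.
Proof.
move=> T0; apply: sub_sigma_algebra2 => E cE.
by exists T.
Qed.

Lemma measurable_fun_path_upto (T : R) : 0 <= T ->
  measurable_fun (setT : set (pathT W))
    (idfun : pathT W -> g_sigma_algebraType (cyl_upto T)).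
Proof.
by move=> T0 _ A mA; rewrite setTI; apply: sub_cylinders_upto mA.
Qed.

Lemma measurable_path_shift d' (Z : measurableType d') (r : Z -> {nonneg R})
    (X : Z -> pathT W) :
  measurable_fun setT X -> measurable_fun setT (fun z => (r z)%:num) ->
  measurable_fun setT (fun z => path_shift (r z) (X z) : pathT W).
Proof.
move=> mX mr; apply: measurable_fun_g_sigma => // _ [T /= T0 [s [B [/andP[s0 _] mB ->]]]].
have := @measurable_fun_eval _ Z (fun z => (r z)%:num + s) X mX
  (measurable_funD mr (@measurable_cst _ _ _ R setT s)).
move=> /(_ (fun z => addr_ge0 (ge0 (r z)) s0)); exact.
Qed.

End PathEvaluation.

Section IteratedFunctionals.
Context {R : realType} d d1 d2 d3 (S : measurableType d) (T1 : measurableType d1)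
  (T2 : measurableType d2) (T3 : measurableType d3).
Variables (mu1 : {measure set T1 -> \bar R})
  (mu2 : {sigma_finite_measure set T2 -> \bar R})
  (mu3 : {sigma_finite_measure set T3 -> \bar R}).
Local Open Scope ereal_scope.

Lemma intf_weighted (w : T1 -> \bar R) (phi : T1 -> S) :
  measurable_fun setT w -> (forall z, 0 <= w z) -> measurable_fun setT phi ->
  integration_functional (fun f => \int[mu1]_x (w x * f (phi x))).
Proof.
move=> mw w0 mphi.
apply: (@intf_bind _ _ _ S T1 mu1 setT w (fun x f => f (phi x))) => //.
- by move=> f mf f0; exact: measurableT_comp mf mphi.
Qed.

Lemma intf_double (w : T1 * T2 -> \bar R) (phi : T1 * T2 -> S) :
  measurable_fun setT w -> (forall z, 0 <= w z) -> measurable_fun setT phi ->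
  integration_functional (fun f => \int[mu1]_x \int[mu2]_y (w (x, y) * f (phi (x, y)))).
Proof.
move=> mw w0 mphi.
have mp (x : T1) : measurable_fun setT (fun y : T2 => (x, y)).
  exact: pair1_measurable.
have := @intf_bind _ _ _ S T1 mu1 setT (cst 1)
  (fun x f => \int[mu2]_y (w (x, y) * f (phi (x, y)))) measurableT (measurable_cst _).
rewrite (_ : (fun f : S -> \bar R => \int[mu1]_x (cst 1 x * _)) =
   (fun f => \int[mu1]_x \int[mu2]_y (w (x, y) * f (phi (x, y))))); last first.
  by apply/funext => f; apply: eq_integral => x _; rewrite mul1e.
apply=> //.
- move=> x; apply: (@intf_bind _ _ _ S T2 mu2 setT (fun y => w (x, y)) (fun y f => f (phi (x, y)))) => //.
  + exact: measurableT_comp mw (mp x).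
  + move=> f mf f0; exact: (measurableT_comp mf (measurableT_comp mphi (mp x))).
- move=> f mf f0.
  apply: (@measurable_fun_fubini_tonelli_F _ _ _ _ _ mu2 (fun z => w z * f (phi z))).
    by apply: emeasurable_funM => //; exact: measurableT_comp mf mphi.
  by move=> z; rewrite mule_ge0.
Qed.

Lemma intf_triple (w : T1 * T2 * T3 -> \bar R) (phi : T1 * T2 * T3 -> S) :
  measurable_fun setT w -> (forall z, 0 <= w z) -> measurable_fun setT phi ->
  integration_functional (fun f =>
    \int[mu1]_x \int[mu2]_y \int[mu3]_z (w (x, y, z) * f (phi (x, y, z)))).
Proof.
move=> mw w0 mphi.
have mp (x : T1) : measurable_fun setT (fun y : T2 => (x, y)).
  exact: pair1_measurable.
have mp3 (x : T1 * T2) : measurable_fun setT (fun y : T3 => (x, y)).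
  exact: pair1_measurable.
have mI f : measurable_fun setT f -> (forall z : S, 0 <= f z) ->
    measurable_fun setT (fun q : T1 * T2 => \int[mu3]_z (w (q, z) * f (phi (q, z)))).
  move=> mf f0.
  apply: (@measurable_fun_fubini_tonelli_F _ _ _ _ _ mu3 (fun z => w z * f (phi z))).
    by apply: emeasurable_funM => //; exact: measurableT_comp mf mphi.
  by move=> z; rewrite mule_ge0.
have mI2 f x : measurable_fun setT f -> (forall z : S, 0 <= f z) ->
    measurable_fun setT (fun y => \int[mu3]_z (w (x, y, z) * f (phi (x, y, z)))).
  by move=> mf f0; exact: measurableT_comp (mI f mf f0) (mp x).
have I3 x y : integration_functional (fun f : S -> \bar R => \int[mu3]_z (w (x, y, z) * f (phi (x, y, z)))).
  apply: (@intf_bind _ _ _ S T3 mu3 setT (fun z => w (x, y, z)) (fun z f => f (phi (x, y, z)))) => //.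
  + exact: measurableT_comp mw (mp3 (x, y)).
  + move=> f mf f0; exact: (measurableT_comp mf (measurableT_comp mphi (mp3 (x, y)))).
have I2 x : integration_functional (fun f : S -> \bar R =>
    \int[mu2]_y \int[mu3]_z (w (x, y, z) * f (phi (x, y, z)))).
  have := @intf_bind _ _ _ S T2 mu2 setT (cst 1)
    (fun y f => \int[mu3]_z (w (x, y, z) * f (phi (x, y, z)))) measurableT (measurable_cst _).
  rewrite (_ : (fun f : S -> \bar R => \int[mu2]_y (cst 1 y * _)) =
     (fun f => \int[mu2]_y \int[mu3]_z (w (x, y, z) * f (phi (x, y, z))))); last first.
    by apply/funext => f; apply: eq_integral => y _; rewrite mul1e.
  by apply=> // f mf f0; exact: mI2.
have := @intf_bind _ _ _ S T1 mu1 setT (cst 1)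
  (fun x f => \int[mu2]_y \int[mu3]_z (w (x, y, z) * f (phi (x, y, z)))) measurableT (measurable_cst _).
rewrite (_ : (fun f : S -> \bar R => \int[mu1]_x (cst 1 x * _)) =
   (fun f => \int[mu1]_x \int[mu2]_y \int[mu3]_z (w (x, y, z) * f (phi (x, y, z))))); last first.
  by apply/funext => f; apply: eq_integral => x _; rewrite mul1e.
apply=> // f mf f0.
apply: (@measurable_fun_fubini_tonelli_F _ _ _ _ _ mu2 (fun q => \int[mu3]_z (w (q, z) * f (phi (q, z))))).
  exact: mI.
by move=> q; apply: integral_ge0 => z _; rewrite mule_ge0.
Qed.

End IteratedFunctionals.

(** * Cylinder events on a window of time *)

Section Cylinders.
Context {R : realType} {d : measure_display} {J : measurableType d}.
Implicit Types (c : seq (R * set J)) (f : R -> J).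

(** Constraints at times outside [[lo, hi[] are vacuous. This lets a cylinder be cut at a fission
    time into conditions on the two pieces of the path, and it agrees with a [life_test], which
    ignores the ages beyond the lifetime. *)
Definition in_cylinder c (lo hi : R) f : Prop :=
  forall q, q \in c -> lo <= q.1 < hi -> q.2 (f q.1).

Definition measurable_cylinder c : Prop :=
  forall q, q \in c -> 0 <= q.1 /\ measurable q.2.

Lemma in_cylinder_split c lo mid hi f : lo <= mid <= hi ->
  in_cylinder c lo hi f <-> in_cylinder c lo mid f /\ in_cylinder c mid hi f.
Proof.
move=> /andP[lm mh]; split=> [H|[H1 H2] q qc /andP[lq qh]].
  split=> q qc /andP[lq qh]; apply: H => //.
    by rewrite lq (lt_le_trans qh).
  by rewrite (le_trans lm lq).
by have [mq|qm] := leP mid q.1; [apply: H2|apply: H1] => //; rewrite ?lq ?mq.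
Qed.

Lemma eq_in_cylinder c lo hi f g : (forall s, lo <= s < hi -> f s = g s) ->
  in_cylinder c lo hi f <-> in_cylinder c lo hi g.
Proof. by move=> fg; split=> H q qc qlh; [rewrite -fg|rewrite fg] => //; exact: H. Qed.

Lemma in_cylinder_cat c c' lo hi f :
  in_cylinder (c ++ c') lo hi f <-> in_cylinder c lo hi f /\ in_cylinder c' lo hi f.
Proof.
split=> [H|[H H'] q].
  by split=> q qc qlh; apply: H => //; rewrite mem_cat qc ?orbT.
by rewrite mem_cat => /orP[qc|qc']; [apply: H|apply: H'].
Qed.

Lemma in_cylinder_cons q c lo hi f :
  in_cylinder (q :: c) lo hi f <->
  (lo <= q.1 < hi -> q.2 (f q.1)) /\ in_cylinder c lo hi f.
Proof.
split=> [H|[Hq H] q'].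
  by split=> [|q' qc]; apply: H; rewrite inE ?eqxx ?qc ?orbT.
by rewrite inE => /orP[/eqP -> //|q'c]; exact: H.
Qed.

(** Each constraint is an implication, hence the complement of an observable event: that [s] lies in
    the window while the path at [s] avoids [B]. *)
Lemma measurable_in_cylinder d' (Z : measurableType d') (D : set Z)
    (lo hi : Z -> R) (f : Z -> R -> J) c : measurable D ->
  measurable_cylinder c ->
  (forall s B, 0 <= s -> measurable B ->
     measurable (D `&` [set z | lo z <= s < hi z /\ B (f z s)])) ->
  measurable (D `&` [set z | in_cylinder c (lo z) (hi z) (f z)]).
Proof.
move=> mD + mf; elim: c => [|[s B] c IHc] mc.
  by rewrite (_ : [set z | _] = setT) ?setIT //; apply/seteqP; split.
have [s0 mB] := mc (s, B) (mem_head _ _).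
have mc' : measurable_cylinder c by move=> q qc; apply: mc; rewrite inE qc orbT.
rewrite (_ : _ `&` _ = (D `\` (D `&` [set z | lo z <= s < hi z /\ (~` B) (f z s)])) `&`
    (D `&` [set z | in_cylinder c (lo z) (hi z) (f z)])).
  apply: measurableI; last exact: IHc.
  by apply: measurableD => //; apply: mf => //; exact: measurableC.
apply/seteqP; split => z /=.
  move=> [Dz /in_cylinder_cons[/= h1 h2]]; split; last by [].
  by split=> // -[_ [zs nB]]; apply: nB; exact: h1.
move=> [[Dz h1] [_ h2]]; split=> //; apply/in_cylinder_cons; split=> //= zs.
by apply: contrapT => nB; apply: h1.
Qed.

Definition cylinder_test (C : set R) (a : nat) (B : set J) c :=
  @LifeTest R d J C a B (size c) (fun i => (tnth (in_tuple c) i).1)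
    (fun i => (tnth (in_tuple c) i).2).

Lemma measurable_cylinder_test C a B c : measurable C -> measurable B ->
  measurable_cylinder c -> measurable_test (cylinder_test C a B c).
Proof.
by move=> mC mB mc; split=> //= i; have [] := mc _ (mem_tnth i (in_tuple c)).
Qed.

Lemma passes_cylinder_test C a B c sigma k y (X : R -> J) :
  measurable_cylinder c ->
  passes (cylinder_test C a B c) sigma k y X <->
  [/\ C sigma, k = a, B y & in_cylinder c 0 sigma X].
Proof.
move=> mc; split=> [[/= Cs -> By H]|[Cs -> By H]]; split=> //=.
  by move=> q /(tnthP (in_tuple c)) [i ->] /andP[_]; exact: H.
move=> i qs; apply: H; first exact: mem_tnth.
by rewrite qs andbT; have [] := mc _ (mem_tnth i (in_tuple c)).
Qed.

End Cylinders.

(** * The Markov property for functions *)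

Section Markov.
Context {R : realType} {d : measure_display} {J : measurableType d}.
Variables (W : path_class R J) (HW : progressively_measurable W).
Variables (Xi : R.-pker J ~> pathT W) (HXi : is_markov_process Xi).
Local Notation cyl_upto T := (@cylinders_upto R d J W T).
Local Open Scope ereal_scope.

Lemma measurable_at (r : R) : (0 <= r)%R ->
  measurable_fun setT (fun X : pathT W => path_fun X r).
Proof.
move=> r0; apply: (measurable_fun_eval HW (tau := cst r)) => //.
Qed.

Lemma measurable_shift (r : {nonneg R}) :
  measurable_fun setT (path_shift r : pathT W -> pathT W).
Proof.
apply: (measurable_path_shift HW (r := cst r)) => //; exact: measurable_cst.
Qed.

Lemma measurable_kernel_integral (psi : pathT W -> \bar R) :
  measurable_fun setT psi -> (forall X, 0 <= psi X) ->
  measurable_fun setT (fun y => \int[Xi y]_X psi X).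
Proof.
move=> mpsi psi0; apply: measurable_fun_integral_kernel => // U mU.
exact: measurable_kernel.
Qed.

(** The property for events is extended in two passes of [intf_eq_fun]: the weight [G] of the past
    is reduced to an indicator, then the function [psi] of the future. *)
Lemma markov_fun y (r : {nonneg R}) (G : g_sigma_algebraType (cyl_upto r%:num) -> \bar R)
    (psi : pathT W -> \bar R) :
  measurable_fun setT G -> (forall X, 0 <= G X) ->
  measurable_fun setT psi -> (forall X, 0 <= psi X) ->
  \int[Xi y]_X (G X * \int[Xi (path_fun X r%:num)]_X' psi X') =
  \int[Xi y]_X (G X * psi (path_shift r X)).
Proof.
move=> mG G0 mpsi psi0.
have r0 : (0 <= r%:num)%R by [].
have mat := measurable_at r0.
have mK (f : pathT W -> \bar R) : measurable_fun setT f -> (forall X, 0 <= f X) ->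
    measurable_fun setT (fun X : pathT W => \int[Xi (path_fun X r%:num)]_X' f X').
  by move=> mf f0; exact: measurableT_comp (measurable_kernel_integral mf f0) mat.
have K0 (f : pathT W -> \bar R) (X : pathT W) : (forall X, 0 <= f X) ->
    0 <= \int[Xi (path_fun X r%:num)]_X' f X'.
  by move=> f0; exact: integral_ge0.
have mid := measurable_fun_path_upto (W := W) r0.
pose L1 (f : g_sigma_algebraType (cyl_upto r%:num) -> \bar R) :=
  \int[Xi y]_X ((\int[Xi (path_fun X r%:num)]_X' psi X') * f X).
pose L2 (f : g_sigma_algebraType (cyl_upto r%:num) -> \bar R) :=
  \int[Xi y]_X (psi (path_shift r X) * f X).
suff : L1 G = L2 G.
  by rewrite /L1 /L2 => E; under eq_integral do rewrite muleC; rewrite E;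
     under eq_integral do rewrite muleC.
apply: (@intf_eq_fun _ _ _ L1 L2) => //.
- apply: (@intf_weighted _ _ _ _ _ (Xi y) _ (idfun : pathT W -> g_sigma_algebraType (cyl_upto r%:num))) => //.
    exact: mK.
  by move=> X; exact: K0.
- apply: (@intf_weighted _ _ _ _ _ (Xi y) _ (idfun : pathT W -> g_sigma_algebraType (cyl_upto r%:num))) => //.
  exact: measurableT_comp mpsi (measurable_shift r).
move=> A mA; rewrite /L1 /L2.
have mA' : measurable (A : set (pathT W)) by exact: sub_cylinders_upto mA.
have toA (f : pathT W -> \bar R) : \int[Xi y]_X (f X * (\1_A X)%:E) = \int[Xi y]_(X in A) f X.
  rewrite [RHS]integral_mkcond; apply: eq_integral => X _.
  by rewrite patchE indicE; case: ifP => _; rewrite ?mule1 ?mule0.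
rewrite (toA (fun X => \int[Xi (path_fun X r%:num)]_X' psi X')).
rewrite (toA (fun X => psi (path_shift r X))).
pose M1 (f : pathT W -> \bar R) :=
  \int[Xi y]_(X in A) (1 * (\int[Xi (path_fun X r%:num)]_X' f X')).
pose M2 (f : pathT W -> \bar R) := \int[Xi y]_(X in A) f (path_shift r X).
suff : M1 psi = M2 psi.
  by rewrite /M1 /M2 => <-; apply: eq_integral => X _; rewrite mul1e.
apply: (@intf_eq_fun _ _ _ M1 M2) => //.
- apply: (@intf_bind _ _ _ _ _ (Xi y) A (cst 1) (fun X f => \int[Xi (path_fun X r%:num)]_X' f X')) => //.
  + move=> X; apply: (@intf_integral _ _ _ _ _ (Xi (path_fun X r%:num)) setT idfun) => //; exact: measurable_id.
  + move=> f mf f0; apply: measurable_funTS; exact: mK.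
- apply: intf_integral => //; apply: measurable_funTS; exact: measurable_shift.
move=> E mE; rewrite /M1 /M2.
transitivity (\int[Xi y]_(X in A) Xi (path_fun X r%:num) E).
  by apply: eq_integral => X _; rewrite mul1e integral_indic // setIT.
rewrite -(HXi.2 y r A E mA mE).
have mS : measurable (path_shift r @^-1` E : set (pathT W)).
  by rewrite -[X in measurable X]setTI; exact: measurable_shift.
rewrite setIC -(integral_indic (Xi y) mA' mS).
by apply: eq_integral => X _.
Qed.

End Markov.

(** * Fission rates along a path *)

Lemma eq_line_integral {R : realType} (h h' : nat -> R -> R) l s :
  (forall a r, 0 <= r <= s -> h a r = h' a r) ->
  line_integral h l s = line_integral h' l s.
Proof.
elim: l s => //= ja l IHl s hh'; apply: eq_integral => r.
rewrite inE /= in_itv /= => /andP[r0 rs].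
rewrite hh' ?r0 // IHl // => a q /andP[q0 qr]; apply: hh'.
by rewrite q0 (le_trans qr).
Qed.

Section RatesAlongPaths.
Context {R : realType} {d : measure_display} {J : measurableType d}.
Variables (rate : J -> R) (p : nat -> J -> R).
Hypotheses (mrate : measurable_fun setT rate) (rate_ge0 : forall y, 0 <= rate y).
Hypotheses (mp : forall a, measurable_fun setT (p a)) (p_ge0 : forall a y, 0 <= p a y).
Local Open Scope ereal_scope.
Local Notation leb := (@lebesgue_measure R).
Implicit Types (f : R -> J) (l : seq (nat * nat)).

Definition fission_rate f (a : nat) (r : R) : R := (rate (f r) * p a (f r))%R.

Definition cumulated_rate f (r : R) : \bar R :=
  \int[leb]_(q in `[0%R, r]%classic) (rate (f q))%:E.

(** The density of the birth time of the last particle of the line, survival factors left aside. It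
    refers to [line_measure], which for the root is the Dirac mass at its birth time 0 and otherwise
    Lebesgue measure. *)
Definition line_density f l (r : R) : \bar R :=
  if l is ja :: l' then
    (fission_rate f ja.2 r)%:E * line_integral (fission_rate f) l' r
  else 1.

Definition line_measure l : {sigma_finite_measure set (measurableTypeR R) -> \bar R} :=
  if l is [::] then \d_(0%R : measurableTypeR R) else leb.

Lemma fission_rate_ge0 f a r : (0 <= fission_rate f a r)%R.
Proof. by rewrite mulr_ge0. Qed.

Lemma line_density_ge0 f l r : 0 <= line_density f l r.
Proof.
case: l => //= ja l; rewrite mule_ge0 ?lee_fin ?fission_rate_ge0 //.
by apply: line_integral_ge0 => *; exact: fission_rate_ge0.
Qed.

Lemma line_integral_density f l s : (0 <= s)%R ->
  line_integral (fission_rate f) l s =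
  \int[line_measure l]_(r in `[0%R, s]%classic) line_density f l r.
Proof.
case: l => [|ja l] //= s0.
rewrite integral_dirac //= mule1 diracE mem_set //=.
by rewrite in_itv /= lexx.
Qed.

Lemma eq_cumulated_rate f f' r : (forall q, (0 <= q <= r)%R -> f q = f' q) ->
  cumulated_rate f r = cumulated_rate f' r.
Proof.
move=> ff'; apply: eq_integral => q; rewrite inE /= in_itv /= => qr.
by rewrite ff'.
Qed.

Lemma eq_line_density f f' l r : (0 <= r)%R -> (forall q, (0 <= q <= r)%R -> f q = f' q) ->
  line_density f l r = line_density f' l r.
Proof.
move=> r0 ff'; case: l => //= ja l; rewrite /fission_rate ff' ?r0 ?lexx //.
by congr (_ * _); apply: eq_line_integral => a q qr; rewrite ff'.
Qed.

Lemma cumulated_rate_ge0 f r : 0 <= cumulated_rate f r.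
Proof. by apply: integral_ge0 => q _; rewrite lee_fin. Qed.

Section Measurability.
Context d' (Z : measurableType d') (Y : Z * R -> J) (mY : measurable_fun setT Y).

Let mh a : measurable_fun setT (fun q : Z * R => fission_rate (fun r => Y (q.1, r)) a q.2).
Proof.
have -> : (fun q : Z * R => fission_rate (fun r => Y (q.1, r)) a q.2) =
    (fun q => rate (Y q) * p a (Y q))%R.
  by apply/funext => -[].
by apply: measurable_funM; exact: measurableT_comp.
Qed.

Lemma measurable_cumulated_rate :
  measurable_fun setT (fun q : Z * R => cumulated_rate (fun r => Y (q.1, r)) q.2).
Proof.
apply: (@measurable_fun_integral_itv R _ (Z * R)%type (cst 0%R) snd
  (fun q => (rate (Y (q.1.1, q.2)))%:E)) => //.
- apply/measurable_EFinP; apply: (measurableT_comp mrate).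
  apply: (measurableT_comp mY).
  apply: measurable_fun_pair; last exact: measurable_snd.
  exact: measurableT_comp measurable_fst measurable_fst.
- by move=> z; rewrite lee_fin.
Qed.

Lemma measurable_line_integral_rate l : measurable_fun setT
  (fun q : Z * R => line_integral (fission_rate (fun r => Y (q.1, r))) l q.2).
Proof. by apply: (measurable_line_integral l mh) => a z; exact: fission_rate_ge0. Qed.

Lemma measurable_line_density l :
  measurable_fun setT (fun q : Z * R => line_density (fun r => Y (q.1, r)) l q.2).
Proof.
case: l => [|ja l] /=; first exact: measurable_cst.
apply: emeasurable_funM; first by apply/measurable_EFinP; exact: mh.
exact: measurable_line_integral_rate.
Qed.

End Measurability.

Lemma cumulated_rate_shift f r0 r : (0 <= r0 <= r)%R ->
  measurable_fun setT (fun q => rate (f q)) ->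
  cumulated_rate f r =
  cumulated_rate f r0 + \int[leb]_(q in `[0%R, (r - r0)%R]%classic) (rate (f (r0 + q)%R))%:E.
Proof.
move=> r0r mf.
have mf' : measurable_fun setT (fun q => (rate (f q))%:E) by apply/measurable_EFinP.
have := @iterated_integral_split R (fun q => (rate (f q))%:E) mf'
  (fun q => rate_ge0 (f q)) r0 r r0r.
have I1 s : iterated_integral (fun q => (rate (f q))%:E) 1 s = cumulated_rate f s.
  by apply: eq_integral => q _ /=; rewrite mule1.
rewrite !I1 => ->; congr (_ + _).
rewrite !integral_itv_if -(integral_shift r0); last 2 first.
- apply: measurable_fun_ifT => //.
  by apply: measurable_and; apply: measurable_fun_ler => //; exact: measurable_id.
- by move=> q; case: ifP => // _; rewrite lee_fin.
apply: eq_integral => q _; rewrite [(q + r0)%R]addrC.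
by rewrite lerDl lerBrDl.
Qed.

End RatesAlongPaths.

(** * One more generation *)

Section KernelLaw.
Context {R : realType} d d' (X : measurableType d) (Y : measurableType d').
Variables (k : R.-pker X ~> Y) (x : X).

(** A copy of [k x] that carries a probability structure, and with it the sigma-finiteness demanded
    by Tonelli. *)
Definition kernel_law : set Y -> \bar R := k x.

HB.instance Definition _ := isMeasure.Build _ _ _ kernel_law
  (measure0 (k x)) (measure_ge0 (k x)) (@measure_semi_sigma_additive _ _ _ (k x)).

HB.instance Definition _ :=
  Measure_isProbability.Build _ _ _ kernel_law (prob_kernel x).

Lemma integral_kernel_law (D : set Y) (f : Y -> \bar R) :
  (\int[kernel_law]_(y in D) f y = \int[k x]_(y in D) f y)%E.
Proof. exact: eq_measure_integral. Qed.

End KernelLaw.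

(** * Paths observed up to their death *)

Section KilledPaths.
Context {R : realType} {d : measure_display} {J : measurableType d}.
Variables (W : path_class R J) (HW : progressively_measurable W).

(* A birth time, a lifetime and a path of which only the piece before the
   lifetime is observed. *)
Definition killed_tests : set (set (R * (R * sample_path W))) :=
  [set A | exists C0 C c, [/\ measurable C0, measurable C, measurable_cylinder c &
     A = [set z | [/\ C0 z.1, C z.2.1 & in_cylinder c 0 z.2.1 (path_fun z.2.2)]]]].

Definition killedT := g_sigma_algebraType killed_tests.

Lemma killed_tests_setI : setI_closed killed_tests.
Proof.
move=> _ _ [C0 [C [c [mC0 mC mc ->]]]] [C0' [C' [c' [mC0' mC' mc' ->]]]].
exists (C0 `&` C0'), (C `&` C'), (c ++ c'); split.
- exact: measurableI.
- exact: measurableI.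
- by move=> q; rewrite mem_cat => /orP[/mc|/mc'].
- apply/seteqP; split => z /=.
    move=> [[H1 H2 H3] [H4 H5 H6]]; split=> //; apply/in_cylinder_cat; split=> //.
  by move=> [[H1 H4] [H2 H5] /in_cylinder_cat[H3 H6]].
Qed.

Let mtest C0 C c : measurable C0 -> measurable C -> measurable_cylinder c ->
  measurable ([set z | [/\ C0 z.1, C z.2.1 & in_cylinder c 0 z.2.1 (path_fun z.2.2)]]
    : set killedT).
Proof. by move=> *; apply: sub_sigma_algebra; exists C0, C, c. Qed.

Lemma measurable_killed_birth : measurable_fun setT (fun z : killedT => z.1).
Proof.
move=> _ C0 mC0; rewrite setTI.
rewrite (_ : _ @^-1` _ = [set z : killedT |
    [/\ C0 z.1, setT z.2.1 & in_cylinder [::] 0 z.2.1 (path_fun z.2.2)]]).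
  by apply: mtest.
by apply/seteqP; split => z //= [].
Qed.

Lemma measurable_killed_life : measurable_fun setT (fun z : killedT => z.2.1).
Proof.
move=> _ C mC; rewrite setTI.
rewrite (_ : _ @^-1` _ = [set z : killedT |
    [/\ setT z.1, C z.2.1 & in_cylinder [::] 0 z.2.1 (path_fun z.2.2)]]).
  by apply: mtest.
by apply/seteqP; split => z //= [].
Qed.

Lemma measurable_killed_at s (B : set J) : 0 <= s -> measurable B ->
  measurable [set z : killedT | s < z.2.1 /\ B (path_fun z.2.2 s)].
Proof.
move=> s0 mB.
rewrite (_ : [set z | _] = [set z : killedT |
    [/\ setT z.1, `]s, +oo[%classic z.2.1 & in_cylinder [:: (s, B)] 0 z.2.1 (path_fun z.2.2)]]).
  by apply: mtest => // q; rewrite inE => /eqP ->.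
apply/seteqP; split => z /=; rewrite in_itv /= andbT.
  by move=> [sz Bz]; split=> // q; rewrite inE => /eqP ->.
by move=> [_ sz H]; split=> //; apply: (H (s, B)); rewrite ?mem_head //= s0.
Qed.

(** The generating tests read birth time, lifetime and ages separately. This event couples them,
    through the fission time and the path at absolute times; its measurability brings it within
    reach of the monotone class argument. *)
Lemma measurable_killed_window (C2 : set (R * R)) c : measurable C2 ->
  measurable_cylinder c ->
  measurable [set z : killedT | C2 (z.1, z.1 + z.2.1) /\
    in_cylinder c z.1 (z.1 + z.2.1) (fun s => path_fun z.2.2 (s - z.1))].
Proof.
move=> mC2 mc.
have mb := measurable_killed_birth; have ms := measurable_killed_life.
rewrite (_ : [set z | _] = ((fun z : killedT => (z.1, z.1 + z.2.1)) @^-1` C2) `&`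
  (setT `&` [set z : killedT | in_cylinder c z.1 (z.1 + z.2.1) (fun s => path_fun z.2.2 (s - z.1))])).
  apply: measurableI.
    rewrite -[X in measurable X]setTI; apply: (measurable_fun_pair mb (measurable_funD mb ms)) => //.
  apply: (@measurable_in_cylinder R d J _ killedT setT (fun z => z.1)
    (fun z => z.1 + z.2.1) (fun z s => path_fun z.2.2 (s - z.1)) c measurableT mc).
  move=> s B s0 mB.
  have mtau : measurable_fun setT (fun z : killedT => s - z.1).
    exact: measurable_funB (measurable_cst _) mb.
  have := @measurable_eval_killed R d J W HW _ killedT setT (fun z => z.2.1)
    (fun z => s - z.1) (fun z => z.2.2) B measurableT ms mtau.
  rewrite (_ : [set z : killedT | 0 <= s - z.1 < z.2.1 /\ _] =
    [set z : killedT | z.1 <= s < z.1 + z.2.1 /\ B (path_fun z.2.2 (s - z.1))]).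
    apply=> // s' B' s'0 mB'; rewrite setTI; exact: measurable_killed_at.
  by apply/seteqP; split => z /=; rewrite subr_ge0 ltrBlDl.
by rewrite setTI.
Qed.

End KilledPaths.

Lemma measurable_expeR (R : realType) : measurable_fun setT (@expeR R).
Proof.
have mb (y : \bar R) : measurable_fun setT (fun z : \bar R => z == y).
  apply: (measurable_fun_bool true); rewrite setTI (_ : _ @^-1` _ = [set y]) //.
  by apply/seteqP; split => z /= /eqP.
rewrite (_ : @expeR R = fun z => if z == +oo%E then +oo%E else
    if z == -oo%E then 0%E else (expR (fine z))%:E); last first.
  by apply/funext => -[].
apply: measurable_fun_ifT => //; apply: measurable_fun_ifT => //.
apply/measurable_EFinP; exact: measurableT_comp.
Qed.

Lemma measurable_set_le {R : realType} d (T : measurableType d) (g h : T -> R) :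
  measurable_fun setT g -> measurable_fun setT h -> measurable [set q | g q <= h q].
Proof.
move=> mg mh; have := measurable_fun_ler mg mh measurableT (Y := [set true]) I.
by rewrite setTI.
Qed.

Lemma measurable_set_lt {R : realType} d (T : measurableType d) (g h : T -> R) :
  measurable_fun setT g -> measurable_fun setT h -> measurable [set q | g q < h q].
Proof.
move=> mg mh; have := measurable_fun_ltr mg mh measurableT (Y := [set true]) I.
by rewrite setTI.
Qed.

Section GenerationStep.
Context {R : realType} {d : measure_display} {J : measurableType d}.
Variables (rate : J -> R) (p : nat -> J -> R).
Hypotheses (mrate : measurable_fun setT rate) (rate_ge0 : forall y, 0 <= rate y).
Hypotheses (mp : forall a, measurable_fun setT (p a)) (p_ge0 : forall a y, 0 <= p a y).
Local Open Scope ereal_scope.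
Local Notation cumulated := (cumulated_rate rate).
Local Notation frate := (fission_rate rate p).
Local Notation density := (line_density rate p).
Implicit Types (f : R -> J) (C : set R) (B : set J) (c : seq (R * set J)).

(* All the particles of a line fission at the same rate along the path, so a
   single exponential up to the time r accounts for the survival of each of them
   between two fissions. *)
Definition past_weight l c f (r : R) : \bar R :=
  (\1_[set r | (0 <= r)%R /\ in_cylinder c 0 r f] r : R)%:E *
  (density f l r * expeR (- cumulated f r)).

Definition along_weight C a B c f (r : R) : \bar R :=
  (\1_[set r | [/\ (0 <= r)%R, C r, B (f r) & in_cylinder c 0 r f]] r : R)%:E *
  ((frate f a r)%:E * expeR (- cumulated f r)).

(** Joint density of the birth time [r0] and the fission time [r] of the particle that ends the
    line. The cylinder bears on the path before [r0] only; what happens between [r0] and [r] is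
    tested on the killed path. *)
Definition step_weight l c a B f (r0 r : R) : \bar R :=
  (\1_[set q : R * R | [/\ (0 <= q.1 <= q.2)%R, in_cylinder c 0 q.1 f & B (f q.2)]] (r0, r) : R)%:E *
  (density f l r0 * ((frate f a r)%:E * expeR (- cumulated f r))).

Lemma past_weight_ge0 l c f r : 0 <= past_weight l c f r.
Proof.
rewrite mule_ge0 ?lee_fin // mule_ge0 ?expeR_ge0 //; exact: line_density_ge0.
Qed.

Lemma past_weight_lt0 l c f r : (r < 0)%R -> past_weight l c f r = 0.
Proof.
by move=> r0; rewrite /past_weight indicE memNset ?mul0e //= => -[+ _]; rewrite leNgt r0.
Qed.

Lemma along_weight_ge0 C a B c f r : 0 <= along_weight C a B c f r.
Proof.
rewrite mule_ge0 ?lee_fin // mule_ge0 ?expeR_ge0 // lee_fin; exact: fission_rate_ge0.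
Qed.

Lemma step_weight_ge0 l c a B f r0 r : 0 <= step_weight l c a B f r0 r.
Proof.
rewrite mule_ge0 ?lee_fin // mule_ge0 //; first exact: line_density_ge0.
rewrite mule_ge0 ?expeR_ge0 // lee_fin; exact: fission_rate_ge0.
Qed.

Lemma eq_past_weight l c f f' r : (forall q, (0 <= q <= r)%R -> f q = f' q) ->
  past_weight l c f r = past_weight l c f' r.
Proof.
move=> ff'; rewrite /past_weight.
have [r0|r0] := leP 0%R r; last first.
  by rewrite !indicE !memNset ?mul0e //= => -[]; rewrite leNgt r0.
rewrite (eq_line_density _ _ _ r0 ff') (eq_cumulated_rate _ ff'); congr (_%:E * _).
rewrite !indicE; congr (_%:R); congr nat_of_bool.
apply/idP/idP => /set_mem [_ H]; apply/mem_set; split=> //; move: H;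
  by apply eq_in_cylinder => s /andP[s0 sr]; rewrite ff' // s0 ltW.
Qed.

Section Measurability.
Context d' (Z : measurableType d') (Y : Z * R -> J) (mY : measurable_fun setT Y).

Let mat s B : measurable B -> measurable ([set q : Z * R | B (Y (q.1, s))]).
Proof.
move=> mB; have : measurable_fun setT (fun q : Z * R => Y (q.1, s)).
  apply: (measurableT_comp mY); exact: measurable_fun_pair.
by move=> /(_ measurableT _ mB); rewrite setTI.
Qed.

Lemma measurable_past_cylinder c : measurable_cylinder c ->
  measurable [set q : Z * R | in_cylinder c 0 q.2 (fun s => Y (q.1, s))].
Proof.
move=> mc.
have := @measurable_in_cylinder R d J _ _ setT (fun=> 0%R) (fun q : Z * R => q.2)
  (fun q s => Y (q.1, s)) c measurableT mc.
rewrite setTI; apply=> s B s0 mB; rewrite setTI.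
rewrite (_ : [set q | _] = [set q : Z * R | (s < q.2)%R] `&` [set q | B (Y (q.1, s))]).
  apply: measurableI; last exact: mat.
  by apply: measurable_set_lt => //; exact: measurable_snd.
by apply/seteqP; split => q /=; rewrite s0.
Qed.

Lemma measurable_survival : measurable_fun setT (fun q : Z * R => expeR (- cumulated (fun s => Y (q.1, s)) q.2)).
Proof.
apply: measurableT_comp; first exact: measurable_expeR.
by apply: measurableT_comp => //; exact: measurable_cumulated_rate.
Qed.

Lemma measurable_fission_rate a : measurable_fun setT (fun q : Z * R => (frate (fun s => Y (q.1, s)) a q.2)%:E).
Proof.
apply/measurable_EFinP.
have -> : (fun q : Z * R => frate (fun r => Y (q.1, r)) a q.2) =
    (fun q => rate (Y q) * p a (Y q))%R.
  by apply/funext => -[].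
by apply: measurable_funM; exact: measurableT_comp.
Qed.

Lemma measurable_past_weight l c : measurable_cylinder c ->
  measurable_fun setT (fun q : Z * R => past_weight l c (fun s => Y (q.1, s)) q.2).
Proof.
move=> mc; apply: emeasurable_funM.
  rewrite (_ : (fun q => _) = (fun q => (\1_([set q : Z * R | (0 <= q.2)%R] `&`
      [set q | in_cylinder c 0 q.2 (fun s => Y (q.1, s))]) q)%:E)).
    apply/measurable_EFinP/measurable_indic/measurableI; last exact: measurable_past_cylinder.
    by apply: measurable_set_le => //; exact: measurable_snd.
  by apply/funext => q; rewrite !indicE.
apply: emeasurable_funM; last exact: measurable_survival.
exact: measurable_line_density.
Qed.

Lemma measurable_along_weight C a B c : measurable C -> measurable B ->
  measurable_cylinder c ->
  measurable_fun setT (fun q : Z * R => along_weight C a B c (fun s => Y (q.1, s)) q.2).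
Proof.
move=> mC mB mc; apply: emeasurable_funM; last first.
  by apply: emeasurable_funM; [exact: measurable_fission_rate|exact: measurable_survival].
rewrite (_ : (fun q => _) = (fun q => (\1_([set q : Z * R | (0 <= q.2)%R] `&` (snd @^-1` C) `&`
   (Y @^-1` B) `&` [set q | in_cylinder c 0 q.2 (fun s => Y (q.1, s))]) q)%:E)).
  apply/measurable_EFinP/measurable_indic/measurableI; last exact: measurable_past_cylinder.
  apply: measurableI; last by rewrite -[X in measurable X]setTI; exact: mY.
  apply: measurableI; last by rewrite -[X in measurable X]setTI; exact: measurable_snd.
  by apply: measurable_set_le => //; exact: measurable_snd.
apply/funext => -[z r]; rewrite !indicE; congr (_%:R%:E); congr nat_of_bool.
apply/idP/idP => /set_mem /=; first by move=> [? ? ? ?]; exact/mem_set.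
by move=> [[[? ?] ?] ?]; apply/mem_set.
Qed.

End Measurability.

End GenerationStep.

Lemma ge0_oppeD {R : realType} (a b : \bar R) :
  (0 <= a)%E -> (0 <= b)%E -> (- (a + b) = - a - b)%E.
Proof. by move=> a0 b0; rewrite oppeD // ge0_adde_def ?inE. Qed.

Section GenerationStepOnPaths.
Context {R : realType} {d : measure_display} {J : measurableType d}.
Variables (W : path_class R J) (HW : progressively_measurable W).
Variables (Xi : R.-pker J ~> pathT W) (HXi : is_markov_process Xi) (x : J).
Variables (rate : J -> R) (p : nat -> J -> R).
Hypotheses (mrate : measurable_fun setT rate) (rate_ge0 : forall y, 0 <= rate y).
Hypotheses (mp : forall a, measurable_fun setT (p a)) (p_ge0 : forall a y, 0 <= p a y).
Local Open Scope ereal_scope.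
Local Notation leb := (@lebesgue_measure R).
Local Notation cyl_upto T := (@cylinders_upto R d J W T).
Local Notation PX := (kernel_law Xi x).
Local Notation past_weight := (past_weight rate p).
Local Notation along_weight := (along_weight rate p).
Local Notation step_weight := (step_weight rate p).

Lemma max0_ge0 (r : R) : (0 <= Num.max 0 r)%R.
Proof. by rewrite le_max lexx. Qed.

Definition nonneg_part (r : R) : {nonneg R} := NngNum (max0_ge0 r).

(* The path is clipped at time 0 because nothing is known about the
   measurability of trajectories at negative times. *)
Definition pos_path (X : sample_path W) (r : R) : J :=
  path_fun X (nonneg_part r)%:num.

Lemma nonneg_partE r : (0 <= r)%R -> (nonneg_part r)%:num = r.
Proof. by move=> r0 /=; apply/max_idPr. Qed.

Lemma pos_pathE X r : (0 <= r)%R -> pos_path X r = path_fun X r.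
Proof. by move=> r0; rewrite /pos_path nonneg_partE. Qed.

Lemma pos_path_shift X r0 r : (0 <= r0)%R -> (0 <= r)%R ->
  pos_path (path_shift (nonneg_part r0) X) r = pos_path X (r0 + r)%R.
Proof.
move=> r0_ge0 r_ge0; rewrite !pos_pathE ?addr_ge0 //=.
by congr (path_fun X (_ + _)%R); apply/max_idPr.
Qed.

Lemma measurable_nonneg_part : measurable_fun setT (fun r : R => (nonneg_part r)%:num).
Proof. exact: measurable_maxr (measurable_cst _) (@measurable_id _ _ _). Qed.

Lemma measurable_pos_path :
  measurable_fun setT (fun q : pathT W * R => pos_path q.1 q.2).
Proof.
apply: (measurable_fun_eval HW) => //.
exact: measurableT_comp measurable_nonneg_part measurable_snd.
Qed.

Lemma measurable_shift_path : measurable_fun setT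
  (fun q : pathT W * R => path_shift (nonneg_part q.2) q.1 : pathT W).
Proof.
apply: (measurable_path_shift HW) => //.
exact: measurableT_comp measurable_nonneg_part measurable_snd.
Qed.

(** The Markov property at [r0] demands a weight measurable for the path up to [r0]. Stopping the
    path at [r0] does not change the weight and makes it jointly measurable in path and time for
    that sigma-algebra. *)
Lemma adapted_past_weight l c r0 : measurable_cylinder c -> (0 <= r0)%R ->
  measurable_fun setT (fun X : g_sigma_algebraType (cyl_upto (nonneg_part r0)%:num) =>
    past_weight l c (pos_path X) r0).
Proof.
move=> mc r00.
pose Y (q : g_sigma_algebraType (cyl_upto (nonneg_part r0)%:num) * R) : J :=
  path_fun q.1 (Num.min (nonneg_part q.2)%:num (nonneg_part r0)%:num).
have mY : measurable_fun setT Y.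
  apply: (measurable_fun_eval_upto HW) => //.
    apply: measurable_minr => //.
    exact: measurableT_comp measurable_nonneg_part measurable_snd.
  by move=> q; rewrite le_min !ge0 /= ge_min lexx orbT.
have := measurable_past_weight mrate rate_ge0 mp p_ge0 mY l mc.
move=> /(@measurable_fun_pair1 _ _ _ _ _ _ _ r0).
congr (measurable_fun _ _); apply/funext => X /=.
apply: eq_past_weight => q /andP[q0 qr].
rewrite /Y pos_pathE //; congr path_fun.
by rewrite !nonneg_partE //; apply/min_idPl.
Qed.

Lemma life_law_along_cylinder C a B c X : measurable_cylinder c ->
  life_law_along rate p (cylinder_test C a B c) X =
  \int[leb]_r along_weight C a B c (pos_path X) r.
Proof.
move=> mc; rewrite /life_law_along integral_mkcond; apply: eq_integral => r _.
rewrite patchE /along_weight indicE.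
have E : [set r | (0 <= r)%R /\ passes (cylinder_test C a B c) r (lt_brood (cylinder_test C a B c)) (path_fun X r) (path_fun X)] =
   [set r | [/\ (0 <= r)%R, C r, B (pos_path X r) & in_cylinder c 0 r (pos_path X)]].
  apply/seteqP; split => q /=.
    move=> [q0 /(passes_cylinder_test _ _ _ _ _ _ _ mc) [Cq _ Bq H]].
    split=> //; first by rewrite pos_pathE.
    by move: H; apply eq_in_cylinder => s /andP[s0 _]; rewrite pos_pathE.
  move=> [q0 Cq Bq H]; split=> //; apply/(passes_cylinder_test _ _ _ _ _ _ _ mc).
  rewrite -(pos_pathE X q0); split=> //.
  by move: H; apply eq_in_cylinder => s /andP[s0 _]; rewrite pos_pathE.
rewrite E; case: ifPn => [/set_mem[r0 _ _ _]|_]; last by rewrite mul0e.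
rewrite mul1e /fission_rate pos_pathE //; congr (_ * expeR (- _)).
apply: eq_integral => q; rewrite inE /= in_itv /= => /andP[q0 _].
by rewrite pos_pathE.
Qed.

Lemma life_law_along_ge0 e (X : sample_path W) : 0 <= life_law_along rate p e X.
Proof.
apply: integral_ge0 => r _; rewrite mule_ge0 ?expeR_ge0 // lee_fin.
by rewrite mulr_ge0.
Qed.

Lemma measurable_life_law_along C a B c : measurable C -> measurable B ->
  measurable_cylinder c ->
  measurable_fun setT (fun X : pathT W => life_law_along rate p (cylinder_test C a B c) X).
Proof.
move=> mC mB mc.
rewrite (_ : (fun X => _) = (fun X : pathT W => \int[leb]_r along_weight C a B c (pos_path X) r)).
  apply: (@measurable_fun_fubini_tonelli_F _ _ _ _ _ leb
    (fun q : pathT W * R => along_weight C a B c (pos_path q.1) q.2)).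
    exact: (measurable_along_weight mrate rate_ge0 mp measurable_pos_path).
  by move=> q; exact: along_weight_ge0.
by apply/funext => X; exact: life_law_along_cylinder.
Qed.

Definition killed_test (C0 C : set R) c : set (killedT W) :=
  [set z | [/\ C0 z.1, C z.2.1 & in_cylinder c 0 z.2.1 (path_fun z.2.2)]].

(** The cumulated rate is additive, so survival up to the birth time [r0] times survival of the
    shifted path up to the age [r - r0] is survival up to [r]. Outside the event common to both
    sides, each of them vanishes. *)
Lemma step_weightE l c C0 C a B c' X r0 r : 
  past_weight l c (pos_path X) r0 * (\1_C0 r0)%:E *
    along_weight C a B c' (pos_path (path_shift (nonneg_part r0) X)) (r - r0)%R =
  step_weight l c a B (pos_path X) r0 r *
    (\1_(killed_test C0 C c') (r0, ((r - r0)%R, path_shift (nonneg_part r0) X)))%:E.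
Proof.
set g := pos_path (path_shift _ _).
have cylE : in_cylinder c' 0 (r - r0)%R g <->
    in_cylinder c' 0 (r - r0)%R (path_fun (path_shift (nonneg_part r0) X)).
  by apply: eq_in_cylinder => s /andP[s0 _]; rewrite /g pos_pathE.
have [[[r0r cc C0r0] [Cr Br c'c]]|H] := pselect (
    [/\ (0 <= r0 <= r)%R, in_cylinder c 0 r0 (pos_path X) & C0 r0] /\
    [/\ C (r - r0)%R, B (pos_path X r) & in_cylinder c' 0 (r - r0)%R g]).
  have /andP[r00 r0r'] := r0r.
  have rr0 : (0 <= r - r0)%R by rewrite subr_ge0.
  have gE : g (r - r0)%R = pos_path X r by rewrite /g pos_path_shift // addrC subrK.
  rewrite /past_weight /along_weight /step_weight !indicE !mem_set //=; last 2 first.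
  - by split=> //; apply/cylE.
  - by split=> //; rewrite gE.
  rewrite !mul1e !mule1 /fission_rate gE -!muleA; congr (_ * _).
  rewrite muleCA; congr (_ * _); rewrite -expeRD; congr expeR.
  rewrite (cumulated_rate_shift rate_ge0 r0r); last first.
    apply: (measurableT_comp mrate).
    exact: (measurable_fun_pair2 (X : pathT W) measurable_pos_path).
  rewrite [in RHS]ge0_oppeD ?cumulated_rate_ge0 //.
  congr (_ - _); apply: eq_integral => q; rewrite inE /= in_itv /= => /andP[q0 _].
  by rewrite /g pos_path_shift.
rewrite /past_weight /along_weight /step_weight !indicE.
transitivity (0 : \bar R).
  case: (boolP (r0 \in [set r1 | (0 <= r1)%R /\ _])) => [/set_mem[/= r00 cc]|_]; last by rewrite !mul0e.
  case: (boolP (r0 \in C0)) => [/set_mem C0r0|_]; last by rewrite mule0 mul0e.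
  case: (boolP ((r - r0)%R \in [set r1 | [/\ (0 <= r1)%R, _, _ & _]])) => [/set_mem[/= rr0 Cr Br c'c]|_];
    last by rewrite mul0e mule0.
  exfalso; apply: H; split; split=> //; first by rewrite r00 -subr_ge0.
  by move: Br; rewrite /g pos_path_shift // addrC subrK.
apply/esym.
case: (boolP ((r0, r) \in [set q : R * R | [/\ (0 <= q.1 <= q.2)%R, _ & _]])) => [/set_mem[/= r0r cc Br]|_];
  last by rewrite !mul0e.
case: (boolP (_ \in killed_test _ _ _)) => [/set_mem[/= C0r0 Cr c'c]|_]; last by rewrite mule0.
by exfalso; apply: H; split; split=> //; apply/cylE.
Qed.

Local Notation Z3 := (pathT W * R * R)%type.

Definition killed_at_step (q : Z3) : killedT W :=
  (q.1.2, ((q.2 - q.1.2)%R, path_shift (nonneg_part q.1.2) q.1.1)).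

Let m12 : measurable_fun setT (fun q : Z3 => q.1.2).
Proof. exact: measurableT_comp measurable_snd measurable_fst. Qed.

Let m13 : measurable_fun setT (fun q : Z3 => (q.1.1, q.2)).
Proof.
apply: measurable_fun_pair; last exact: measurable_snd.
exact: measurableT_comp measurable_fst measurable_fst.
Qed.

Lemma measurable_killed_at_step : measurable_fun setT killed_at_step.
Proof.
apply: measurable_fun_g_sigma => // _ [C0 [C [c [mC0 mC mc ->]]]].
rewrite setTI (_ : _ @^-1` _ = ((fun q : Z3 => q.1.2) @^-1` C0) `&`
    ((fun q : Z3 => q.2 - q.1.2)%R @^-1` C) `&`
    (setT `&` [set q : Z3 | in_cylinder c 0 (q.2 - q.1.2)%R
       (path_fun (path_shift (nonneg_part q.1.2) q.1.1))])).
  have mdiff : measurable_fun setT (fun q : Z3 => q.2 - q.1.2)%R.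
    by apply: measurable_funB => //; exact: measurable_snd.
  apply: measurableI; first apply: measurableI.
  - by rewrite -[X in measurable X]setTI; exact: m12.
  - by rewrite -[X in measurable X]setTI; exact: mdiff.
  apply: (@measurable_in_cylinder R d J _ Z3 setT (fun=> 0%R) (fun q => q.2 - q.1.2)%R
    (fun q => path_fun (path_shift (nonneg_part q.1.2) q.1.1)) c measurableT mc) => s B s0 mB.
  rewrite setTI (_ : [set q | _] = [set q : Z3 | (s < q.2 - q.1.2)%R] `&`
     ((fun q : Z3 => path_fun (path_shift (nonneg_part q.1.2) q.1.1) s) @^-1` B)).
    apply: measurableI; first exact: measurable_set_lt.
    rewrite -[X in measurable X]setTI.
    have := measurableT_comp (measurable_at HW s0)
      (measurableT_comp (@measurable_shift_path) (@measurable_fst _ _ (pathT W * R)%type R)).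
    exact.
  by apply/seteqP; split => q /=; rewrite s0.
rewrite setTI; apply/seteqP; split => q /= => [[? ? ?]|[[? ?] ?]]; by [].
Qed.

Lemma measurable_step_weight l c a B : measurable_cylinder c -> measurable B ->
  measurable_fun setT
    (fun q : Z3 => step_weight l c a B (pos_path q.1.1) q.1.2 q.2).
Proof.
move=> mc mB; have mpos := @measurable_pos_path.
apply: emeasurable_funM; last first.
  apply: emeasurable_funM.
    exact: measurableT_comp (measurable_line_density mrate rate_ge0 mp p_ge0 mpos l) measurable_fst.
  apply: emeasurable_funM.
    exact: measurableT_comp (measurable_fission_rate mrate mp mpos a) m13.
  exact: measurableT_comp (measurable_survival mrate rate_ge0 mpos) m13.
rewrite (_ : (fun q => _) = (fun q => (\1_([set q : Z3 | (0 <= q.1.2)%R] `&`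
    [set q : Z3 | (q.1.2 <= q.2)%R] `&`
    (fst @^-1` [set q : pathT W * R | in_cylinder c 0 q.2 (pos_path q.1)]) `&`
    ((fun q : Z3 => pos_path q.1.1 q.2) @^-1` B)) q : R)%:E)).
  apply/measurable_EFinP/measurable_indic; apply: measurableI; last first.
    rewrite -[X in measurable X]setTI.
    by apply: (measurableT_comp mpos m13).
  apply: measurableI; last first.
    rewrite -[X in measurable X]setTI; apply: measurable_fst => //.
    exact: (measurable_past_cylinder mpos).
  by apply: measurableI; apply: measurable_set_le => //; exact: measurable_snd.
apply/funext => -[[X r0] r]; rewrite !indicE; congr (_%:R%:E); congr nat_of_bool.
apply/idP/idP => /set_mem /=.
  by move=> [/andP[? ?] ? ?]; exact/mem_set.
by move=> [[[? ?] ?] ?]; apply/mem_set; split=> //=; apply/andP.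
Qed.

Lemma measurable_life_law C a B c : measurable C -> measurable B ->
  measurable_cylinder c ->
  measurable_fun setT (fun y => life_law Xi rate p y (cylinder_test C a B c)).
Proof.
move=> mC mB mc; apply: measurable_kernel_integral.
  exact: measurable_life_law_along.
by move=> X; exact: life_law_along_ge0.
Qed.

(** Tonelli makes [r0] the outer variable, so that the Markov property is applied at a deterministic
    time. Translation invariance of Lebesgue measure then replaces the age at fission by the fission
    time. *)
Lemma generation_step l c a B (C0 C : set R) c' : measurable_cylinder c -> measurable B ->
  measurable C0 -> measurable C -> measurable_cylinder c' ->
  \int[PX]_X \int[line_measure l]_r0 (past_weight l c (pos_path X) r0 *
    ((\1_C0 r0 : R)%:E * life_law Xi rate p (pos_path X r0) (cylinder_test C a B c'))) =
  \int[PX]_X \int[line_measure l]_r0 \int[leb]_r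
    (step_weight l c a B (pos_path X) r0 r *
     (\1_(killed_test C0 C c') (killed_at_step (X, r0, r)))%:E).
Proof.
move=> mc mB mC0 mC mc'; have mpos := @measurable_pos_path.
set e := cylinder_test C a B c'.
have mpast : measurable_fun setT (fun q : pathT W * R => past_weight l c (pos_path q.1) q.2).
  exact: (measurable_past_weight mrate rate_ge0 mp p_ge0 mpos).
have past0 q := past_weight_ge0 rate_ge0 p_ge0 l c (pos_path q.1) q.2.
have mC0' : measurable_fun setT (fun q : pathT W * R => (\1_C0 q.2 : R)%:E).
  apply/measurable_EFinP; exact: measurableT_comp (measurable_indic mC0) measurable_snd.
have C0ge0 (r : R) : 0 <= (\1_C0 r : R)%:E by rewrite lee_fin.
have mlaw := measurable_life_law a mC mB mc'.
have malong := measurable_life_law_along a mC mB mc'.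
have along0 := life_law_along_ge0 e.
have law0 y : 0 <= life_law Xi rate p y e by apply: integral_ge0 => X _; exact: along0.
pose h1 (q : pathT W * R) := past_weight l c (pos_path q.1) q.2 *
  ((\1_C0 q.2 : R)%:E * life_law Xi rate p (pos_path q.1 q.2) e).
pose h2 (q : pathT W * R) := past_weight l c (pos_path q.1) q.2 *
  ((\1_C0 q.2 : R)%:E * life_law_along rate p e (path_shift (nonneg_part q.2) q.1)).
have mh1 : measurable_fun setT h1.
  apply: emeasurable_funM => //; apply: emeasurable_funM => //.
  exact: measurableT_comp mlaw mpos.
have mh2 : measurable_fun setT h2.
  apply: emeasurable_funM => //; apply: emeasurable_funM => //.
  exact: measurableT_comp malong (@measurable_shift_path).
have h10 q : 0 <= h1 q by rewrite mule_ge0 ?past0 // mule_ge0.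
have h20 q : 0 <= h2 q by rewrite mule_ge0 ?past0 // mule_ge0.
have F1 := @fubini_tonelli _ _ _ _ _ PX (line_measure l) h1 mh1 h10.
have F2 := @fubini_tonelli _ _ _ _ _ PX (line_measure l) h2 mh2 h20.
transitivity (\int[PX]_X \int[line_measure l]_r0 h2 (X, r0)).
  apply: (etrans F1); apply: (etrans _ (esym F2)).
  apply: eq_integral => r0 _; rewrite /h1 /h2 /= integral_kernel_law [RHS]integral_kernel_law.
  have [r00|r00] := leP 0%R r0; last first.
    by rewrite !integral0_eq // => X _; rewrite past_weight_lt0 // mul0e.
  under eq_integral do rewrite muleA.
  under [RHS]eq_integral do rewrite muleA.
  apply: (markov_fun HW HXi x (r := nonneg_part r0)
    (G := fun X => past_weight l c (pos_path X) r0 * (\1_C0 r0 : R)%:E)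
    (psi := life_law_along rate p e)) => //.
    apply: emeasurable_funM => //.
    exact: adapted_past_weight.
  by move=> X; rewrite mule_ge0 ?(past0 (X, r0)).
apply: eq_integral => X _; apply: eq_integral => r0 _.
rewrite /h2 /= life_law_along_cylinder // muleA.
have malw := measurable_along_weight mrate rate_ge0 mp mpos a mC mB mc'.
have malw' := measurable_fun_pair2 (path_shift (nonneg_part r0) X : pathT W) malw.
have alw0 (r : R) := along_weight_ge0 rate_ge0 p_ge0 C a B c' (pos_path (path_shift (nonneg_part r0) X)) r.
have A0 : 0 <= past_weight l c (pos_path X) r0 * (\1_C0 r0 : R)%:E.
  by rewrite mule_ge0 ?(past0 (X, r0)).
rewrite -ge0_integralZl //.
rewrite -(integral_shift (- r0)%R); last 2 first.
- by apply: emeasurable_funM.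
- by move=> r; rewrite mule_ge0.
by apply: eq_integral => r _; rewrite step_weightE.
Qed.

Definition killed_window (C2 : set (R * R)) c : set (killedT W) :=
  [set z | C2 (z.1, z.1 + z.2.1)%R /\
    in_cylinder c z.1 (z.1 + z.2.1)%R (fun s => path_fun z.2.2 (s - z.1)%R)].

(** The cylinder conditions before and after the birth time [r0] join into one on [[0, r[], after
    which [r0] appears only in the density of the line; integrating it over [[0, tau r]] gives the
    line integral at [tau r]. *)
Lemma window_step l c a B (C : set R) (tau : R -> R) (X : sample_path W) :
  measurable_cylinder c -> measurable B -> measurable C -> measurable_fun setT tau ->
  (forall r, C r -> (0 <= tau r <= r)%R) ->
  \int[line_measure l]_r0 \int[leb]_r
    (step_weight l c a B (pos_path X) r0 r *
     (\1_(killed_window [set q | (q.1 <= tau q.2)%R /\ C q.2] c)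
       (killed_at_step (X : pathT W, r0, r)))%:E) =
  \int[leb]_r ((\1_[set r | [/\ C r, B (pos_path X r) & in_cylinder c 0 r (pos_path X)]] r : R)%:E *
    ((fission_rate rate p (pos_path X) a r)%:E * expeR (- cumulated_rate rate (pos_path X) r) *
     line_integral (fission_rate rate p (pos_path X)) l (tau r))).
Proof.
move=> mc mB mC mtau Ctau; set f := pos_path X; set K := killed_window _ c.
have mpos := @measurable_pos_path.
have mC2 : measurable [set q : R * R | (q.1 <= tau q.2)%R /\ C q.2].
  rewrite (_ : [set q | _] = [set q : R * R | (q.1 <= tau q.2)%R] `&` snd @^-1` C) //.
  apply: measurableI; last by rewrite -[X in measurable X]setTI; exact: measurable_snd.
  apply: measurable_set_le => //; exact: measurableT_comp mtau measurable_snd.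
have mK : measurable K by exact: measurable_killed_window.
pose V r := (\1_[set r | [/\ C r, B (f r) & in_cylinder c 0 r f]] r : R)%:E *
    ((fission_rate rate p f a r)%:E * expeR (- cumulated_rate rate f r)).
have V0 r : 0 <= V r.
  by rewrite mule_ge0 ?lee_fin // mule_ge0 ?expeR_ge0 // lee_fin; exact: fission_rate_ge0.
pose D r0 r : \bar R := (if (0 <= r0 <= tau r)%R then line_density rate p f l r0 else 0).
have mX : measurable_fun setT (fun q : R * R => ((X : pathT W, q.1), q.2)).
  apply: measurable_fun_pair; last exact: measurable_snd.
  apply: measurable_fun_pair; last exact: measurable_fst.
  exact: measurable_cst.
have E r0 r : step_weight l c a B f r0 r * (\1_K (killed_at_step (X : pathT W, r0, r)))%:E =
    D r0 r * V r.
  have KE : (0 <= r0)%R -> K (killed_at_step (X : pathT W, r0, r)) <->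
      ((r0 <= tau r)%R /\ C r) /\ in_cylinder c r0 r f.
    move=> r0_ge0; rewrite /K /killed_window /= subrKC; split=> -[CC H]; split=> //;
      move: H; apply eq_in_cylinder => s /andP[r0s sr];
      by rewrite /f pos_pathE ?(le_trans r0_ge0) //=; congr path_fun;
        rewrite (max_idPr r0_ge0) subrKC.
  have [[/andP[r00 r0t] [Cr Br cr]]|H] := pselect ((0 <= r0 <= tau r)%R /\
      [/\ C r, B (f r) & in_cylinder c 0 r f]).
    have /andP[t0 tr] := Ctau _ Cr.
    have r0r : (0 <= r0 <= r)%R by rewrite r00 (le_trans r0t).
    have [c1 c2] := (in_cylinder_split c f r0r).1 cr.
    rewrite /V /D r00 r0t /step_weight !indicE !mem_set //=; last by apply/KE.
    by rewrite !mul1e mule1.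
  transitivity (0 : \bar R).
    rewrite /step_weight !indicE.
    case: (boolP ((r0, r) \in _)) => [/set_mem[/= r0r c1 Br]|_]; last by rewrite !mul0e.
    have /andP[r00 _] := r0r.
    case: (boolP (_ \in K)) => [/set_mem /(KE r00) [[r0t Cr] c2]|_]; last by rewrite mule0.
    exfalso; apply: H; split; first by rewrite r00 r0t.
    by split=> //; apply/(in_cylinder_split c f r0r).
  rewrite /V /D indicE; case: ifPn => r0t; last by rewrite mul0e.
  case: (boolP (r \in _)) => [/set_mem VV|_]; last by rewrite mul0e mule0.
  by exfalso; apply: H; split.
have mD r : measurable_fun setT (fun r0 : R => D r0 r).
  have := measurable_fun_pair2 (X : pathT W) (measurable_line_density mrate rate_ge0 mp p_ge0 mpos l).
  move=> mdens; apply: measurable_fun_ifT => //.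
  by apply: measurable_and; apply: measurable_fun_ler.
have D0 r0 r : 0 <= D r0 r.
  by rewrite /D; case: ifP => // _; exact: line_density_ge0.
pose G (q : R * R) := D q.1 q.2 * V q.2.
have mG : measurable_fun setT G.
  have -> : G = (fun q => step_weight l c a B f q.1 q.2 *
      (\1_K (killed_at_step (X : pathT W, q.1, q.2)))%:E).
    by apply/funext => -[r0 r]; rewrite E.
  apply: emeasurable_funM.
    exact: measurableT_comp (measurable_step_weight l a mc mB) mX.
  apply/measurable_EFinP; apply: (measurableT_comp (measurable_indic mK)).
  exact: measurableT_comp (@measurable_killed_at_step) mX.
have G0 q : 0 <= G q by rewrite mule_ge0.
transitivity (\int[line_measure l]_r0 \int[leb]_r G (r0, r)).
  by apply: eq_integral => r0 _; apply: eq_integral => r _; exact: E.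
apply: (etrans (@fubini_tonelli _ _ _ _ _ (line_measure l) leb G mG G0)).
apply: eq_integral => r _; rewrite /G /=.
rewrite ge0_integralZr //; last exact: mD.
rewrite muleC /V -muleA indicE.
case: (boolP (r \in _)) => [/set_mem[Cr _ _]|_]; last by rewrite !mul0e.
have /andP[t0 _] := Ctau _ Cr.
congr (_ * (_ * _)); rewrite line_integral_density // [RHS]integral_mkcond.
apply: eq_integral => r0 _; rewrite patchE /D.
by rewrite mem_setE in_itv.
Qed.

End GenerationStepOnPaths.

(** * Genealogy and measurability on trees *)

Section TreeGenealogy.
Context {R : realType} {d : measure_display} {J : measurableType d}.
Variable W : path_class R J.
Implicit Types (w : spined_tree W) (u v : seq nat) (l : seq (nat * nat)).

Lemma ancestors_rcons u j : ancestors (rcons u j) = rcons (ancestors u) (rcons u j).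
Proof.
rewrite /ancestors; congr rcons; rewrite /strict_ancestors size_rcons.
rewrite -addn1 iotaD map_cat add0n /= cats1.
congr rcons; last by rewrite -cats1 take_size_cat.
apply/eq_in_map => k; rewrite mem_iota /= add0n => ku.
by rewrite -cats1 takel_cat // ltnW.
Qed.

Lemma strict_ancestors_rcons u j : strict_ancestors (rcons u j) = ancestors u.
Proof. by have := ancestors_rcons u j; rewrite /ancestors => /rcons_inj[]. Qed.

Lemma fission_birth w u : fission w u = birth w u + life w u.
Proof. by rewrite /birth /birth_time subrK. Qed.

Lemma birth_root w : birth w [::] = 0.
Proof. by rewrite /birth /birth_time /fission_time /= big_seq1 subrr. Qed.

Lemma birth_rcons w u j : birth w (rcons u j) = fission w u.
Proof.
rewrite /birth /birth_time /fission /fission_time ancestors_rcons.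
by rewrite -cats1 big_cat big_seq1 /= addrK.
Qed.

Lemma tree_rcons w u j : tree w (rcons u j) -> tree w u.
Proof. by rewrite -cats1; exact: tree_prefix. Qed.

Lemma tree_child1 w u : tree w u -> tree w (rcons u 1%N).
Proof. by move=> wu; apply/(tree_children _ wu). Qed.

Lemma birth_ge0 w u : tree w u -> 0 <= birth w u.
Proof.
elim/last_ind: u => [|u j IHu] wu; first by rewrite birth_root.
have wu' := tree_rcons wu.
by rewrite birth_rcons fission_birth addr_ge0 ?IHu // ltW // life_gt0.
Qed.

Lemma birth_lt_fission w u : tree w u -> birth w u < fission w u.
Proof. by move=> wu; rewrite fission_birth ltrDl life_gt0. Qed.

Lemma fission_gt0 w u : tree w u -> 0 < fission w u.
Proof. by move=> wu; apply: le_lt_trans (birth_lt_fission wu); exact: birth_ge0. Qed.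

Definition alive_ancestors w u s := [seq v <- ancestors u | alive_at (life w) s v].

Lemma alive_atE w u s : alive_at (life w) s u = (birth w u <= s) && (s < fission w u).
Proof. by []. Qed.

Lemma alive_ancestors_rcons w u j s : alive_ancestors w (rcons u j) s =
  if alive_at (life w) s (rcons u j) then rcons (alive_ancestors w u s) (rcons u j)
  else alive_ancestors w u s.
Proof. by rewrite /alive_ancestors ancestors_rcons filter_rcons. Qed.

Lemma alive_ancestors_neq0 w u s : tree w u -> 0 <= s < fission w u ->
  alive_ancestors w u s <> [::].
Proof.
elim/last_ind: u => [|u j IHu] wu /andP[s0 su].
  by rewrite /alive_ancestors /= alive_atE birth_root s0 su.
rewrite alive_ancestors_rcons alive_atE birth_rcons su andbT.
case: leP => sf; first by case: (alive_ancestors w u s).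
by apply: IHu; [exact: tree_rcons wu|rewrite s0].
Qed.

Lemma alive_ancestors_fission w u s : tree w u -> fission w u <= s ->
  alive_ancestors w u s = [::].
Proof.
elim/last_ind: u => [|u j IHu] wu fs.
  by rewrite /alive_ancestors /= alive_atE (ltNge s) fs andbF.
rewrite alive_ancestors_rcons alive_atE (ltNge s) fs andbF; apply: IHu.
  exact: tree_rcons wu.
apply: le_trans fs; rewrite -(birth_rcons w u j); exact/ltW/birth_lt_fission.
Qed.

Lemma position_rcons w u j s : tree w (rcons u j) -> 0 <= s < fission w u ->
  position w (rcons u j) s = position w u s.
Proof.
move=> wu /andP[s0 su]; rewrite /position /extended_path -!/(alive_ancestors _ _ _).
rewrite alive_ancestors_rcons alive_atE birth_rcons leNgt su /=.
have : alive_ancestors w u s <> [::].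
  by apply: alive_ancestors_neq0; [exact: tree_rcons wu|rewrite s0].
by case: (alive_ancestors w u s).
Qed.

Lemma position_alive w u s : tree w u -> birth w u <= s < fission w u ->
  position w u s = seg w u s.
Proof.
case/lastP: u => [|u j] wu us; rewrite /position /extended_path.
  by rewrite /= alive_atE us.
rewrite -/(alive_ancestors _ _ _) alive_ancestors_rcons alive_atE us.
rewrite (alive_ancestors_fission (tree_rcons wu)) //.
by rewrite -(birth_rcons w u j); case/andP: us.
Qed.

(** A chosen trajectory that extends the positions of [u]. It is meaningful before the fission of
    [u] only, so no event may look at it later. *)
Definition tree_path w u : sample_path W :=
  if pselect (tree w u) is left wu then sval (cid (seg_trajectory wu))
  else sample_path0 W.

Lemma tree_pathE w u s : tree w u -> 0 <= s < fission w u ->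
  path_fun (tree_path w u) s = position w u s.
Proof.
move=> wu su; rewrite /tree_path; case: pselect => // wu'.
by rewrite -(svalP (cid (seg_trajectory wu')) s su).
Qed.

(** At its fission time [u] has disappeared. The place is read on the path of its first child, which
    always exists and is alive then. *)
Lemma fission_positionE w u : tree w u ->
  fission_position w u = path_fun (tree_path w (rcons u 1%N)) (fission w u).
Proof.
move=> wu; have wu1 := tree_child1 wu.
have lt1 : birth w (rcons u 1%N) < fission w (rcons u 1%N) by exact: birth_lt_fission.
rewrite tree_pathE //; last by rewrite (ltW (fission_gt0 wu)) -(birth_rcons w u 1%N).
by rewrite position_alive // birth_rcons lexx -(birth_rcons w u 1%N).
Qed.

Definition life_path w u : sample_path W :=
  path_shift (nonneg_part (birth w u)) (tree_path w u).

Lemma life_pathE w u s : tree w u -> 0 <= s < life w u ->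
  path_fun (life_path w u) s = seg w u (birth w u + s).
Proof.
move=> wu /andP[s0 su]; have b0 := birth_ge0 wu.
rewrite /life_path /path_shift /= (max_idPr b0) tree_pathE ?position_alive //.
  by rewrite lerDl s0 fission_birth ltrD2l.
by rewrite addr_ge0 // fission_birth ltrD2l.
Qed.

Lemma life_path_position w u s : tree w u -> birth w u <= s < fission w u ->
  path_fun (life_path w u) (s - birth w u) = position w u s.
Proof.
move=> wu us; rewrite life_pathE ?subr_ge0 ?ltrBlDl -?fission_birth //.
by rewrite subrKC position_alive.
Qed.

Lemma birth_position_rcons (x : J) w u j :
  birth_position x w (rcons u j) = fission_position w u.
Proof.
by rewrite /birth_position size_rcons -cats1 take_size_cat.
Qed.

Definition word l : seq nat := rev [seq ja.1.+1 | ja <- l].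

Lemma word_cons ja l : word (ja :: l) = rcons (word l) ja.1.+1.
Proof. by rewrite /word /= rev_cons. Qed.

Lemma size_word l : size (word l) = size l.
Proof. by rewrite size_rev size_map. Qed.

(** Only the brood sizes are prescribed: for a line that fits, they already force its word into the
    tree. *)
Fixpoint line_event l : set (spined_tree W) :=
  if l is ja :: l' then line_event l' `&` [set w | brood w (word l') = ja.2]
  else setT.

Lemma line_event_tree l w : fits l -> line_event l w -> tree w (word l).
Proof.
elim: l => [|[j a] l IHl] /= => [_ _|/andP[ja fl] [wl aE]]; first exact: tree_root.
rewrite word_cons; apply/(tree_children _ (IHl fl wl)).
by rewrite aE add1n ltnS.
Qed.

End TreeGenealogy.

(** * What is observable up to a fixed time *)

Section TreeMeasurability.
Context {R : realType} {d : measure_display} {J : measurableType d}.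
Variables (W : path_class R J) (HW : progressively_measurable W).
Implicit Types (w : spined_tree W) (u v : seq nat) (l : seq (nat * nat)).
Local Notation genF t := (@filt_F_generators R d J W t).
Local Notation FT t := (g_sigma_algebraType (genF t)).

Section AtTime.
Variable t : R.

Lemma measurable_population u : measurable ([set w : spined_tree W | population w t u] : set (FT t)).
Proof.
apply: sub_sigma_algebra; right; exists u, t, setT; split=> //.
by apply/seteqP; split=> w /= => [wu|[]//]; split=> //; case: wu => _ /andP[-> _]; rewrite lexx.
Qed.

Lemma measurable_dead u : measurable ([set w : spined_tree W | tree w u /\ fission w u <= t] : set (FT t)).
Proof.
apply: sub_sigma_algebra; left; left; exists u, setT; split=> //.
by apply/seteqP; split=> w /= [].
Qed.

Lemma measurable_born u : measurable ([set w : spined_tree W | tree w u /\ birth w u <= t] : set (FT t)).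
Proof.
rewrite (_ : [set w | _] = [set w : spined_tree W | tree w u /\ fission w u <= t] `|` [set w : spined_tree W | population w t u]).
  by apply: measurableU; [exact: measurable_dead|exact: measurable_population].
apply/seteqP; split=> w /=.
  move=> [wu bt]; have [ft|tf] := leP (fission w u) t; first by left.
  by right; split=> //; rewrite alive_atE bt.
move=> [[wu ft]|[wu /andP[bt _]]]; split=> //.
exact: le_trans (ltW (birth_lt_fission wu)) ft.
Qed.

(** The generators of [filt_F t] do not mention brood sizes. That of a dead particle is read off its
    children: number [a.+1] is born and number [a.+2] is not. *)
Lemma measurable_brood_upto u a :
  measurable ([set w : spined_tree W | [/\ tree w u, fission w u <= t & brood w u = a]] : set (FT t)).
Proof.
rewrite (_ : [set w | _] = [set w : spined_tree W | tree w u /\ fission w u <= t] `&`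
  [set w : spined_tree W | tree w (rcons u a.+1) /\ birth w (rcons u a.+1) <= t] `\`
  [set w : spined_tree W | tree w (rcons u a.+2) /\ birth w (rcons u a.+2) <= t]).
  by apply: measurableD; [apply: measurableI|]; try exact: measurable_born; exact: measurable_dead.
apply/seteqP; split=> w /=.
  move=> [wu ft uE]; split.
    split=> //; split; last by rewrite birth_rcons.
    by apply/(tree_children _ wu); rewrite uE add1n ltnS leqnn.
  by move=> [/(tree_children _ wu)]; rewrite uE add1n ltnn andbF.
move=> [[[wu ft] [/(tree_children _ wu) + _]] H]; rewrite add1n /= ltnS => ab.
split=> //; apply/eqP; rewrite eqn_leq ab andbT leqNgt; apply/negP => ba.
apply: H; split; last by rewrite birth_rcons.
by apply/(tree_children _ wu); rewrite add1n ltnS.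
Qed.

(** The generators show each particle during its own life only. The extended path at [s] is followed
    up the ancestors to the one whose life contains [s], and [own] treats that one, dead or still
    alive at [t]. *)
Lemma measurable_position_born u s (B : set J) : 0 <= s <= t -> measurable B ->
  measurable ([set w : spined_tree W | [/\ tree w u, birth w u <= t, s < fission w u & B (position w u s)]] : set (FT t)).
Proof.
move=> /andP[s0 st] mB.
have own v : measurable ([set w : spined_tree W | [/\ tree w v, birth w v <= s < fission w v & B (position w v s)]] : set (FT t)).
  rewrite (_ : [set w | _] =
    [set w : spined_tree W | [/\ tree w v, fission w v <= t,
                      birth w v <= s < fission w v & B (seg w v s)]] `|`
    ([set w : spined_tree W | [/\ population w t v, birth w v <= s <= t & B (seg w v s)]] `&`
     [set w : spined_tree W | population w t v])).
    apply: measurableU; first by apply: sub_sigma_algebra; left; right; exists v, s, B.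
    apply: measurableI; last exact: measurable_population.
    by apply: sub_sigma_algebra; right; exists v, s, B.
  apply/seteqP; split=> w /=.
    move=> [wv sv]; rewrite position_alive // => Bs.
    have [ft|tf] := leP (fission w v) t; [by left|right].
    have /andP[bs _] := sv.
    have pv : population w t v by split=> //; rewrite alive_atE (le_trans bs).
    by split=> //; split=> //; rewrite bs.
  move=> [[wv ft sv Bs]|[[[wv tv] /andP[bs _] Bs] _]].
    by split=> //; rewrite position_alive.
  have sv : birth w v <= s < fission w v.
    by move: tv; rewrite bs alive_atE => /andP[_]; exact: le_lt_trans.
  by split=> //; rewrite position_alive.
elim/last_ind: u => [|u j IHu].
  rewrite (_ : [set w | _] = [set w : spined_tree W | [/\ tree w [::], birth w [::] <= s < fission w [::] & B (position w [::] s)]]) //.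
  apply/seteqP; split=> w /=; rewrite birth_root s0; first by move=> [].
  by move=> [? ? ?]; split=> //; exact: le_trans st.
rewrite (_ : [set w | _] =
  ([set w : spined_tree W | tree w (rcons u j) /\ birth w (rcons u j) <= t] `&`
   [set w : spined_tree W | [/\ tree w u, birth w u <= t, s < fission w u & B (position w u s)]]) `|`
  [set w : spined_tree W | [/\ tree w (rcons u j), birth w (rcons u j) <= s < fission w (rcons u j) &
             B (position w (rcons u j) s)]]).
  apply: measurableU => //; apply: measurableI => //; exact: measurable_born.
apply/seteqP; split=> w /=.
  move=> [wu bt sf Bs]; have [bs|sb] := leP (birth w (rcons u j)) s.
    by right; rewrite sf.
  left; split=> //; have wu' := tree_rcons wu.
  move: bt sb; rewrite birth_rcons => ft sb; split=> //.
    exact: le_trans (ltW (birth_lt_fission wu')) ft.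
  by rewrite -(position_rcons wu) // s0.
move=> [[[wu bt] [wu' bt' sf Bs]]|[wu /andP[bs sf] Bs]]; last first.
  by split=> //; exact: le_trans st.
split=> //; last by rewrite position_rcons // s0.
by apply: (lt_trans sf); rewrite -(birth_rcons w u j); exact: birth_lt_fission.
Qed.

Lemma measurable_position_alive u s (B : set J) : 0 <= s <= t -> measurable B ->
  measurable ([set w : spined_tree W | population w t u /\ B (position w u s)] : set (FT t)).
Proof.
move=> st mB; rewrite (_ : [set w | _] = [set w : spined_tree W | population w t u] `&`
   [set w : spined_tree W | [/\ tree w u, birth w u <= t, s < fission w u & B (position w u s)]]).
  by apply: measurableI; [exact: measurable_population|exact: measurable_position_born].
apply/seteqP; split=> w /=; last by move=> [? []].
move=> [wu Bs]; split=> //; case: (wu) => wu' /andP[bt tf]; split=> //.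
by apply: le_lt_trans tf; case/andP: st.
Qed.

(** A particle alive at [t] splits after [t], so its chosen trajectory agrees with its positions on
    [[0, t]], however arbitrary it is later. *)
Lemma measurable_tree_path_alive u (E : set (sample_path W)) : 0 <= t ->
  <<s @cylinders_upto R d J W t >> E ->
  measurable ([set w : spined_tree W | population w t u /\ E (tree_path w u)] : set (FT t)).
Proof.
move=> t0 cE.
have mpop := measurable_population u.
have : measurable_fun ([set w : spined_tree W | population w t u] : set (FT t))
    (fun w => tree_path w u : g_sigma_algebraType (@cylinders_upto R d J W t)).
  apply: measurable_fun_g_sigma => // _ [s [B [st mB ->]]].
  rewrite (_ : _ `&` _ = [set w : spined_tree W | population w t u /\ B (position w u s)]).
    exact: measurable_position_alive.
  have /andP[s0 st'] := st.
  apply/seteqP; split=> w /= [wu]; (rewrite tree_pathE; last 2 first);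
    try by case: wu => wu /andP[_ tf]; rewrite ?s0 ?(le_lt_trans st').
  - by move=> Bs.
  - by move=> Bs.
by move=> /(_ mpop E cE).
Qed.

End AtTime.

End TreeMeasurability.

Section TreeMeasurabilityAtInfinity.
Context {R : realType} {d : measure_display} {J : measurableType d}.
Variables (W : path_class R J) (HW : progressively_measurable W).
Implicit Types (w : spined_tree W) (u v : seq nat) (l : seq (nat * nat)).
Local Notation FT t := (g_sigma_algebraType (@filt_F_generators R d J W t)).
Local Notation Finf := (g_sigma_algebraType (at_infinity (@filt_F R d J W))).

Lemma measurable_filt_F t (A : set (spined_tree W)) : 0 <= t ->
  measurable (A : set (FT t)) -> measurable (A : set Finf).
Proof. by move=> t0 mA; apply: sub_sigma_algebra; exists t. Qed.

Let mnat (F : nat -> set (spined_tree W)) :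
  (forall n, measurable (F n : set (FT n%:R))) -> measurable (\bigcup_n F n : set Finf).
Proof. by move=> mF; apply: bigcupT_measurable => n; exact: measurable_filt_F (mF n). Qed.

Let archi (y : R) : exists n : nat, y <= n%:R.
Proof.
exists (Num.bound `|y|).
exact: le_trans (ler_norm y) (ltW (archi_boundP (normr_ge0 y))).
Qed.

Lemma measurable_life u : measurable_fun ([set w | tree w u] : set Finf) (fun w => life w u).
Proof.
move=> _ C mC.
rewrite (_ : _ `&` _ = \bigcup_n [set w : spined_tree W | [/\ tree w u, fission w u <= n%:R & C (life w u)]]).
  by apply: mnat => n; apply: sub_sigma_algebra; left; left; exists u, C.
apply/seteqP; split=> w /=; last by move=> [n _ []].
by move=> [wu Cw]; have [n fn] := archi (fission w u); exists n.
Qed.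

Lemma measurable_tree u : measurable ([set w : spined_tree W | tree w u] : set Finf).
Proof.
rewrite (_ : [set w | _] = \bigcup_n [set w : spined_tree W | tree w u /\ fission w u <= n%:R]).
  by apply: mnat => n; exact: measurable_dead.
apply/seteqP; split=> w /=; last by move=> [n _ []].
by move=> wu; have [n fn] := archi (fission w u); exists n.
Qed.

Lemma measurable_brood u a :
  measurable ([set w : spined_tree W | tree w u /\ brood w u = a] : set Finf).
Proof.
rewrite (_ : [set w | _] = \bigcup_n [set w : spined_tree W | [/\ tree w u, fission w u <= n%:R & brood w u = a]]).
  by apply: mnat => n; exact: measurable_brood_upto.
apply/seteqP; split=> w /=; last by move=> [n _ []].
by move=> [wu Aw]; have [n fn] := archi (fission w u); exists n.
Qed.

Lemma measurable_birth_fission u :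
  measurable_fun ([set w | tree w u] : set Finf) (fun w => birth w u) /\
  measurable_fun ([set w | tree w u] : set Finf) (fun w => fission w u).
Proof.
have E v : (fun w => fission w v) = (fun w : spined_tree W => birth w v + life w v).
  by apply/funext => w; rewrite fission_birth.
elim/last_ind: u => [|u j [_ IHu]].
  have -> : (fun w => birth w [::]) = cst 0 :> (spined_tree W -> R).
    by apply/funext => w; rewrite birth_root.
  split; first exact: measurable_cst.
  rewrite E; apply: measurable_funD; last exact: measurable_life.
  by rewrite (_ : (fun w => birth w [::]) = cst 0) //; apply/funext => w; rewrite birth_root.
have mb : measurable_fun ([set w | tree w (rcons u j)] : set Finf) (fun w => birth w (rcons u j)).
  rewrite (_ : (fun w => _) = (fun w : spined_tree W => fission w u)); last first.
    by apply/funext => w; rewrite birth_rcons.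
  apply: (measurable_funS (measurable_tree u)) IHu => w; exact: tree_rcons.
split=> //; rewrite E; apply: measurable_funD => //; exact: measurable_life.
Qed.

Lemma measurable_tree_path u s (B : set J) : 0 <= s -> measurable B ->
  measurable ([set w : spined_tree W | [/\ tree w u, s < fission w u & B (path_fun (tree_path w u) s)]] : set Finf).
Proof.
move=> s0 mB.
rewrite (_ : [set w | _] = \bigcup_n (if s <= n%:R then
    [set w : spined_tree W | [/\ tree w u, birth w u <= n%:R, s < fission w u & B (position w u s)]] else set0)).
  apply: mnat => n; case: ifPn => // sn; apply: measurable_position_born => //.
  by rewrite s0.
apply/seteqP; split=> w /=.
  move=> [wu sf Bs]; have [n] := archi (Num.max s (birth w u)); rewrite ge_max => /andP[sn bn].
  by exists n => //; rewrite sn; split=> //; rewrite -tree_pathE // s0.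
by move=> [n _]; case: ifP => // _ [wu bn sf Bs]; split=> //; rewrite tree_pathE // s0.
Qed.

Lemma measurable_tree_path_at u (tau : spined_tree W -> R) (B : set J) :
  measurable_fun ([set w | tree w u] : set Finf) tau -> measurable B ->
  measurable ([set w : spined_tree W | tree w u /\ (0 <= tau w < fission w u /\
    B (path_fun (tree_path w u) (tau w)))] : set Finf).
Proof.
move=> mtau mB.
have := @measurable_eval_killed R d J W HW _ Finf [set w | tree w u]
  (fun w => fission w u) tau (fun w => tree_path w u) B (measurable_tree u)
  (measurable_birth_fission u).2 mtau _ mB.
apply=> s B' s0 mB'.
rewrite (_ : _ `&` _ = [set w : spined_tree W | [/\ tree w u, s < fission w u & B' (path_fun (tree_path w u) s)]]).
  exact: measurable_tree_path.
by apply/seteqP; split=> w /= => [[? []]|[]].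
Qed.

Lemma measurable_fission_position u :
  measurable_fun ([set w | tree w u] : set Finf) (fun w => fission_position w u).
Proof.
move=> _ B mB.
have sub : [set w : spined_tree W | tree w (rcons u 1%N)] `<=` [set w : spined_tree W | tree w u].
  by move=> w; exact: tree_rcons.
have := @measurable_tree_path_at (rcons u 1%N) (fun w => fission w u) B
  (measurable_funS (measurable_tree u) sub (measurable_birth_fission u).2) mB.
congr (measurable _); apply/seteqP; split=> w /=.
  by move=> [wu [_ Bs]]; have wu' := tree_rcons wu; rewrite fission_positionE.
move=> [wu Bs]; have wu1 := tree_child1 wu; split=> //; rewrite -fission_positionE //.
by rewrite (ltW (fission_gt0 wu)) -(birth_rcons w u 1%N) birth_lt_fission.
Qed.

Lemma measurable_birth_position x u :
  measurable_fun ([set w | tree w u] : set Finf) (fun w => birth_position x w u).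
Proof.
case/lastP: u => [|u j]; first exact: measurable_cst.
rewrite (_ : (fun w => _) = (fun w : spined_tree W => fission_position w u)).
  have sub : [set w : spined_tree W | tree w (rcons u j)] `<=` [set w : spined_tree W | tree w u].
    by move=> w; exact: tree_rcons.
  have := measurable_funS (measurable_tree u) sub (measurable_fission_position (u := u)).
  exact.
by apply/funext => w; rewrite birth_position_rcons.
Qed.

Lemma measurable_seg u s (B : set J) : 0 <= s -> measurable B ->
  measurable ([set w : spined_tree W | tree w u /\ (s < life w u -> B (seg w u (birth w u + s)))] : set Finf).
Proof.
move=> s0 mB.
have mb := (measurable_birth_fission u).1.
have ms : measurable_fun ([set w | tree w u] : set Finf) (fun w => birth w u + s).
  by apply: measurable_funD.
have := @measurable_tree_path_at u (fun w => birth w u + s) (~` B) ms (measurableC mB).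
move=> /(measurableD (measurable_tree u)); congr (measurable _).
apply/seteqP; split=> w /=.
  move=> [wu H]; split=> // sl; apply: contrapT => nB; apply: H; split=> //.
  have b0 := birth_ge0 wu.
  have r : 0 <= birth w u + s < fission w u by rewrite addr_ge0 // fission_birth ltrD2l.
  split=> //; rewrite tree_pathE // position_alive //.
  by rewrite lerDl s0; case/andP: r.
move=> [wu H]; split=> // -[_ [r]]; apply; rewrite tree_pathE //.
have /andP[_ rf] := r; rewrite position_alive ?lerDl ?s0 //.
by apply: H; move: rf; rewrite fission_birth ltrD2l.
Qed.

Lemma measurable_particle_passes u e : measurable_test e ->
  measurable ([set w : spined_tree W | tree w u /\ particle_passes w u e] : set Finf).
Proof.
move=> [mlife mend mage mat].
have mseg : measurable ([set w : spined_tree W | tree w u /\ (forall i : 'I_(lt_num e),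
    lt_age i < life w u -> lt_at i (seg w u (birth w u + lt_age i)))] : set Finf).
  rewrite (_ : [set w | _] = [set w : spined_tree W | tree w u] `&`
    \bigcap_(i in [set` [pred i : 'I_(lt_num e) | true]]) [set w : spined_tree W | tree w u /\
     (lt_age i < life w u -> lt_at i (seg w u (birth w u + lt_age i)))]).
    apply: measurableI; first exact: measurable_tree.
    apply: fin_bigcap_measurable => [|i _]; first exact: finite_finset.
    by apply: measurable_seg.
  apply/seteqP; split=> w /= [wu H]; split=> //; first by move=> i _ /=; split=> //; exact: H.
  by move=> i; have [] := H i isT.
rewrite (_ : [set w | _] = ([set w : spined_tree W | tree w u] `&` (fun w => life w u) @^-1` lt_life e) `&`
  [set w : spined_tree W | tree w u /\ brood w u = lt_brood e] `&`
  ([set w : spined_tree W | tree w u] `&` (fun w => fission_position w u) @^-1` lt_end e) `&`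
  [set w : spined_tree W | tree w u /\ (forall i : 'I_(lt_num e),
    lt_age i < life w u -> lt_at i (seg w u (birth w u + lt_age i)))]).
  apply: measurableI => //; apply: measurableI; last exact: measurable_fission_position (measurable_tree u) _ mend.
  apply: measurableI; last exact: measurable_brood.
  exact: measurable_life (measurable_tree u) _ mlife.
apply/seteqP; split=> w /=; first by move=> [wu []].
by move=> [[[[wu ?] [_ ?]] [_ ?]] [_ ?]]; split.
Qed.

Lemma measurable_generations n (E : set (spined_tree W)) :
  generations_lt n E -> measurable (E : set Finf).
Proof.
apply: smallest_sub; first exact: sigma_algebra_measurable.
by move=> _ [u [e [_ me ->]]]; exact: measurable_particle_passes.
Qed.

End TreeMeasurabilityAtInfinity.

(** * What the earlier generations determine *)

Section GenerationMeasurability.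
Context {R : realType} {d : measure_display} {J : measurableType d}.
Variables (W : path_class R J) (HW : progressively_measurable W) (n : nat).
Implicit Types (w : spined_tree W) (u v : seq nat) (l : seq (nat * nat)).

Definition generation_tests : set (set (spined_tree W)) :=
  [set E | exists u e, [/\ (size u < n)%N, measurable_test e &
     E = [set w : spined_tree W | tree w u /\ particle_passes w u e]]].

Local Notation Gam := (g_sigma_algebraType generation_tests).

Lemma measurable_gen_test u C a (B : set J) c : (size u < n)%N -> measurable C ->
  measurable B -> measurable_cylinder c ->
  measurable ([set w : spined_tree W | tree w u /\
    [/\ C (life w u), brood w u = a, B (fission_position w u) &
        in_cylinder c 0 (life w u) (fun s => seg w u (birth w u + s))]] : set Gam).
Proof.
move=> un mC mB mc; apply: sub_sigma_algebra.
exists u, (cylinder_test C a B c); split=> //; first exact: measurable_cylinder_test.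
by apply/seteqP; split=> w /= [wu H]; split=> //; apply/(passes_cylinder_test _ _ _ _ _ _ _ mc).
Qed.

Lemma measurable_gen_brood u a : (size u < n)%N ->
  measurable ([set w : spined_tree W | tree w u /\ brood w u = a] : set Gam).
Proof.
move=> un.
have := @measurable_gen_test u setT a setT [::] un measurableT measurableT.
rewrite (_ : [set w | _ /\ [/\ _, _, _ & _]] = [set w : spined_tree W | tree w u /\ brood w u = a]); first exact.
by apply/seteqP; split=> w /= [wu]; [move=> []|split].
Qed.

Lemma measurable_gen_life u : (size u < n)%N ->
  measurable_fun ([set w : spined_tree W | tree w u] : set Gam) (fun w => life w u).
Proof.
move=> un _ C mC.
rewrite (_ : _ `&` _ = \bigcup_a [set w : spined_tree W | tree w u /\
    [/\ C (life w u), brood w u = a, setT (fission_position w u) &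
        in_cylinder [::] 0 (life w u) (fun s => seg w u (birth w u + s))]]).
  by apply: bigcupT_measurable => a; apply: measurable_gen_test.
by apply/seteqP; split=> w /= => [[wu Cw]|[a _ [wu []]]] //; exists (brood w u).
Qed.

Lemma measurable_gen_path u s (B : set J) : (size u < n)%N -> 0 <= s -> measurable B ->
  measurable ([set w : spined_tree W | [/\ tree w u, s < life w u &
     B (path_fun (life_path w u) s)]] : set Gam).
Proof.
move=> un s0 mB.
rewrite (_ : [set w | _] = \bigcup_a [set w : spined_tree W | tree w u /\
    [/\ `]s, +oo[%classic (life w u), brood w u = a, setT (fission_position w u) &
        in_cylinder [:: (s, B)] 0 (life w u) (fun s => seg w u (birth w u + s))]]).
  apply: bigcupT_measurable => a; apply: measurable_gen_test => //.
  by move=> q; rewrite inE => /eqP ->.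
apply/seteqP; split=> w.
  move=> [wu sl Bs]; exists (brood w u) => //; split=> //; split=> //.
    by rewrite /= in_itv /= andbT.
  by move=> q; rewrite inE => /eqP -> _ /=; rewrite -life_pathE // s0.
move=> [a _ [wu [sl' _ _ H]]].
have sl : s < life w u by move: sl'; rewrite /= in_itv /= andbT.
split=> //; rewrite life_pathE ?s0 //.
by apply: (H (s, B)); rewrite ?mem_head //= s0.
Qed.

(** The branching property conditions on the generations before [n], so the past of a line has to be
    expressed by the lives of its ancestors: its birth time is the sum of their lifetimes, and the
    path before its birth is glued from their life paths, one window per ancestor. *)
Lemma measurable_gen_line l : fits l -> (size l <= n)%N ->
  [/\ measurable (line_event l : set Gam),
      measurable_fun (line_event l : set Gam) (fun w => birth w (word l)) &
      forall c, measurable_cylinder c ->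
        measurable (line_event l `&` [set w | in_cylinder c 0 (birth w (word l))
           (position w (word l))] : set Gam)].
Proof.
elim: l => [|[j a] l IHl] => [_ _|/andP[ja fl] ln].
  split=> /=; first exact: measurableT.
    rewrite (_ : (fun w => _) = cst 0); first exact: measurable_cst.
    by apply/funext => w; exact: birth_root.
  move=> c mc; rewrite setTI (_ : [set w | _] = setT) //.
  apply/seteqP; split=> // w _ q _; rewrite birth_root => /andP[q0].
  by rewrite ltNge q0.
have [mE mb mcyl] := IHl fl (ltnW ln); rewrite word_cons /=.
set u := word l; have un : (size u < n)%N by rewrite size_word.
have treeE : line_event l `&` [set w | brood w u = a] =
    line_event l `&` [set w : spined_tree W | tree w u /\ brood w u = a].
  apply/seteqP; split=> w /= [lw]; last by move=> [].
  by move=> aw; split=> //; split=> //; exact: line_event_tree lw.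
have mE' : measurable (line_event l `&` [set w | brood w u = a] : set Gam).
  by rewrite treeE; apply: measurableI => //; exact: measurable_gen_brood.
have subT : line_event l `&` [set w | brood w u = a] `<=` [set w : spined_tree W | tree w u].
  by rewrite treeE => w [_ []].
have mtree : measurable ([set w : spined_tree W | tree w u] : set Gam).
  rewrite (_ : [set w | _] = \bigcup_a [set w : spined_tree W | tree w u /\ brood w u = a]).
    by apply: bigcupT_measurable => a'; exact: measurable_gen_brood.
  by apply/seteqP; split=> w /= => [wu|[a' _ []]] //; exists (brood w u).
have mb' : measurable_fun (line_event l `&` [set w | brood w u = a] : set Gam) (fun w => birth w u).
  by apply: measurable_funS mb => // w [].
have ml' : measurable_fun (line_event l `&` [set w | brood w u = a] : set Gam) (fun w => life w u).
  exact: measurable_funS mtree subT (measurable_gen_life un).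
split=> //.
  rewrite (_ : (fun w => _) = (fun w : spined_tree W => birth w u + life w u)).
    exact: measurable_funD.
  by apply/funext => w; rewrite birth_rcons fission_birth.
move=> c mc.
rewrite (_ : _ `&` _ = (line_event l `&` [set w | in_cylinder c 0 (birth w u) (position w u)]) `&`
  ((line_event l `&` [set w | brood w u = a]) `&`
   [set w | in_cylinder c (birth w u) (fission w u) (position w u)])).
  apply: measurableI; first exact: mcyl.
  apply: (@measurable_in_cylinder R d J _ Gam (line_event l `&` [set w | brood w u = a])
    (fun w => birth w u) (fun w => fission w u) (fun w => position w u)) => // s B s0 mB.
  (* The absolute time [s] is the random age [s - birth w u] of [u], and life tests show the path at
     ages below the lifetime only: the case of a killed path. *)
  have mtau : measurable_fun (line_event l `&` [set w | brood w u = a] : set Gam) (fun w => s - birth w u).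
    by apply: measurable_funB => //; exact: measurable_cst.
  have := @measurable_eval_killed R d J W HW _ Gam (line_event l `&` [set w | brood w u = a])
    (fun w => life w u) (fun w => s - birth w u) (fun w => life_path w u) B mE' ml' mtau.
  rewrite (_ : _ `&` [set z | 0 <= s - birth z u < life z u /\ _] =
     (line_event l `&` [set w | brood w u = a]) `&`
       [set w | birth w u <= s < fission w u /\ B (position w u s)]).
    apply=> // s' B' s'0 mB'.
    rewrite [X in measurable X](_ : _ = (line_event l `&` [set w | brood w u = a]) `&`
      [set w : spined_tree W | [/\ tree w u, s' < life w u & B' (path_fun (life_path w u) s')]]).
      by apply: measurableI => //; exact: measurable_gen_path.
    apply/seteqP; split=> w [Ew]; last by move=> [].
    by move=> [? ?]; split=> //; split=> //; exact: subT Ew.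
  have ageE w : (0 <= s - birth w u < life w u) = (birth w u <= s < fission w u).
    by rewrite subr_ge0 ltrBlDl -fission_birth.
  apply/seteqP; split=> w [Ew [r Bs]]; have wu := subT _ Ew.
    have r' : birth w u <= s < fission w u by rewrite -ageE.
    by split=> //; split=> //; rewrite -life_path_position.
  have r' : 0 <= s - birth w u < life w u by rewrite ageE.
  by split=> //; split=> //; rewrite life_path_position.
apply/seteqP; split=> w /=.
  move=> [[lw aw] H]; have wu := line_event_tree fl lw; rewrite -/u in wu.
  have wu' : tree w (rcons u j.+1) by apply/(tree_children _ wu); rewrite aw add1n ltnS.
  have r : 0 <= birth w u <= fission w u by rewrite birth_ge0 //= ltW // birth_lt_fission.
  have [c1 c2] : in_cylinder c 0 (birth w u) (position w u) /\
      in_cylinder c (birth w u) (fission w u) (position w u).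
    apply/(in_cylinder_split _ _ r); move: H; rewrite birth_rcons.
    by apply eq_in_cylinder => s sr; rewrite position_rcons.
  by [].
move=> [[lw c1] [[_ aw] c2]]; split=> //.
have wu := line_event_tree fl lw; rewrite -/u in wu.
have wu' : tree w (rcons u j.+1) by apply/(tree_children _ wu); rewrite aw add1n ltnS.
have r : 0 <= birth w u <= fission w u by rewrite birth_ge0 //= ltW // birth_lt_fission.
have := (in_cylinder_split c (position w u) r).2 (conj c1 c2).
by rewrite birth_rcons; apply eq_in_cylinder => s sr; rewrite position_rcons.
Qed.

End GenerationMeasurability.

(** * The law of a line of descent *)

Lemma integral_indic_comp {R : realType} d d' (T : measurableType d) (S : measurableType d')
    (mu : {measure set T -> \bar R}) (D : set T) (phi : T -> S) (A : set S) :
  measurable D -> measurable_fun D phi -> measurable A ->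
  (\int[mu]_(x in D) (\1_A (phi x))%:E = mu (D `&` phi @^-1` A))%E.
Proof.
move=> mD mphi mA; have mDA := mphi mD A mA.
rewrite -[in RHS](setIid D) -setIA setIC -integral_indic //.
apply: eq_integral => x; rewrite inE => Dx.
by rewrite !indicE; congr (_%:R%:E); congr nat_of_bool; apply/idP/idP => /set_mem H; apply/mem_set => //; case: H.
Qed.

Section LineLaw.
Context {R : realType} {d : measure_display} {J : measurableType d}.
Variables (W : path_class R J) (HW : progressively_measurable W).
Variables (Xi : R.-pker J ~> pathT W) (HXi : is_markov_process Xi) (x : J).
Variables (rate : J -> R) (p : nat -> J -> R).
Hypotheses (mrate : measurable_fun setT rate) (rate_ge0 : forall y, 0 <= rate y).
Hypotheses (mp : forall a, measurable_fun setT (p a)) (p_ge0 : forall a y, 0 <= p a y).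
Variable P : probability (g_sigma_algebraType (at_infinity (@filt_F R d J W))) R.
Hypothesis HP : is_branching_markov Xi rate p x P.
Local Open Scope ereal_scope.
Local Notation Finf := (g_sigma_algebraType (at_infinity (@filt_F R d J W))).
Local Notation leb := (@lebesgue_measure R).
Local Notation PX := (kernel_law Xi x).
Local Notation pastw := (past_weight rate p).
Implicit Types (w : spined_tree W) (l : seq (nat * nat)).

Definition born_event l (C0 : set R) c : set (spined_tree W) :=
  line_event l `&` [set w | C0 (birth w (word l)) /\
    in_cylinder c 0%R (birth w (word l)) (position w (word l))].

(** The joint law, on the event that the line exists, of the birth time of its last particle, the
    path before that time and the position at it. This is the statement carried from one generation
    to the next. *)
Definition line_law l : Prop := forall (C0 : set R) (B : set J) c,
  measurable C0 -> measurable B -> measurable_cylinder c ->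
  P (born_event l C0 c `&` [set w | B (birth_position x w (word l))]) =
  \int[PX]_X \int[line_measure l]_r
    (pastw l c (pos_path X) r * ((\1_C0 r : R)%:E * (\1_B (pos_path X r) : R)%:E)).

Lemma generations_born_event l C0 c : fits l -> measurable C0 -> measurable_cylinder c ->
  generations_lt (size l) (born_event l C0 c).
Proof.
move=> fl mC0 mc; have [mE mb mcyl] := measurable_gen_line HW fl (leqnn (size l)).
have -> : born_event l C0 c = (line_event l `&` (fun w => birth w (word l)) @^-1` C0) `&`
    (line_event l `&` [set w | in_cylinder c 0%R (birth w (word l)) (position w (word l))]).
  by apply/seteqP; split=> w /= => [[lw [? ?]]|[[lw ?] [_ ?]]].
have h1 := mb mE _ mC0; have h2 := mcyl c mc.
exact (measurableI _ _ h1 h2).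
Qed.

Lemma born_event_tree l C0 c : fits l ->
  born_event l C0 c `<=` [set w : spined_tree W | tree w (word l)].
Proof. by move=> fl w [lw _]; exact: line_event_tree lw. Qed.

(** Meant for [h] the [life_law] of the last particle of the line as a function of its birth
    position, as the branching property presents it. *)
Lemma line_law_fun l (C0 : set R) c (h : J -> \bar R) : fits l -> line_law l ->
  measurable C0 -> measurable_cylinder c -> measurable_fun setT h -> (forall y, 0 <= h y) ->
  \int[P]_(w in born_event l C0 c) h (birth_position x w (word l)) =
  \int[PX]_X \int[line_measure l]_r
    (pastw l c (pos_path X) r * ((\1_C0 r : R)%:E * h (pos_path X r))).
Proof.
move=> fl Hl mC0 mc mh h0.
have mE : measurable (born_event l C0 c : set Finf).
  exact: measurable_generations (generations_born_event fl mC0 mc).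
have mbp : measurable_fun (born_event l C0 c : set Finf) (fun w => birth_position x w (word l)).
  have := measurable_funS (measurable_tree (W := W) (word l)) (born_event_tree fl)
    (measurable_birth_position HW x (u := word l)).
  exact.
have mpos := measurable_pos_path HW.
have mw : measurable_fun setT (fun q : pathT W * R =>
    pastw l c (pos_path q.1) q.2 * (\1_C0 q.2 : R)%:E).
  apply: emeasurable_funM; first exact: (measurable_past_weight mrate rate_ge0 mp p_ge0 mpos).
  apply/measurable_EFinP; exact: measurableT_comp (measurable_indic mC0) measurable_snd.
have w0 (q : pathT W * R) : 0 <= pastw l c (pos_path q.1) q.2 * (\1_C0 q.2 : R)%:E.
  by rewrite mule_ge0 ?lee_fin //; exact: past_weight_ge0.
transitivity (\int[PX]_X \int[line_measure l]_r
    (pastw l c (pos_path X) r * (\1_C0 r : R)%:E * h (pos_path X r))); last first.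
  by apply: eq_integral => X _; apply: eq_integral => r _; rewrite muleA.
apply: (@intf_eq_fun _ _ _
  (fun h => \int[P]_(w in born_event l C0 c) h (birth_position x w (word l)))
  (fun h => \int[PX]_X \int[line_measure l]_r
    (pastw l c (pos_path X) r * (\1_C0 r : R)%:E * h (pos_path X r)))) => //.
- exact: intf_integral.
- exact: (@intf_double _ _ _ _ _ _ _ PX (line_measure l)
    (fun q => pastw l c (pos_path q.1) q.2 * (\1_C0 q.2 : R)%:E) (fun q => pos_path q.1 q.2)).
move=> B mB; apply: (etrans (integral_indic_comp P mE mbp mB)); apply: (etrans (Hl C0 B c mC0 mB mc)).
by apply: eq_integral => X _; apply: eq_integral => r _; rewrite muleA.
Qed.

(* With tau = id this gives the law of the next birth; with tau and C the time t
   and the times after t, that of the particle alive at time t. *)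
Lemma line_step l a (B : set J) c (C : set R) (tau : R -> R) : fits l -> line_law l ->
  measurable_cylinder c -> measurable B -> measurable C -> measurable_fun setT tau ->
  (forall r, C r -> (0 <= tau r <= r)%R) ->
  P (line_event l `&` [set w : spined_tree W | [/\ brood w (word l) = a, B (fission_position w (word l)),
       (birth w (word l) <= tau (fission w (word l)))%R /\ C (fission w (word l)) &
       in_cylinder c 0%R (fission w (word l)) (position w (word l))]]) =
  \int[PX]_X \int[leb]_r
   ((\1_[set r | [/\ C r, B (pos_path X r) & in_cylinder c 0%R r (pos_path X)]] r : R)%:E *
    ((fission_rate rate p (pos_path X) a r)%:E * expeR (- cumulated_rate rate (pos_path X) r) *
     line_integral (fission_rate rate p (pos_path X)) l (tau r))).
Proof.
move=> fl Hl mc mB mC mtau Ctau; set u := word l.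
have mC2 : measurable [set q : R * R | (q.1 <= tau q.2)%R /\ C q.2].
  rewrite (_ : [set q | _] = [set q : R * R | (q.1 <= tau q.2)%R] `&` snd @^-1` C) //.
  apply: measurableI; last by rewrite -[X in measurable X]setTI; exact: measurable_snd.
  apply: measurable_set_le => //; exact: measurableT_comp mtau measurable_snd.
set C2 := [set q : R * R | _] in mC2.
pose K : set (killedT W) := killed_window C2 c.
have mK : measurable K by exact: measurable_killed_window.
(* [D1] gathers what stays fixed in the monotone class argument: the past of the line, the brood
   size and the position at fission. *)
pose D1 := born_event l setT c `&` [set w : spined_tree W | tree w u /\ brood w u = a] `&`
  ([set w : spined_tree W | tree w u] `&` (fun w => fission_position w u) @^-1` B).
have mD1 : measurable (D1 : set Finf).
  apply: measurableI.
    apply: measurableI; last exact: measurable_brood.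
    exact: measurable_generations (generations_born_event fl measurableT mc).
  exact: (measurable_fission_position HW (u := u)) (measurable_tree (W := W) u) _ mB.
have D1T : D1 `<=` [set w : spined_tree W | tree w u] by move=> w [_ []].
pose phi w : killedT W := (birth w u, (life w u, life_path w u)).
have mb := measurable_funS (measurable_tree (W := W) u) D1T (measurable_birth_fission W u).1.
have ml := measurable_funS (measurable_tree (W := W) u) D1T (measurable_life (W := W) (u := u)).
have mphi : measurable_fun (D1 : set Finf) phi.
  apply: measurable_fun_g_sigma => // _ [C0' [C' [c' [mC0' mC' mc' ->]]]].
  rewrite [X in measurable X](_ : _ = (D1 `&` (fun w => birth w u) @^-1` C0') `&`
      (D1 `&` (fun w : spined_tree W => life w u) @^-1` C') `&`
      (D1 `&` [set w : spined_tree W | in_cylinder c' 0%R (life w u) (path_fun (life_path w u))])).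
    apply: measurableI; first by apply: measurableI; [exact: mb|exact: ml].
    apply: (@measurable_in_cylinder R d J _ Finf D1 (fun=> 0%R) (fun w : spined_tree W => life w u)
      (fun w => path_fun (life_path w u))) => // s B' s0 mB'.
    rewrite [X in measurable X](_ : _ = D1 `&` ([set w : spined_tree W | tree w u] `&` (fun w : spined_tree W => life w u) @^-1` `]s, +oo[) `&`
      [set w : spined_tree W | tree w u /\ ((s < life w u)%R -> B' (seg w u (birth w u + s)%R))]).
      apply: measurableI; last exact: measurable_seg.
      by apply: measurableI => //; exact: (measurable_life (W := W) (u := u)) (measurable_tree (W := W) u) _ (measurable_itv _).
    apply/seteqP; split=> w.
      move=> [D1w [/andP[_ sl] Bs]]; have wu := D1T _ D1w; split.
        by split=> //; split=> //; rewrite /= in_itv /= andbT.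
      by split=> // _; rewrite -life_pathE // s0.
    move=> [[D1w [wu sl']] [_ Bs]].
    have sl : (s < life w u)%R by move: sl'; rewrite /= in_itv /= andbT.
    by split=> //; split; rewrite ?s0 // life_pathE ?s0 //; exact: Bs.
  by apply/seteqP; split=> w => [[D1w [? ? ?]]|[[[D1w ?] [_ ?]] [_ ?]]].
(* On [killed_tests] the branching property, for the single particle [u], computes [L1], and
   [generation_step] identifies the result with [L2]. These tests form a pi-system, so the equality
   extends to the event [K] that involves the fission time. *)
pose L1 (f : killedT W -> \bar R) := \int[P]_(w in D1) f (phi w).
pose L2 (f : killedT W -> \bar R) := \int[PX]_X \int[line_measure l]_r0 \int[leb]_r
    (step_weight rate p l c a B (pos_path X) r0 r * f (killed_at_step (X, r0, r))).
have IL1 : integration_functional L1 by exact: intf_integral.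
have IL2 : integration_functional L2.
  apply: (@intf_triple _ _ _ _ _ _ _ _ _ PX (line_measure l) leb
    (fun q => step_weight rate p l c a B (pos_path q.1.1) q.1.2 q.2) (@killed_at_step _ _ _ W)).
  - exact: measurable_step_weight.
  - by move=> q; exact: step_weight_ge0.
  - exact: measurable_killed_at_step.
have LG A : @killed_tests _ _ _ W A -> L1 (fun z => (\1_A z)%:E) = L2 (fun z => (\1_A z)%:E).
  move=> HA; have mA : measurable (A : set (killedT W)) by exact: sub_sigma_algebra.
  rewrite /L1 integral_indic_comp //.
  move: HA mA => [C0 [C' [c' [mC0 mC' mc' ->]]]] mA.
  have := HP (U := [:: u]) (e := fun=> cylinder_test C' a B c') (E := born_event l C0 c)
    isT _ _ (generations_born_event fl mC0 mc).
  have szu u' : u' \in [:: u] -> size u' = size l by rewrite inE => /eqP ->; exact: size_word.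
  move=> /(_ szu (fun _ _ => measurable_cylinder_test a mC' mB mc')) HPu.
  have E1 : D1 `&` phi @^-1` [set z | [/\ C0 z.1, C' z.2.1 & in_cylinder c' 0%R z.2.1 (path_fun z.2.2)]] =
    born_event l C0 c `&` [set w : spined_tree W | forall u', u' \in [:: u] ->
      tree w u' /\ particle_passes w u' (cylinder_test C' a B c')].
    apply/seteqP; split=> w.
      move=> [[[[lw [_ cw]] [wu aw]] [_ Bw]] [C0w C'w c'w]]; split=> // u'.
      rewrite inE => /eqP ->; split=> //; apply/(passes_cylinder_test _ _ _ _ _ _ _ mc'); split=> //.
      by move: c'w; apply eq_in_cylinder => s sl; rewrite /phi life_pathE.
    move=> [[lw [C0w cw]] /(_ u (mem_head _ _)) [wu /(passes_cylinder_test _ _ _ _ _ _ _ mc') [C'w aw Bw c'w]]].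
    split=> //; split=> //.
    by move: c'w; apply eq_in_cylinder => s sl; rewrite /phi life_pathE.
  apply: (etrans (congr1 (fun A => P A) E1)); apply: (etrans HPu).
  have E2 : born_event l C0 c `&` [set w : spined_tree W | forall u', u' \in [:: u] -> tree w u'] =
      born_event l C0 c.
    apply/seteqP; split=> w; first by move=> [].
    move=> Ew; split=> // u'; rewrite inE => /eqP ->; exact: (born_event_tree fl Ew).
  rewrite E2; under eq_integral do rewrite big_seq1.
  rewrite (line_law_fun (h := fun y => life_law Xi rate p y (cylinder_test C' a B c'))) //; last 2 first.
  - exact: measurable_life_law.
  - by move=> y; apply: integral_ge0 => X _; exact: life_law_along_ge0.
  exact: generation_step.
have LT : L1 (fun z => (\1_(setT : set (killedT W)) z)%:E) = L2 (fun z => (\1_(setT : set (killedT W)) z)%:E).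
  apply: LG; exists setT, setT, [::]; split=> //.
  by apply/seteqP; split.
have fin : L1 (fun z => (\1_(setT : set (killedT W)) z)%:E) < +oo.
  rewrite /L1 integral_indic_comp //; apply: le_lt_trans (ltry 1).
  exact: probability_le1 (mphi mD1 _ measurableT).
have := @intf_unique _ _ (killedT W) L1 L2 IL1 IL2 (@killed_tests _ _ _ W) erefl
  (@killed_tests_setI _ _ _ W) fin LT LG.
have mKind : measurable_fun setT (fun z : killedT W => (\1_K z : R)%:E).
  by apply/measurable_EFinP; exact: measurable_indic.
move=> /(_ _ mKind) HK.
have HK' : L1 (fun z => (\1_K z)%:E) = L2 (fun z => (\1_K z)%:E).
  by apply: HK => z; rewrite lee_fin.
move: HK'; rewrite /L1 integral_indic_comp // /L2 => HK'.
transitivity (P (D1 `&` phi @^-1` K)); last first.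
  apply: (etrans HK'); apply: eq_integral => X _; exact: window_step.
congr (P _); apply/seteqP; split=> w.
  move=> [lw [aw Bw [bt Cw] cw]]; have wu := line_event_tree fl lw; rewrite -/u in wu.
  have r : (0 <= birth w u <= fission w u)%R by rewrite birth_ge0 //= ltW // birth_lt_fission.
  have [c1 c2] := (in_cylinder_split c (position w u) r).1 cw.
  split; first by [].
  rewrite /K /killed_window /phi /= -fission_birth; split=> //.
  by move: c2; apply eq_in_cylinder => s su; rewrite -life_path_position.
move=> [[[[lw [_ c1]] [wu aw]] [_ Bw]]]; rewrite /K /killed_window /phi /= -fission_birth => -[[bt Cw] c2].
have r : (0 <= birth w u <= fission w u)%R by rewrite birth_ge0 //= ltW // birth_lt_fission.
split=> //; split=> //; apply/(in_cylinder_split c (position w u) r); split=> //.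
by move: c2; apply eq_in_cylinder => s su; rewrite -life_path_position.
Qed.

Lemma in_cylinder_empty c (f : R -> J) lo : in_cylinder c lo lo f.
Proof. by move=> q _ /andP[/le_lt_trans h /h]; rewrite ltxx. Qed.

(** The root is born at time 0 at [x]: the window before its birth is empty, the cumulated rate at 0
    vanishes, and [Xi] started from [x] is at [x] at time 0. *)
Lemma line_law_nil : line_law [::].
Proof.
move=> C0 B c mC0 mB mc.
have mpos := measurable_pos_path HW.
have past1 (X : sample_path W) : past_weight rate p [::] c (pos_path X) 0%R = 1.
  rewrite /past_weight indicE mem_set /=; last by split=> //; exact: in_cylinder_empty.
  by rewrite !mul1e /cumulated_rate set_itv1 integral_set1 oppe0 expeR0.
transitivity (\int[PX]_X ((\1_C0 (0%R : R) : R)%:E * (\1_B (pos_path X 0) : R)%:E)); last first.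
  apply: eq_integral => X _; rewrite /line_measure integral_dirac //.
    by rewrite diracT mul1e past1 mul1e.
  apply: emeasurable_funM.
    exact: measurable_fun_pair2 (X : pathT W) (measurable_past_weight mrate rate_ge0 mp p_ge0 mpos [::] mc).
  apply: emeasurable_funM; apply/measurable_EFinP; first exact: measurable_indic.
  apply: (measurableT_comp (measurable_indic mB)); exact: (measurable_fun_pair2 (X : pathT W) mpos).
have mB0 : measurable_fun setT (fun X : pathT W => (\1_B (pos_path X 0) : R)%:E).
  apply/measurable_EFinP; apply: (measurableT_comp (measurable_indic mB)).
  exact: measurable_fun_pair1 (0%R : R) mpos.
rewrite ge0_integralZl //.
have -> : \int[PX]_X (\1_B (pos_path X 0) : R)%:E = (\1_B x : R)%:E.
  have m0 : measurable_fun setT (fun X : pathT W => pos_path X 0).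
    exact: measurable_fun_pair1 (0%R : R) mpos.
  apply: (etrans (integral_indic_comp PX measurableT m0 mB)).
  rewrite setTI -[RHS]/(\d_x B) -(HXi.1 x B mB).
  by congr (Xi x _); apply/seteqP; split=> X /=; rewrite pos_pathE.
transitivity (P [set w | C0 0%R /\ B x]).
  have b0 w : birth w (word [::]) = 0%R := birth_root w.
  congr (P _); apply/seteqP; split=> w.
    by move=> [[_ [+ _]] ?]; rewrite b0.
  move=> [? ?]; split=> //; split=> //; rewrite /= b0; split=> //.
  exact: in_cylinder_empty.
rewrite !indicE.
have [C00|nC0] := pselect (C0 0%R); have [Bx|nB] := pselect (B x).
- rewrite !mem_set // mul1e (_ : [set w | _] = setT) ?probability_setT //.
  by apply/seteqP; split.
- rewrite (memNset nB) mule0 (_ : [set w | _] = set0) ?measure0 //.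
  by apply/seteqP; split => w //= [].
- rewrite (memNset nC0) mul0e (_ : [set w | _] = set0) ?measure0 //.
  by apply/seteqP; split => w //= [].
- rewrite (memNset nC0) mul0e (_ : [set w | _] = set0) ?measure0 //.
  by apply/seteqP; split => w //= [].
Qed.

Lemma line_law_cons j a l : fits ((j, a) :: l) -> line_law l -> line_law ((j, a) :: l).
Proof.
move=> /= /andP[ja fl] Hl C0 B c mC0 mB mc.
(* Fission times are nonnegative, so cutting [C0] down to [[0, +oo[] loses nothing and meets the
   requirement [0 <= tau r] for [tau] the identity. *)
have mC : measurable (C0 `&` [set r : R | (0 <= r)%R]).
  apply: measurableI => //; rewrite (_ : [set r : R | _] = `[0%R, +oo[%classic) //.
  by apply/seteqP; split=> r /=; rewrite in_itv /= andbT.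
have tauC r : (C0 `&` [set r : R | (0 <= r)%R]) r -> (0 <= r <= r)%R.
  by move=> [_ /= ->]; rewrite lexx.
have := line_step a fl Hl mc mB mC (@measurable_id _ _ _) tauC.
set u := word l => E.
transitivity (P (line_event l `&` [set w : spined_tree W | [/\ brood w u = a, B (fission_position w u),
       (birth w u <= fission w u)%R /\ (C0 `&` [set r : R | (0 <= r)%R]) (fission w u) &
       in_cylinder c 0%R (fission w u) (position w u)]])).
  congr (P _); rewrite /born_event word_cons -/u; apply/seteqP; split=> w.
    move=> [[[lw aw] [C0w cw]] Bw]; have wu := line_event_tree fl lw; rewrite -/u in wu aw.
    move: C0w cw Bw => /=; rewrite !birth_rcons birth_position_rcons => C0w cw Bw.
    have wuj : tree w (rcons u j.+1).
      by apply/(tree_children _ wu); rewrite aw /= add1n ltnS.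
    split=> //; split=> //; first split.
    - exact/ltW/birth_lt_fission.
    - by split=> //=; exact/ltW/fission_gt0.
    - move: cw; apply eq_in_cylinder => s su; exact/esym/position_rcons.
  move=> [lw [aw Bw [_ [C0w _]] cw]]; have wu := line_event_tree fl lw; rewrite -/u in wu.
  have wuj : tree w (rcons u j.+1).
    by apply/(tree_children _ wu); rewrite aw /= add1n ltnS.
  split; last by rewrite /= birth_position_rcons.
  split; first by split.
  split; rewrite !birth_rcons //.
  by move: cw; apply eq_in_cylinder => s su; exact: position_rcons.
apply: (etrans E); apply: eq_integral => X _; apply: eq_integral => r _.
rewrite /past_weight /=; set D := line_integral _ _ _.
rewrite !indicE.
have [r0|r0] := pselect (0 <= r)%R; last first.
  rewrite (memNset (A := [set _ | [/\ _, _ & _]])); last by move=> [[]].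
  by rewrite (memNset (A := [set _ | _ /\ _])) ?mul0e // => -[].
have [cr|cr] := pselect (in_cylinder c 0 r (pos_path X)); last first.
  rewrite (memNset (A := [set _ | [/\ _, _ & _]])); last by move=> [].
  by rewrite (memNset (A := [set _ | _ /\ _])) ?mul0e // => -[].
rewrite (mem_set (A := [set _ | _ /\ _])) //= mul1e.
have [C0r|C0r] := pselect (C0 r); last first.
  rewrite (memNset (A := [set _ | [/\ _, _ & _]])); last by move=> [[]].
  by rewrite (memNset C0r) !mul0e mule0.
have [Br|Br] := pselect (B (pos_path X r)); last first.
  rewrite (memNset (A := [set _ | [/\ _, _ & _]])); last by move=> [].
  by rewrite (memNset Br) mul0e !mule0.
rewrite (mem_set (A := [set _ | [/\ _, _ & _]])) // !mem_set // !mul1e mule1.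
by rewrite muleAC.
Qed.

Lemma line_lawP l : fits l -> line_law l.
Proof.
elim: l => [|[j a] l IHl] fl; first exact: line_law_nil.
by apply: line_law_cons => //; apply: IHl; case/andP: fl.
Qed.

End LineLaw.

(** * The law of a particle alive at a fixed time *)

Section LineAliveLaw.
Context {R : realType} {d : measure_display} {J : measurableType d}.
Variables (W : path_class R J) (HW : progressively_measurable W).
Variables (Xi : R.-pker J ~> pathT W) (HXi : is_markov_process Xi) (x : J).
Variables (rate : J -> R) (p : nat -> J -> R).
Hypotheses (mrate : measurable_fun setT rate) (rate_ge0 : forall y, 0 <= rate y).
Hypothesis Hp : is_offspring_law p.
Variable P : probability (g_sigma_algebraType (at_infinity (@filt_F R d J W))) R.
Hypothesis HP : is_branching_markov Xi rate p x P.
Local Open Scope ereal_scope.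
Local Notation Finf := (g_sigma_algebraType (at_infinity (@filt_F R d J W))).
Local Notation leb := (@lebesgue_measure R).
Local Notation PX := (kernel_law Xi x).
Local Notation frate := (fission_rate rate p).
Local Notation cyl_upto t := (@cylinders_upto R d J W t).
Local Notation alongw := (along_weight rate p).
Implicit Types (w : spined_tree W) (l : seq (nat * nat)) (t : R).

Let mp : forall a, measurable_fun setT (p a). Proof. by case: Hp. Qed.
Let p_ge0 : forall a y, (0 <= p a y)%R. Proof. by case: Hp. Qed.

Definition path_cylinder (c : seq (R * set J)) : set (sample_path W) :=
  [set X | forall q, q \in c -> q.2 (path_fun X q.1)].

Definition cylinder_upto t (c : seq (R * set J)) : Prop :=
  measurable_cylinder c /\ forall q, q \in c -> (q.1 <= t)%R.

(** Along a given path, the total density of a fission after [t], all brood sizes together. It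
    stands for the survival up to [t] of the whole line and is left unevaluated, being a common
    factor of the two expectations to be compared. *)
Definition late_fission t (X : sample_path W) : \bar R :=
  \int[leb]_r ((\1_`]t, +oo[%classic r : R)%:E * ((rate (pos_path X r))%:E *
    expeR (- cumulated_rate rate (pos_path X) r))).

Definition line_alive l t : set (spined_tree W) :=
  line_event l `&` [set w | population w t (word l)].

Lemma late_fission_ge0 t X : 0 <= late_fission t X.
Proof.
by apply: integral_ge0 => r _; rewrite mule_ge0 ?lee_fin // mule_ge0 ?lee_fin // expeR_ge0.
Qed.

Lemma measurable_late_fission t : measurable_fun setT (late_fission t : pathT W -> \bar R).
Proof.
have mpos := measurable_pos_path HW.
apply: (@measurable_fun_fubini_tonelli_F _ _ _ _ _ leb
  (fun q : pathT W * measurableTypeR R => (\1_`]t, +oo[%classic q.2 : R)%:E * ((rate (pos_path q.1 q.2))%:E *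
    expeR (- cumulated_rate rate (pos_path q.1) q.2)))).
  apply: emeasurable_funM.
    by apply/measurable_EFinP; apply: measurableT_comp measurable_snd; exact: measurable_indic.
  apply: emeasurable_funM; last exact: (measurable_survival mrate rate_ge0 mpos).
  by apply/measurable_EFinP; exact: measurableT_comp mrate mpos.
by move=> q; rewrite mule_ge0 ?lee_fin // mule_ge0 ?lee_fin // expeR_ge0.
Qed.

Lemma measurable_line_integral_at l t : measurable_fun setT
  (fun X : pathT W => line_integral (frate (pos_path X)) l t).
Proof.
exact: measurable_fun_pair1 t (measurable_line_integral_rate mrate rate_ge0 mp p_ge0 (measurable_pos_path HW) l).
Qed.

Lemma path_cylinder_upto t c : cylinder_upto t c ->
  <<s cyl_upto t >> (path_cylinder c).
Proof.
elim: c => [|[s B] c IHc] [mc ct].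
  by rewrite (_ : path_cylinder _ = setT); [exact: (@measurableT _ (g_sigma_algebraType (cyl_upto t)))|apply/seteqP; split].
rewrite (_ : path_cylinder _ = [set X | B (path_fun X s)] `&` path_cylinder c).
  apply: (@measurableI _ (g_sigma_algebraType (cyl_upto t))).
    apply: sub_sigma_algebra; have [s0 mB] := mc _ (mem_head _ _).
    by exists s, B; split=> //; rewrite s0 (ct _ (mem_head _ _)).
  by apply: IHc; split=> q qc; [apply: mc|apply: ct]; rewrite inE qc orbT.
apply/seteqP; split=> X /=.
  move=> H; split; first exact: (H _ (mem_head _ _)).
  by move=> q qc; apply: H; rewrite inE qc orbT.
by move=> [H1 H2] q; rewrite inE => /orP[/eqP -> //|]; exact: H2.
Qed.

Lemma measurable_line_event l : fits l -> measurable (line_event l : set Finf).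
Proof.
move=> fl; have [m _ _] := measurable_gen_line HW fl (leqnn (size l)).
exact: (measurable_generations HW m).
Qed.

(** When the fission comes after [t], all constraints at times up to [t] are active. The cylinder no
    longer depends on the fission time and factors out. *)
Lemma along_weight_after t a c X r : (0 <= t)%R -> cylinder_upto t c ->
  alongw `]t, +oo[%classic a setT c (pos_path X) r =
  (p a (pos_path X r))%:E * ((\1_(path_cylinder c) X : R)%:E * ((\1_`]t, +oo[%classic r : R)%:E *
     ((rate (pos_path X r))%:E * expeR (- cumulated_rate rate (pos_path X) r)))).
Proof.
move=> t0 [mc ct]; rewrite /along_weight !indicE.
have [tr|tr] := ltP t r; last first.
  rewrite memNset; last by move=> [_]; rewrite /= in_itv /= andbT ltNge tr.
  by rewrite (memNset (A := `]t, +oo[%classic)) ?mul0e ?mule0 //= in_itv /= andbT; apply/negP; rewrite -leNgt.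
rewrite (mem_set (A := `]t, +oo[%classic)) /= ?in_itv /= ?tr // mul1e.
have Ec : in_cylinder c 0%R r (pos_path X) <-> path_cylinder c X.
  split=> H q qc; have [q0 _] := mc _ qc; have qt := ct _ qc.
    by rewrite -pos_pathE //; apply: H => //; rewrite q0 (le_lt_trans qt).
  by move=> _; rewrite pos_pathE //; exact: H.
have [cX|cX] := pselect (path_cylinder c X); last first.
  by rewrite (memNset cX) memNset ?mul0e ?mule0 //= => -[_ _ _ /Ec].
rewrite (mem_set cX) mem_set ?mul1e /=; last first.
  by split=> //; [exact: ltW (le_lt_trans t0 tr)|rewrite in_itv /= tr|apply/Ec].
by rewrite /fission_rate muleA -EFinM mulrC.
Qed.

(** The brood size [a] enters through [p a] at the fission position only, and these probabilities
    sum to 1. *)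
Lemma late_fission_sum t c X l : (0 <= t)%R -> cylinder_upto t c ->
  \sum_(0 <= a <oo) \int[leb]_r
     (alongw `]t, +oo[%classic a setT c (pos_path X) r * line_integral (frate (pos_path X)) l t) =
  (late_fission t X * line_integral (frate (pos_path X)) l t) * (\1_(path_cylinder c) X : R)%:E.
Proof.
move=> t0 Hc; have [mc _] := Hc; set I := line_integral _ l t.
have I0 : 0 <= I by apply: line_integral_ge0 => *; exact: fission_rate_ge0.
have mpos := measurable_pos_path HW.
have m1 a : measurable_fun setT (fun r : R => alongw `]t, +oo[%classic a setT c (pos_path X) r).
  exact: measurable_fun_pair2 (X : pathT W) (measurable_along_weight mrate rate_ge0 mp mpos a (measurable_itv _) measurableT mc).
rewrite -integral_nneseries //; last 2 first.
- by move=> a; apply: emeasurable_funM => //; exact: m1.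
- by move=> a r _; rewrite mule_ge0 // along_weight_ge0.
transitivity (\int[leb]_r (((\1_(path_cylinder c) X : R)%:E * I) *
    ((\1_`]t, +oo[%classic r : R)%:E * ((rate (pos_path X r))%:E *
      expeR (- cumulated_rate rate (pos_path X) r))))).
  apply: eq_integral => r _.
  under eq_eseriesr => a _ do rewrite along_weight_after // -muleA.
  rewrite nneseriesZr; last 2 first.
  - by move=> a; rewrite lee_fin.
  - by rewrite mule_ge0 // mule_ge0 ?lee_fin // mule_ge0 ?lee_fin // mule_ge0 ?lee_fin // expeR_ge0.
  by have [_ _ -> _] := Hp; rewrite mul1e muleAC.
rewrite ge0_integralZl //; last 3 first.
- have mX : measurable_fun setT (fun r : R => pos_path X r).
    exact: measurable_fun_pair2 (X : pathT W) mpos.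
  apply: emeasurable_funM.
    by apply/measurable_EFinP; exact: measurable_indic.
  apply: emeasurable_funM.
    by apply/measurable_EFinP; exact: measurableT_comp mrate mX.
  exact: measurable_fun_pair2 (X : pathT W) (measurable_survival mrate rate_ge0 mpos).
- by move=> r _; rewrite mule_ge0 ?lee_fin // mule_ge0 ?lee_fin // expeR_ge0.
- by rewrite mule_ge0 ?lee_fin.
by rewrite -/(late_fission t X) muleC muleAC muleA.
Qed.

(** A particle alive at [t] is one born by [t] that splits after [t]. The event is cut according to
    its future brood size [a], to make each piece a test on complete lives, and [line_step] is used
    with [tau] constant equal to [t]. *)
Lemma line_alive_cylinder l t c : (0 <= t)%R -> fits l -> cylinder_upto t c ->
  P (line_alive l t `&` [set w | path_cylinder c (tree_path w (word l))]) =
  \int[PX]_X ((late_fission t X * line_integral (frate (pos_path X)) l t) *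
    (\1_(path_cylinder c) X : R)%:E).
Proof.
move=> t0 fl Hc; have [mc ct] := Hc; set u := word l.
have mpos := measurable_pos_path HW.
pose F a := line_event l `&` [set w : spined_tree W | [/\ brood w u = a, setT (fission_position w u),
   (birth w u <= t)%R /\ `]t, +oo[%classic (fission w u) &
   in_cylinder c 0%R (fission w u) (position w u)]].
have FE a : F a = (line_event l `&` [set w : spined_tree W | tree w u /\ brood w u = a]) `&`
    [set w : spined_tree W | population w t u /\ path_cylinder c (tree_path w u)].
  have H w : line_event l w -> (t < fission w u)%R ->
      (in_cylinder c 0%R (fission w u) (position w u) <-> path_cylinder c (tree_path w u)).
    move=> lw tw; have wu := line_event_tree fl lw.
    split=> H q qc; have [q0 _] := mc _ qc; have qt := ct _ qc.
      by rewrite tree_pathE //; [apply: H => //|]; rewrite q0 (le_lt_trans qt).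
    by move=> qu; rewrite -tree_pathE //; exact: H.
  apply/seteqP; split=> w.
    move=> [lw [aw _ [bt]]]; rewrite /= in_itv /= andbT => tf cw.
    have wu := line_event_tree fl lw; split=> //.
    split; last by apply/(H _ lw).
    by split=> //; rewrite alive_atE bt.
  move=> [[lw [wu aw]] [[_]]]; rewrite alive_atE => /andP[bt tf] cw; split=> //.
  by split=> //; [rewrite /= in_itv /= tf|apply/H].
have mF a : measurable (F a : set Finf).
  rewrite FE; apply: measurableI.
    by apply: measurableI; [exact: measurable_line_event|exact: measurable_brood].
  apply: (measurable_filt_F t0); apply: measurable_tree_path_alive => //.
  exact: path_cylinder_upto.
have tF : trivIset setT F.
  by move=> a b _ _ [w [[_ [<- _ _ _]] [_ [<- _ _ _]]]].
have -> : line_alive l t `&` [set w | path_cylinder c (tree_path w u)] = \bigcup_a F a.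
  apply/seteqP; split=> w.
    move=> [[lw pw] cw]; exists (brood w u) => //; rewrite FE; split=> //; split=> //.
    by split=> //; case: pw.
  by move=> [a _]; rewrite FE => -[[lw _] [pw cw]].
apply: (etrans (measure_bigcup P setT F (fun a _ => mF a) tF)).
have Ctau r : `]t, +oo[%classic r -> (0 <= cst t r <= r)%R.
  by rewrite /= in_itv /= andbT t0 /= => /ltW.
transitivity (\sum_(0 <= a <oo) \int[PX]_X \int[leb]_r
     (alongw `]t, +oo[%classic a setT c (pos_path X) r * line_integral (frate (pos_path X)) l t)).
  rewrite (eq_eseriesl (Q := xpredT)); last by move=> a; rewrite in_setT.
  apply: eq_eseriesr => a _.
  have Hl := line_lawP HW HXi mrate rate_ge0 mp p_ge0 HP fl.
  apply: (etrans (line_step HW HXi mrate rate_ge0 mp p_ge0 HP a fl Hl mc measurableT (measurable_itv `]t, +oo[) (measurable_cst t) Ctau)).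
  apply: eq_integral => X _; apply: eq_integral => r _; rewrite muleA; congr (_ * _ * _).
  rewrite !indicE; congr (_%:R%:E); congr nat_of_bool.
  apply/idP/idP => /set_mem H; apply/mem_set; last by case: H.
  by case: H => tr Br cr; split=> //; case/andP: (Ctau _ tr) => _; exact: le_trans.
have mI := measurable_line_integral_at l t.
have m2 a : measurable_fun setT (fun q : pathT W * R =>
    alongw `]t, +oo[%classic a setT c (pos_path q.1) q.2 * line_integral (frate (pos_path q.1)) l t).
  apply: emeasurable_funM.
    exact: (measurable_along_weight mrate rate_ge0 mp mpos a (measurable_itv _) measurableT mc).
  exact: measurableT_comp mI measurable_fst.
have m20 a (q : pathT W * R) : 0 <= alongw `]t, +oo[%classic a setT c (pos_path q.1) q.2 *
    line_integral (frate (pos_path q.1)) l t.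
  by rewrite mule_ge0 ?along_weight_ge0 //; apply: line_integral_ge0 => *; exact: fission_rate_ge0.
rewrite -integral_nneseries //; last 2 first.
- move=> a; apply: (@measurable_fun_fubini_tonelli_F _ _ _ _ _ leb _ (m2 a) (m20 a)).
- by move=> a X _; apply: integral_ge0 => r _; exact: (m20 a (X, r)).
by apply: eq_integral => X _; exact: late_fission_sum.
Qed.

Lemma measurable_line_alive l t : (0 <= t)%R -> fits l ->
  measurable (line_alive l t : set Finf).
Proof.
move=> t0 fl; apply: measurableI; first exact: measurable_line_event.
apply: (measurable_filt_F t0); exact: measurable_population.
Qed.

Lemma measurable_tree_path_line l t (E : set (sample_path W)) : (0 <= t)%R -> fits l ->
  <<s cyl_upto t >> E ->
  measurable (line_alive l t `&` [set w | E (tree_path w (word l))] : set Finf).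
Proof.
move=> t0 fl mE; rewrite /line_alive -setIA; apply: measurableI; first exact: measurable_line_event.
apply: (measurable_filt_F t0); exact: measurable_tree_path_alive.
Qed.

Lemma line_alive_integral l t (h : g_sigma_algebraType (cyl_upto t) -> \bar R) :
  (0 <= t)%R -> fits l -> measurable_fun setT h -> (forall X, 0 <= h X) ->
  \int[P]_(w in line_alive l t) h (tree_path w (word l)) =
  \int[PX]_X ((late_fission t X * line_integral (frate (pos_path X)) l t) * h X).
Proof.
move=> t0 fl mh h0; set u := word l.
(* The generators of [cyl_upto t] bear on a single time and are not stable under intersection. Their
   finite intersections are, and they generate the same sigma-algebra. *)
pose cyls : set (set (sample_path W)) :=
  [set E | exists2 c, cylinder_upto t c & E = path_cylinder c].
pose S := g_sigma_algebraType cyls.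
have cylsE E : cyls E -> <<s cyl_upto t >> E.
  by move=> [c Hc ->]; exact: path_cylinder_upto.
have mS (E : set (sample_path W)) : <<s cyl_upto t >> E -> measurable (E : set S).
  move=> mE; have : measurable_fun setT (idfun : S -> g_sigma_algebraType (cyl_upto t)).
    apply: measurable_fun_g_sigma => // A [s [B [/andP[s0 st] mB AE]]]; rewrite setTI.
    apply: sub_sigma_algebra; exists [:: (s, B)].
      by split=> q; rewrite inE => /eqP -> /=.
    rewrite AE; apply/seteqP; split=> X /=; last by move=> /(_ _ (mem_head _ _)).
    by move=> BX q; rewrite inE => /eqP ->.
  by move=> /(_ measurableT _ mE); rewrite setTI.
have mh' : measurable_fun setT (h : S -> \bar R).
  by move=> _ Y mY; rewrite setTI; apply: mS; have := mh measurableT Y mY; rewrite setTI.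
pose w0 (X : pathT W) := late_fission t X * line_integral (frate (pos_path X)) l t.
have mw0 : measurable_fun setT w0.
  apply: emeasurable_funM; first exact: measurable_late_fission.
  exact: measurable_line_integral_at.
have w00 X : 0 <= w0 X.
  rewrite mule_ge0 ?late_fission_ge0 //; apply: line_integral_ge0 => *; exact: fission_rate_ge0.
have mphi : measurable_fun (line_alive l t : set Finf) (fun w => tree_path w u : S).
  apply: measurable_fun_g_sigma; first exact: measurable_line_alive.
  by move=> E /cylsE mE; exact: measurable_tree_path_line.
have mid : measurable_fun setT (idfun : pathT W -> S).
  apply: measurable_fun_g_sigma => // E /cylsE mE; rewrite setTI.
  exact: sub_cylinders_upto mE.
have mL := measurable_line_alive t0 fl.
have LG E : cyls E -> \int[P]_(w in line_alive l t) (\1_E (tree_path w u) : R)%:E =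
    \int[PX]_X (w0 X * (\1_E X : R)%:E).
  move=> HE; have mE : measurable (E : set S) by exact: sub_sigma_algebra.
  apply: (etrans (integral_indic_comp P mL mphi mE)).
  by case: HE => c Hc ->; exact: line_alive_cylinder.
have cylsT : cyls setT.
  by exists [::]; [split|apply/seteqP; split].
apply: (@intf_unique _ _ S (fun f => \int[P]_(w in line_alive l t) f (tree_path w u))
   (fun f => \int[PX]_X (w0 X * f X)) _ _ cyls erefl _ _ _ LG h mh' h0).
- exact: intf_integral.
- exact: (@intf_weighted _ _ _ S _ PX w0 idfun).
- move=> A B [c [mc ct] ->] [c' [mc' ct'] ->]; exists (c ++ c').
    split=> q; rewrite mem_cat => /orP[]; [exact: mc|exact: mc'|exact: ct|exact: ct'].
  apply/seteqP; split=> X /=.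
    by move=> [H H'] q; rewrite mem_cat => /orP[]; [exact: H|exact: H'].
  by move=> H; split=> q qc; apply: H; rewrite mem_cat qc ?orbT.
- rewrite integral_indic_comp //; apply: le_lt_trans (ltry 1).
  exact: probability_le1 (mphi mL _ measurableT).
- exact: LG.
Qed.

End LineAliveLaw.

(** * The many-to-one formula *)

Section ManyToOnePath.
Context {R : realType} {d : measure_display} {J : measurableType d}.
Variables (W : path_class R J) (HW : progressively_measurable W).
Variables (rate : J -> R) (p : nat -> J -> R).
Hypotheses (mrate : measurable_fun setT rate) (rate_ge0 : forall y, 0 <= rate y).
Hypothesis Hp : is_offspring_law p.
Local Open Scope ereal_scope.
Local Notation leb := (@lebesgue_measure R).
Local Notation frate := (fission_rate rate p).
Implicit Types (l : seq (nat * nat)) (t : R) (X : sample_path W).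

Let mp : forall a, measurable_fun setT (p a). Proof. by case: Hp. Qed.
Let p_ge0 : forall a y, (0 <= p a y)%R. Proof. by case: Hp. Qed.

Let kp_ge0 k y : 0 <= ((k%:R : R) * p k y)%:E.
Proof. by rewrite lee_fin mulr_ge0. Qed.

Lemma offspring_meanE y :
  \sum_(0 <= k <oo) (k%:R * p k y)%:E = (offspring_mean p y)%:E.
Proof.
have [_ _ _ fin] := Hp; rewrite /offspring_mean fineK //.
by rewrite ge0_fin_numE ?fin // nneseries_ge0.
Qed.

Lemma mean_rate_ge0 y : (0 <= mean_rate rate p y)%R.
Proof. by rewrite mulr_ge0 // fine_ge0 // nneseries_ge0. Qed.

Lemma measurable_mean_rate : measurable_fun setT (mean_rate rate p).
Proof.
apply: measurable_funM => //; apply: measurableT_comp => //.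
apply: (@ge0_emeasurable_sum _ _ _ _ _ xpredT) => // k _.
apply/measurable_EFinP; exact: measurable_funM.
Qed.

Lemma fission_rate_sum y :
  \sum_(0 <= a <oo) (a.+1%:R * (1 + a%:R)^-1 * (rate y * p a y))%:E = (rate y)%:E.
Proof.
have [_ _ p1 _] := Hp.
transitivity (\sum_(0 <= a <oo) ((p a y)%:E * (rate y)%:E)).
  apply: eq_eseriesr => a _; rewrite -EFinM nat1r divff ?pnatr_eq0 // mul1r.
  by rewrite mulrC.
by rewrite nneseriesZr ?p1 ?mul1e // => *; rewrite lee_fin.
Qed.

Lemma fission_rate_sum_mean y :
  \sum_(0 <= a <oo) (a.+1%:R * 1 * (rate y * p a y))%:E = (rate y + mean_rate rate p y)%:E.
Proof.
have [_ _ p1 _] := Hp.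
transitivity (\sum_(0 <= a <oo) (((p a y)%:E + ((a%:R : R) * p a y)%:E) * (rate y)%:E)).
  apply: eq_eseriesr => a _; rewrite -EFinD -EFinM mulr1 -nat1r; congr _%:E.
  by rewrite mulrCA mulrC mulrDl mul1r.
rewrite nneseriesZr ?lee_fin //; last by move=> a; rewrite adde_ge0 // lee_fin.
rewrite nneseriesD //; try by move=> *; rewrite lee_fin.
by rewrite p1 offspring_meanE -EFinD -EFinM mulrDl mul1r.
Qed.

Definition mean_exposure t X : \bar R :=
  \int[leb]_(s in `[0%R, t]%classic) (mean_rate rate p (pos_path X s))%:E.

Lemma late_fission0 t X : cumulated_rate rate (pos_path X) t = +oo ->
  late_fission rate t X = 0.
Proof.
move=> cum; rewrite /late_fission integral0_eq // => r _; rewrite indicE.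
case: (boolP (r \in _)) => [/set_mem|_]; last by rewrite mul0e.
rewrite /= in_itv /= andbT => tr.
have -> : cumulated_rate rate (pos_path X) r = +oo; last by rewrite /= mule0 mule0.
apply/eqP; rewrite -leye_eq -cum; apply: ge0_subset_integral => //.
- apply/measurable_EFinP/measurable_funTS/measurableT_comp => //.
  exact: measurable_fun_pair2 (X : pathT W) (measurable_pos_path HW).
- by move=> q _; rewrite lee_fin.
- by apply: subset_itvl; rewrite bnd_simp ltW.
Qed.

(* Both sums are exponential series with value exp (cumulated_rate t); if the
   latter is infinite then late_fission vanishes. *)
Lemma many_to_one_path t X : (0 <= t)%R -> mean_exposure t X < +oo ->
  late_fission rate t X * (\sum_(0 <= n <oo)
    sum_lines n (fun l => line_integral (frate (pos_path X)) l t * expeR (- mean_exposure t X))) =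
  late_fission rate t X * (\sum_(0 <= n <oo)
    sum_lines n (fun l => line_integral (frate (pos_path X)) l t *
       (line_weight (fun a => (1 + a%:R)^-1) l)%:E)).
Proof.
move=> t0 Mfin; set f := pos_path X; set M := mean_exposure t X.
have [cum|cfin] := eqVneq (cumulated_rate rate f t) +oo.
  by rewrite late_fission0 // !mul0e.
have mf : measurable_fun setT f.
  exact: measurable_fun_pair2 (X : pathT W) (measurable_pos_path HW).
have mh a : measurable_fun setT (frate f a).
  by apply: measurable_funM; exact: measurableT_comp.
have h0 a r : (0 <= frate f a r)%R by exact: fission_rate_ge0.
have I0 l : 0 <= line_integral (frate f) l t by exact: line_integral_ge0.
have M0 : 0 <= M by apply: integral_ge0 => s _; rewrite lee_fin mean_rate_ge0.
have c0 : 0 <= cumulated_rate rate f t by exact: cumulated_rate_ge0.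
have Mn : M \is a fin_num by rewrite ge0_fin_numE.
have cn : cumulated_rate rate f t \is a fin_num by rewrite ge0_fin_numE // ltey.
have mr : measurable_fun setT (fun r => (rate (f r))%:E).
  by apply/measurable_EFinP; exact: measurableT_comp.
have mm : measurable_fun setT (fun r => (mean_rate rate p (f r))%:E).
  by apply/measurable_EFinP; exact: measurableT_comp measurable_mean_rate mf.
have r0 r : 0 <= (rate (f r))%:E by rewrite lee_fin.
have m0 r : 0 <= (mean_rate rate p (f r))%:E by rewrite lee_fin mean_rate_ge0.
congr (_ * _).
transitivity ((\sum_(0 <= n <oo) iterated_integral (fun r => (rate (f r))%:E + (mean_rate rate p (f r))%:E) n t) * expeR (- M)).
  rewrite -nneseriesZr ?expeR_ge0 //; last first.
    by move=> n; apply: iterated_integral_ge0 => r; rewrite adde_ge0.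
  apply: eq_eseriesr => n _; rewrite sum_linesZr ?expeR_ge0 //; congr (_ * _).
  transitivity (sum_lines n (fun l => (line_weight (fun=> 1%R) l)%:E * line_integral (frate f) l t)).
    by apply: eq_sum_lines => l _ _; rewrite /line_weight big1 // mul1e.
  rewrite sum_line_integral //; congr (iterated_integral _ n t); apply/funext => r.
  by rewrite fission_rate_sum_mean EFinD.
transitivity (\sum_(0 <= n <oo) iterated_integral (fun r => (rate (f r))%:E) n t); last first.
  apply: eq_eseriesr => n _.
  transitivity (sum_lines n (fun l => (line_weight (fun a => ((1 + a%:R)^-1)%R) l)%:E * line_integral (frate f) l t)).
    rewrite sum_line_integral //.
    by congr (iterated_integral _ n t); apply/funext => r; rewrite fission_rate_sum.
  by apply: eq_sum_lines => l _ _; rewrite muleC.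
have I1 : iterated_integral (fun r => (rate (f r))%:E) 1 t = cumulated_rate rate f t.
  by apply: eq_integral => r _ /=; rewrite mule1.
have I2 : iterated_integral (fun r => (rate (f r))%:E + (mean_rate rate p (f r))%:E) 1 t =
    cumulated_rate rate f t + M.
  transitivity (\int[leb]_(r in `[0%R, t]%classic) ((rate (f r))%:E + (mean_rate rate p (f r))%:E)).
    by apply: eq_integral => r _ /=; rewrite mule1.
  rewrite ge0_integralD //; exact: measurable_funTS.
rewrite !sum_iterated_integral ?I1 ?I2 //; last 4 first.
- by rewrite ltey.
- exact: emeasurable_funD.
- by move=> r; rewrite adde_ge0.
- by rewrite lte_add_pinfty // ltey.
rewrite fineD // -(fineK Mn) /= -EFinM; congr _%:E.
by rewrite -expRD addrK.
Qed.

End ManyToOnePath.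

(** * Population sums as sums over lines *)

Section PopulationSum.
Context {R : realType} {d : measure_display} {J : measurableType d}.
Variable W : path_class R J.
Implicit Types (w : spined_tree W) (u v : seq nat) (l : seq (nat * nat)) (t : R).
Local Open Scope ereal_scope.

(** Inverse to [word] on a given tree: it restores the brood sizes that the word forgets, so that
    each living particle has exactly one line. *)
Definition line_of w u : seq (nat * nat) :=
  [seq ((nth 0%N u k).-1, brood w (take k u)) | k <- rev (iota 0 (size u))].

Lemma line_of_rcons w u j : line_of w (rcons u j) = (j.-1, brood w u) :: line_of w u.
Proof.
rewrite /line_of size_rcons -addn1 iotaD rev_cat map_cat add0n /=.
congr (_ :: _); first by rewrite nth_rcons ltnn eqxx -cats1 take_size_cat.
apply/eq_in_map => k; rewrite mem_rev mem_iota add0n /= => ku.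
by rewrite nth_rcons ku -cats1 takel_cat // ltnW.
Qed.

Lemma size_line_of w u : size (line_of w u) = size u.
Proof. by rewrite size_map size_rev size_iota. Qed.

Lemma line_of_spec w u : tree w u ->
  [/\ fits (line_of w u), line_event (line_of w u) w & word (line_of w u) = u].
Proof.
elim/last_ind: u => [|u j IHu] // wuj; have wu := tree_rcons wuj.
have [f e wd] := IHu wu; rewrite line_of_rcons.
have /andP[j1 jb] := (tree_children j wu).1 wuj.
split=> /=.
- by rewrite f andbT -ltnS prednK // -add1n.
- by rewrite wd.
- by rewrite word_cons /= wd prednK.
Qed.

Lemma line_of_word w l : line_event l w -> line_of w (word l) = l.
Proof.
elim: l => [|[j a] l IHl] //= [lw aw].
by rewrite word_cons line_of_rcons IHl //= aw.
Qed.

Lemma line_aliveE t w l : fits l ->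
  line_alive l t w <-> exists2 u, population w t u & l = line_of w u.
Proof.
move=> fl; split=> [[lw pw]|[u pu ->]]; first by exists (word l); rewrite ?line_of_word.
by have [_ ? wd] := line_of_spec pu.1; split=> //=; rewrite wd.
Qed.

Lemma nneseries_delta (m : nat) (c : \bar R) : 0 <= c ->
  \sum_(0 <= n <oo) (if m == n then c else 0) = c.
Proof.
move=> c0; rewrite (nneseriesD1 (n := m)) ?eqxx //.
  by rewrite eseries0 ?adde0 // => k _ /negPf; rewrite eq_sym => ->.
by move=> k; case: ifP.
Qed.

Lemma sum_lines_population (s : seq (seq nat)) (G : seq nat -> seq (nat * nat) -> \bar R) :
  (forall u l, 0 <= G u l) ->
  \sum_(0 <= n <oo) sum_lines n (fun l => \sum_(u <- s) G u l) =
  \sum_(u <- s) \sum_(0 <= n <oo) sum_lines n (G u).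
Proof.
move=> G0; elim: s => [|u s IHs].
  rewrite big_nil eseries0 // => n _ _; rewrite -[RHS](sum_lines0 n).
  by apply: eq_sum_lines => l _ _; rewrite big_nil.
rewrite big_cons -IHs -nneseriesD; last 2 first.
- by move=> n _ _; exact: sum_lines_ge0.
- by move=> n _ _; apply: sum_lines_ge0 => l; exact: sume_ge0.
apply: eq_eseriesr => n _; rewrite -sum_linesD //; last by move=> l; exact: sume_ge0.
by apply: eq_sum_lines => l _ _; rewrite big_cons.
Qed.

(** The index set on the left is random and cannot be exchanged with an expectation. Each living
    particle is a delta at its own line, which moves the randomness into the indicator of
    [line_alive]. *)
Lemma population_sum t w (F : seq nat -> R) : (0 <= t)%R -> (forall u, 0 <= F u)%R ->
  (\sum_(u \in population w t) F u)%:E =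
  \sum_(0 <= n <oo) sum_lines n (fun l => (\1_(line_alive l t) w : R)%:E * (F (word l))%:E).
Proof.
move=> t0 F0; have popfin := finite_population w t0.
rewrite fsbig_finite // -sumEFin; set s := finmap.enum_fset _.
have us : uniq s by exact: finmap.fset_uniq.
have inP u : u \in s <-> population w t u.
  by rewrite in_fset_set //; split=> [/set_mem|/mem_set].
pose G u l : \bar R := if l == line_of w u then (F u)%:E else 0.
have G0 u l : 0 <= G u l by rewrite /G; case: ifP => // _; rewrite lee_fin.
transitivity (\sum_(u <- s) \sum_(0 <= n <oo) sum_lines n (G u)).
  rewrite big_seq [RHS]big_seq; apply: eq_bigr => u /inP pu.
  have [fu _ wu] := line_of_spec pu.1.
  rewrite -[LHS](nneseries_delta (size u)) ?lee_fin //; apply: eq_eseriesr => n _.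
  by rewrite sum_lines_delta ?lee_fin // size_line_of fu andbT.
rewrite -sum_lines_population //; apply: eq_eseriesr => n _.
apply: eq_sum_lines => l _ fl; rewrite indicE.
case: (boolP (w \in _)) => [/set_mem lw|/negP nlw].
  have wl : word l \in s by apply/inP; case: lw.
  rewrite (bigD1_seq (word l)) //= /G line_of_word ?eqxx; last by case: lw.
  rewrite mul1e big1_seq ?adde0 // => u /andP[ul /inP pu].
  case: ifP => // /eqP lu; case/eqP: ul; rewrite lu.
  by have [_ _ ->] := line_of_spec pu.1.
rewrite mul0e big1_seq // => u /= /inP pu; rewrite /G.
case: ifP => // /eqP lu; exfalso; apply: nlw; apply/mem_set.
by apply/line_aliveE => //; exists u.
Qed.

Lemma strict_ancestors_line (g : nat -> R) w l : line_event l w ->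
  (\prod_(v <- strict_ancestors (word l)) g (brood w v) = line_weight g l)%R.
Proof.
elim: l => [|[j a] l IHl] /=; first by rewrite /line_weight !big_nil.
move=> [lw aw]; rewrite word_cons strict_ancestors_rcons /ancestors -cats1 big_cat /=.
by rewrite big_seq1 IHl // aw /line_weight big_cons mulrC.
Qed.

End PopulationSum.

Section ManyToOne.
Context {R : realType} {d : measure_display} {J : measurableType d}.
Variables (W : path_class R J) (HW : progressively_measurable W).
Variables (rate : J -> R) (p : nat -> J -> R).
Hypotheses (mrate : measurable_fun setT rate) (rate_ge0 : forall y, 0 <= rate y).
Hypothesis Hp : is_offspring_law p.
Local Open Scope ereal_scope.
Local Notation Finf := (g_sigma_algebraType (at_infinity (@filt_F R d J W))).
Local Notation leb := (@lebesgue_measure R).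
Local Notation frate := (fission_rate rate p).
Local Notation cyl_upto t := (@cylinders_upto R d J W t).
Implicit Types (w : spined_tree W) (l : seq (nat * nat)) (t : R).

Let p_ge0 : forall a y, (0 <= p a y)%R. Proof. by case: Hp. Qed.

(** Times are clipped to [[0, t]]: the integral is unchanged and its integrand becomes jointly
    measurable for the path up to [t]. *)
Lemma measurable_mean_exposure t : (0 <= t)%R ->
  measurable_fun setT (mean_exposure rate p t : g_sigma_algebraType (cyl_upto t) -> \bar R).
Proof.
move=> t0; pose clip (s : R) := Num.min (Num.max 0%R s) t.
have mclip : measurable_fun setT clip.
  by apply: measurable_minr; [exact: measurable_maxr|exact: measurable_cst].
have clipt s : (0 <= clip s <= t)%R by rewrite /clip le_min t0 andbT max0_ge0 ge_min lexx orbT.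
pose Y (q : g_sigma_algebraType (cyl_upto t) * R) : J := path_fun q.1 (clip q.2).
have mY : measurable_fun setT Y.
  apply: (measurable_fun_eval_upto HW t0) => //; exact: measurableT_comp mclip measurable_snd.
rewrite (_ : mean_exposure rate p t = fun X => \int[leb]_(s in `[0%R, t]%classic) (mean_rate rate p (Y (X, s)))%:E).
  apply: (@measurable_fun_integral_itv R _ _ (cst 0%R) (cst t) (fun q => (mean_rate rate p (Y q))%:E)) => //.
    apply/measurable_EFinP; exact: (measurableT_comp (measurable_mean_rate mrate Hp) mY).
  by move=> q; rewrite lee_fin mean_rate_ge0.
apply/funext => X; apply: eq_integral => s; rewrite inE /= in_itv /= => /andP[s0 st].
rewrite pos_pathE //; congr (mean_rate rate p (path_fun X _))%:E.
by rewrite /clip (max_idPr s0) (min_idPl st).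
Qed.

Lemma position_tree_path t w u s : population w t u -> (0 <= s <= t)%R ->
  position w u s = path_fun (tree_path w u) s.
Proof.
move=> [wu]; rewrite alive_atE => /andP[_ tu] /andP[s0 st].
by rewrite tree_pathE // s0 (le_lt_trans st).
Qed.

Lemma mean_exposure_tree t w u : population w t u ->
  \int[leb]_(s in `[0%R, t]%classic) (mean_rate rate p (position w u s))%:E =
  mean_exposure rate p t (tree_path w u).
Proof.
move=> pu; apply: eq_integral => s; rewrite inE /= in_itv /= => /andP[s0 st].
by rewrite (position_tree_path pu) ?s0 // pos_pathE.
Qed.

Variables (Xi : R.-pker J ~> pathT W) (HXi : is_markov_process Xi) (x : J).
Variable P : probability Finf R.
Hypothesis HP : is_branching_markov Xi rate p x P.
Local Notation PX := (kernel_law Xi x).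

(** Many-to-one for any nonnegative summand that depends on a living particle through its line and
    its path up to [t]. The two sums to be compared are both of this kind, so they become integrals
    over the same law of paths and can be compared path by path. *)
Lemma population_integral t (F : spined_tree W -> seq nat -> R)
    (G : seq (nat * nat) -> g_sigma_algebraType (cyl_upto t) -> R) : (0 <= t)%R ->
  (forall w u, 0 <= F w u)%R ->
  (forall l, measurable_fun setT (G l)) -> (forall l X, 0 <= G l X)%R ->
  (forall l w, fits l -> line_alive l t w -> F w (word l) = G l (tree_path w (word l))) ->
  \int[P]_w (\sum_(u \in population w t) F w u)%:E =
  \int[PX]_X (late_fission rate t X *
    \sum_(0 <= n <oo) sum_lines n (fun l => line_integral (frate (pos_path X)) l t * (G l X)%:E)).
Proof.
move=> t0 F0 mG G0 FG.
pose H l w : \bar R := if fits l then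
  ((fun w => (G l (tree_path w (word l)))%:E) \_ (line_alive l t)) w else 0.
have H0 l w : 0 <= H l w.
  by rewrite /H; case: ifP => // _; rewrite patchE; case: ifP => // _; rewrite lee_fin.
have mH l : measurable_fun setT (H l : Finf -> \bar R).
  rewrite /H; case: (boolP (fits l)) => fl; last exact: measurable_cst.
  have mL := measurable_line_alive HW t0 fl.
  apply: (measurable_restrictT (fun w : Finf => (G l (tree_path w (word l)))%:E) mL).1.
  apply/measurable_EFinP; apply: (measurableT_comp (mG l)).
  apply: measurable_fun_g_sigma; first exact: measurable_line_alive.
  by move=> E HE; apply: measurable_tree_path_line => //; exact: sub_sigma_algebra.
have I0 X l : 0 <= line_integral (frate (pos_path X)) l t.
  by apply: line_integral_ge0 => *; exact: fission_rate_ge0.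
have late0 X : 0 <= late_fission rate t X by exact: late_fission_ge0.
pose K l (X : pathT W) : \bar R :=
  late_fission rate t X * line_integral (frate (pos_path X)) l t * (G l X)%:E.
have K0 l X : 0 <= K l X by rewrite mule_ge0 ?lee_fin // mule_ge0.
have mK l : measurable_fun setT (K l).
  apply: emeasurable_funM.
    apply: emeasurable_funM; [exact: measurable_late_fission|exact: measurable_line_integral_at].
  apply/measurable_EFinP; apply: (measurableT_comp (mG l)); exact: measurable_fun_path_upto.
transitivity (\sum_(0 <= n <oo) sum_lines n (fun l => \int[PX]_X K l X)).
  transitivity (\int[P]_w (\sum_(0 <= n <oo) sum_lines n (H ^~ w))).
    apply: eq_integral => w _; rewrite population_sum //.
    apply: eq_eseriesr => n _; apply: eq_sum_lines => l _ fl.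
    rewrite /H fl patchE indicE; case: (boolP (w \in _)) => [/set_mem lw|_]; last by rewrite mul0e.
    by rewrite mul1e FG.
  have mn n := @ge0_integral_sum_lines _ _ _ P setT n H measurableT mH H0.
  rewrite integral_nneseries //; last 2 first.
  - by move=> n; exact: (mn n).1.
  - by move=> n w _; exact: sum_lines_ge0.
  apply: eq_eseriesr => n _; rewrite (mn n).2; apply: eq_sum_lines => l _ fl.
  rewrite /H fl -integral_mkcond.
  have mGl : measurable_fun setT (fun X => (G l X)%:E) by exact/measurable_EFinP.
  have Gl0 X : 0 <= (G l X)%:E by rewrite lee_fin.
  exact: (line_alive_integral HW HXi mrate rate_ge0 Hp HP t0 fl mGl Gl0).
have mn n := @ge0_integral_sum_lines _ _ _ PX setT n K measurableT mK K0.
transitivity (\sum_(0 <= n <oo) \int[PX]_X sum_lines n (K ^~ X)).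
  by apply: eq_eseriesr => n _; rewrite (mn n).2.
rewrite -integral_nneseries //; last 2 first.
- by move=> n; exact: (mn n).1.
- by move=> n X _; exact: sum_lines_ge0.
apply: eq_integral => X _; rewrite muleC -nneseriesZr //; last first.
  by move=> n; apply: sum_lines_ge0 => l; rewrite mule_ge0 ?lee_fin.
apply: eq_eseriesr => n _; rewrite -sum_linesZr //; last first.
  by move=> l; rewrite mule_ge0 ?lee_fin.
by apply: eq_sum_lines => l _ _; rewrite /K -muleA muleC.
Qed.

Hypothesis Hfin : forall w t u, (0 <= t)%R -> population w t u ->
  \int[leb]_(s in `[0%R, t]%classic) (mean_rate rate p (position w u s))%:E < +oo.

(* This is E~[prod (1 + A_v) exp (- int m R) | G_t] = 1, written under P. *)
Lemma many_to_one t (E : set (sample_path W)) : (0 <= t)%R -> <<s cyl_upto t >> E ->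
  \int[P]_w (\sum_(u \in population w t) (\1_E (tree_path w u) *
     expR (- \int[leb]_(s in `[0%R, t]) mean_rate rate p (position w u s))))%R%:E =
  \int[P]_w (\sum_(u \in population w t) (\1_E (tree_path w u) *
     \prod_(v <- strict_ancestors u) (1 + (brood w v)%:R)^-1 : R))%R%:E.
Proof.
move=> t0 mE; pose M : sample_path W -> \bar R := mean_exposure rate p t.
(* Finite exposure is known for the paths of living particles, whereas the integral against [Xi]
   runs over all trajectories. Restricting [E] to finite exposure changes neither population sum. *)
pose E' : set (sample_path W) := E `&` [set X : sample_path W | M X < +oo].
have mM := measurable_mean_exposure t0.
have mE' : measurable (E' : set (g_sigma_algebraType (cyl_upto t))).
  apply: measurableI; first exact: mE.
  by rewrite -[X in measurable X]setTI; exact: emeasurable_fun_infty_o.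
have M0 X : 0 <= M X by apply: integral_ge0 => s _; rewrite lee_fin mean_rate_ge0.
have EE' w u : population w t u -> \1_E (tree_path w u) = \1_E' (tree_path w u) :> R.
  move=> pu; rewrite !indicE; congr (_%:R); congr nat_of_bool.
  apply/idP/idP => /set_mem H; apply/mem_set; last by case: H.
  by split=> //=; rewrite /M -mean_exposure_tree //; exact: Hfin.
pose g (a : nat) : R := ((1 + a%:R)^-1)%R.
have g0 a : (0 <= g a)%R by rewrite invr_ge0 addr_ge0.
have lw0 l : (0 <= line_weight g l)%R by exact: prodr_ge0.
have mind : measurable_fun setT (\1_E' : g_sigma_algebraType (cyl_upto t) -> R) by exact: measurable_indic.
have E1 := @population_integral t
  (fun w u => \1_E (tree_path w u) * expR (- \int[leb]_(s in `[0%R, t]) mean_rate rate p (position w u s)))%R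
  (fun l X => \1_E' X * expR (- fine (M X)))%R t0.
have E2 := @population_integral t
  (fun w u => \1_E (tree_path w u) * \prod_(v <- strict_ancestors u) (1 + (brood w v)%:R)^-1)%R
  (fun l X => \1_E' X * line_weight g l)%R t0.
rewrite {}E1; last 4 first.
- by move=> w u; rewrite mulr_ge0 // expR_ge0.
- move=> l; apply: measurable_funM => //; apply: measurableT_comp => //.
  by apply: measurableT_comp => //; exact: measurableT_comp.
- by move=> l X; rewrite mulr_ge0 // expR_ge0.
- move=> l w fl [lw pw]; rewrite (EE' _ _ pw); congr (_ * expR (- fine _))%R.
  exact: mean_exposure_tree.
rewrite {}E2; last 4 first.
- move=> w u; rewrite mulr_ge0 //; apply: prodr_ge0 => v _; exact: g0.
- by move=> l; apply: measurable_funM => //.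
- by move=> l X; rewrite mulr_ge0.
- move=> l w fl [lw pw]; rewrite (EE' _ _ pw); congr (_ * _)%R.
  exact: strict_ancestors_line lw.
apply: eq_integral => X _; rewrite !indicE.
case: (boolP (X \in E')) => [/set_mem [_ /= MX]|_]; last first.
  congr (_ * _); apply: eq_eseriesr => n _; apply: eq_sum_lines => l _ _.
  by rewrite !mul0r.
have Mn : M X \is a fin_num by rewrite ge0_fin_numE.
transitivity (late_fission rate t X * \sum_(0 <= n <oo)
    sum_lines n (fun l => line_integral (frate (pos_path X)) l t * expeR (- M X))).
  congr (_ * _); apply: eq_eseriesr => n _; apply: eq_sum_lines => l _ _.
  by rewrite mul1r -[in RHS](fineK Mn).
rewrite many_to_one_path //; congr (_ * _); apply: eq_eseriesr => n _.
by apply: eq_sum_lines => l _ _; rewrite mul1r.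
Qed.

End ManyToOne.

(** * The spine *)

Section SpineTheory.
Context {R : realType} {d : measure_display} {J : measurableType d}.
Variables (W : path_class R J) (HW : progressively_measurable W).
Implicit Types (w : spined_tree W) (u v : seq nat) (t s : R).
Local Notation FT t := (g_sigma_algebraType (@filt_F_generators R d J W t)).
Local Notation FtT t := (g_sigma_algebraType (@filt_F_generators R d J W t `|`
  [set E | exists u, E = [set w : spined_tree W | node w t = u]])).
Local Notation cyl_upto t := (@cylinders_upto R d J W t).

Lemma tree_spine w n : tree w (spine w n).
Proof. by have [_ h _] := spine_line w. Qed.

Lemma birth_spineS w n : birth w (spine w n.+1) = fission w (spine w n).
Proof. by have [_ _ /(_ n) [j ->]] := spine_line w; rewrite birth_rcons. Qed.

Lemma fission_spine_le w k n : (k <= n)%N ->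
  fission w (spine w k) <= fission w (spine w n).
Proof.
elim: n => [|n IHn]; first by rewrite leqn0 => /eqP ->.
rewrite leq_eqVlt => /orP[/eqP -> //|/IHn kn]; apply: (le_trans kn).
by rewrite -birth_spineS; exact/ltW/birth_lt_fission/tree_spine.
Qed.

Lemma position_spine w k n s : (k <= n)%N -> 0 <= s < fission w (spine w k) ->
  position w (spine w n) s = position w (spine w k) s.
Proof.
move=> + /andP[s0 sk]; elim: n => [|n IHn]; first by rewrite leqn0 => /eqP ->.
rewrite leq_eqVlt => /orP[/eqP -> //|kn]; rewrite -IHn //.
have [_ _ /(_ n) [j nj]] := spine_line w; rewrite nj position_rcons //.
  by rewrite -nj; exact: tree_spine.
by rewrite s0 (lt_le_trans sk) // fission_spine_le.
Qed.

(** Birth times increase along the spine, so the spine node at [s] is the node at [t] or one of its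
    ancestors, and the extended path of the latter passes through it. *)
Lemma spine_position_node w s t : 0 <= s <= t ->
  spine_position w s = position w (node w t) s.
Proof.
move=> /andP[s0 st]; rewrite /spine_position.
have [[k _ <-] [_ /andP[bk sk]] _] := node_spec w s0.
have [[n _ <-] [_ /andP[_ tn]] _] := node_spec w (le_trans s0 st).
rewrite (@position_spine _ k n) ?s0 // leqNgt; apply/negP => nk.
have : fission w (spine w n) <= birth w (spine w k).
  by case: k nk {sk} bk => // k nk _; rewrite birth_spineS fission_spine_le.
by move=> /le_trans/(_ bk)/(lt_le_trans tn); rewrite ltNge st.
Qed.

Lemma population_node w t : 0 <= t -> population w t (node w t).
Proof. by move=> /(node_spec w) []. Qed.

Lemma spine_position_path w s t : 0 <= s <= t ->
  spine_position w s = path_fun (tree_path w (node w t)) s.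
Proof.
move=> st; rewrite (spine_position_node _ st).
rewrite (position_tree_path (population_node _ _) st) //.
by case/andP: st; exact: le_trans.
Qed.

Lemma population0 w : population w 0 = [set [::]].
Proof.
apply/seteqP; split=> u.
  case/lastP: u => [//|u j] [wu]; rewrite alive_atE birth_rcons leNgt.
  by rewrite fission_gt0 //; exact: tree_rcons wu.
move=> ->; split; first exact: tree_root.
by rewrite alive_atE birth_root lexx fission_gt0 //; exact: tree_root.
Qed.

Lemma node0 w : node w 0 = [::].
Proof. by have := population_node w (lexx 0); rewrite population0. Qed.

Lemma node_sum w t (F : seq nat -> R) : 0 <= t ->
  \sum_(u \in population w t) F u * (node w t == u)%:R = F (node w t).
Proof.
move=> t0; rewrite -(fsbig_widen [set node w t]); last 2 first.
- by move=> u ->; exact: population_node.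
- by move=> u [_ /= nu]; case: eqP => [/esym//|_]; rewrite mulr0.
by rewrite fsbig_set1 eqxx mulr1.
Qed.

Lemma filt_F_Ft t A : filt_F t A -> filt_Ft t (A : set (spined_tree W)).
Proof. by apply: sub_sigma_algebra2 => E; left. Qed.

(** There are countably many words, so an event that involves the spine node splits into countably
    many pieces, on each of which the node is a fixed word. *)
Lemma measurable_node_set t (A : set (spined_tree W)) (F : seq nat -> set (spined_tree W)) :
  (forall u, measurable (F u : set (FT t))) ->
  (forall w, A w <-> F (node w t) w) -> filt_Ft t A.
Proof.
move=> mF AF; suff -> : A = \bigcup_u ([set w | node w t = u] `&` F u).
  apply: (@countable_bigcupT_measurable _ (FtT t)) => [|u].
    exact: countableP.
  apply: (@measurableI _ (FtT t)); first by apply: sub_sigma_algebra; right; exists u.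
  exact: filt_F_Ft (mF u).
by apply/seteqP; split=> w => [/AF Fw|[u _ [/= <- /AF]]] //; exists (node w t).
Qed.

Lemma measurable_node_fun t (F : seq nat -> spined_tree W -> R) :
  (forall u, measurable_fun setT (F u : FT t -> R)) ->
  measurable_wrt (filt_Ft t) (fun w => F (node w t) w).
Proof.
move=> mF B mB; apply: (@measurable_node_set t _ (fun u => F u @^-1` B)) => //.
by move=> u; have := mF u measurableT B mB; rewrite setTI.
Qed.

(** Exhibits an event about the spine as an event [E] about one path. The same [E] can then be
    tested on every living particle, as the passage from [Pt] to [P] requires. *)
Lemma filt_G_path t A : 0 <= t -> filt_G t (A : set (spined_tree W)) ->
  exists2 E, <<s cyl_upto t >> E & A = [set w | E (tree_path w (node w t))].
Proof.
move=> t0; have SA := @sigma_algebra_preimage _ _ <<s cyl_upto t >> setT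
  (fun w : spined_tree W => tree_path w (node w t)) (smallest_sigma_algebra setT (cyl_upto t)).
move=> GA; have : preimage_set_system setT (fun w : spined_tree W => tree_path w (node w t)) <<s cyl_upto t >> A.
  move: A GA; apply: smallest_sub => // A [s [B [st mB ->]]].
  exists [set X : sample_path W | B (path_fun X s)]; first by apply: sub_sigma_algebra; exists s, B.
  by rewrite setTI; apply/seteqP; split=> w /=; rewrite (spine_position_path _ st).
by move=> [E mE <-]; exists E => //; rewrite setTI.
Qed.

Lemma filt_G_Ft t A : 0 <= t -> filt_G t A -> filt_Ft t (A : set (spined_tree W)).
Proof.
move=> t0 /(filt_G_path t0)[E mE ->].
apply: (@measurable_node_set t _ (fun u => [set w | population w t u /\ E (tree_path w u)])).
  by move=> u; exact: measurable_tree_path_alive.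
by move=> w; split=> [Ew|[]//]; split=> //; exact: population_node.
Qed.

Lemma filt_G_le s t A : s <= t -> filt_G s A -> filt_G t (A : set (spined_tree W)).
Proof.
move=> st; apply: sub_sigma_algebra2 => _ [q [B [/andP[q0 qs] mB ->]]].
by exists q, B; split=> //; rewrite q0 (le_trans qs).
Qed.

(** The generators at time 0 are not literally generators at [t], because the root, alive at 0, may
    have died by [t]. All that is visible at 0 is the position of the root at 0, recovered in either
    case. This makes the initial value of [zeta_u] measurable at time [t]. *)
Lemma filt_F_ge0 t A : 0 <= t -> filt_F 0 A -> filt_F t (A : set (spined_tree W)).
Proof.
move=> t0; apply: smallest_sub; first exact: smallest_sigma_algebra.
have no w u : tree w u -> fission w u <= 0 -> False.
  by move=> wu; rewrite leNgt fission_gt0.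
have e0 : filt_F t (set0 : set (spined_tree W)) by exact: (@measurable0 _ (FT t)).
move=> _ [[[u [C [mC ->]]]|[u [s [B [mB ->]]]]]|[u [s [B [mB ->]]]]].
- by rewrite (_ : [set w | _] = set0) //; apply/seteqP; split=> w // [wu /(no _ _ wu)].
- by rewrite (_ : [set w | _] = set0) //; apply/seteqP; split=> w // [wu /(no _ _ wu)].
have [[-> ->]|us] := pselect (u = [::] /\ s = 0); last first.
  rewrite (_ : [set w | _] = set0) //; apply/seteqP; split=> w // [].
  rewrite population0 => u0; rewrite u0 birth_root -eq_le => /eqP s0 _.
  by apply: us.
rewrite (_ : [set w | _] = [set w : spined_tree W | [/\ tree w [::], fission w [::] <= t,
    birth w [::] <= 0 < fission w [::] & B (seg w [::] 0)]] `|`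
  [set w : spined_tree W | [/\ population w t [::], birth w [::] <= 0 <= t & B (seg w [::] 0)]]).
  apply: (@measurableU _ (FT t)); apply: sub_sigma_algebra.
    by left; right; exists [::], 0, B.
  by right; exists [::], 0, B.
apply/seteqP; split=> w /=.
  rewrite population0 birth_root => -[_ _ Bw].
  have [ft|tf] := leP (fission w [::]) t; [left|right].
    by split=> //; [exact: tree_root|rewrite lexx fission_gt0 //; exact: tree_root].
  by split=> //; [split; [exact: tree_root|rewrite alive_atE birth_root t0]|rewrite lexx].
by rewrite population0 birth_root lexx => -[[]|[]].
Qed.

End SpineTheory.

(** * The weight that multiplies [zeta] in the spine martingale *)

Section SpineMeasure.
Context {R : realType} {d : measure_display} {J : measurableType d}.
Variables (W : path_class R J) (HW : progressively_measurable W).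
Variables (rate : J -> R) (p : nat -> J -> R).
Hypotheses (mrate : measurable_fun setT rate) (rate_ge0 : forall y, 0 <= rate y).
Hypothesis Hp : is_offspring_law p.
Implicit Types (w : spined_tree W) (u v : seq nat) (t s : R).
Local Notation leb := (@lebesgue_measure R).
Local Notation FT t := (g_sigma_algebraType (@filt_F_generators R d J W t)).
Local Notation Finf := (g_sigma_algebraType (at_infinity (@filt_F R d J W))).
Local Notation Ftinf := (g_sigma_algebraType (at_infinity (@filt_Ft R d J W))).

Definition discount t u w : R :=
  expR (- \int[leb]_(s in `[0, t]) mean_rate rate p (position w u s)).

Definition fertility u w : R := \prod_(v <- strict_ancestors u) (1 + (brood w v)%:R).

(** The indicator makes the weight measurable on the whole space: for a word that is not alive at
    [t], brood sizes and path may be junk or not yet observable. At the spine node it equals 1. *)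
Definition spine_weight t u w : R :=
  \1_[set w | population w t u] w * (fertility u w * discount t u w).

Lemma fertility_gt0 u w : 0 < fertility u w.
Proof. by apply: prodr_gt0 => v _; rewrite ltr_pwDl. Qed.

Lemma fertilityV u w :
  fertility u w * \prod_(v <- strict_ancestors u) (1 + (brood w v)%:R)^-1 = 1.
Proof. by rewrite prodfV mulfV // gt_eqF // fertility_gt0. Qed.

(** The strict ancestors of a particle alive at [t] have all died by [t], which makes their brood
    sizes observable. *)
Lemma measurable_fertility t u :
  measurable_fun ([set w | population w t u] : set (FT t)) (fertility u).
Proof.
set D := [set w | _].
have mD : measurable (D : set (FT t)) by exact: measurable_population.
apply: measurable_prod => v; case/mapP => k; rewrite mem_iota add0n /= => ku -> _ Y mY.
pose B a := [set w : spined_tree W | [/\ tree w (take k u), fission w (take k u) <= t & brood w (take k u) = a]].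
rewrite (_ : D `&` _ = D `&` \bigcup_(a in [set a : nat | Y (1 + a%:R : R)]) B a).
  apply: measurableI => //; apply: bigcup_measurable => a _; exact: measurable_brood_upto.
apply/seteqP; split=> w [Dw].
  move=> Yw; split=> //; exists (brood w (take k u)) => //.
  move: Dw => [wu /andP[bt _]].
  have wk : tree w (take k u) by apply: (@tree_prefix _ _ _ _ w _ (drop k u)); rewrite cat_take_drop.
  split=> //; apply: le_trans bt; apply: fission_le_birth => //.
    by rewrite size_takel // ltnW.
  by rewrite size_takel // ltnW.
by move=> [a Ya [_ _ aw]]; split=> //=; rewrite aw.
Qed.

Lemma measurable_discount t u : 0 <= t ->
  measurable_fun ([set w | population w t u] : set (FT t)) (discount t u).
Proof.
move=> t0; set D := [set w | _].
have mD : measurable (D : set (FT t)) by exact: measurable_population.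
pose g w : R := expR (- fine (mean_exposure rate p t (tree_path w u))).
suff : measurable_fun (D : set (FT t)) g.
  apply: eq_measurable_fun => w /set_mem Dw.
  by rewrite /g -(mean_exposure_tree _ _ Dw).
apply: measurableT_comp => //; apply: measurableT_comp => //; apply: measurableT_comp => //.
apply: (measurableT_comp (measurable_mean_exposure HW mrate rate_ge0 Hp t0)).
apply: measurable_fun_g_sigma => // E HE.
rewrite (_ : _ `&` _ = [set w | population w t u /\ E (tree_path w u)]) //.
apply: measurable_tree_path_alive => //; exact: sub_sigma_algebra.
Qed.

Lemma measurable_spine_weight t u : 0 <= t ->
  measurable_fun setT (spine_weight t u : FT t -> R).
Proof.
move=> t0; set D := [set w : spined_tree W | population w t u].
have mD : measurable (D : set (FT t)) by exact: measurable_population.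
have := (measurable_restrictT (fun w : FT t => fertility u w * discount t u w) mD).1.
move=> /(_ (measurable_funM (@measurable_fertility t u) (@measurable_discount t u t0))).
congr (measurable_fun _ _); apply/funext => w; rewrite patchE /spine_weight indicE -/D.
by case: ifP => _; rewrite ?mul1r ?mul0r.
Qed.

Lemma spine_weight_node t w : 0 <= t ->
  spine_weight t (node w t) w = fertility (node w t) w * discount t (node w t) w.
Proof.
by move=> t0; rewrite /spine_weight indicE mem_set ?mul1r //; exact: population_node.
Qed.

Lemma spine_weight_gt0 t w : 0 <= t -> 0 < spine_weight t (node w t) w.
Proof. by move=> t0; rewrite spine_weight_node // mulr_gt0 ?fertility_gt0 ?expR_gt0. Qed.

Lemma spine_martingaleE (zeta : R -> spined_tree W -> R) t w : 0 <= t ->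
  spine_martingale rate p zeta t w = spine_weight t (node w t) w * zeta t w.
Proof.
move=> t0; rewrite (spine_weight_node _ t0) /spine_martingale.
rewrite (@eq_Rintegral _ _ _ leb _ (fun s => mean_rate rate p (position w (node w t) s))); first by [].
by move=> s; rewrite inE /= in_itv /= => st; rewrite (spine_position_node _ st).
Qed.

Lemma spine_martingale0 (zeta : R -> spined_tree W -> R) w :
  spine_martingale rate p zeta 0 w = zeta 0 w.
Proof.
rewrite /spine_martingale node0 /strict_ancestors /= big_nil mul1r.
by rewrite set_itv1 /Rintegral integral_set1 oppr0 expR0 mul1r.
Qed.

Variables (P : probability Finf R) (Pt : probability Ftinf R) (HPt : is_spine_measure P Pt).
Local Open Scope ereal_scope.

Lemma spine_measure_integral t (F : seq nat -> spined_tree W -> R) : (0 <= t)%R ->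
  (forall u, measurable_fun setT (F u : FT t -> R)) ->
  (forall w, 0 <= F (node w t) w)%R ->
  \int[Pt]_w (F (node w t) w)%:E =
  \int[P]_w (\sum_(u \in population w t) F u w *
                  \prod_(v <- strict_ancestors u) (1 + (brood w v)%:R)^-1)%R%:E.
Proof.
move=> t0 mF F0; apply: (HPt t0 (f := fun w => F (node w t) w)).
- exact: measurable_node_fun.
- by left.
- split=> [u B mB|w]; last by rewrite (node_sum w (F ^~ w)).
  by have := mF u measurableT B mB; rewrite setTI.
Qed.

Variables (Xi : R.-pker J ~> pathT W) (HXi : is_markov_process Xi) (x : J).
Hypothesis HP : is_branching_markov Xi rate p x P.
Hypothesis Hfin : forall w t u, (0 <= t)%R -> population w t u ->
  \int[leb]_(s in `[0%R, t]%classic) (mean_rate rate p (position w u s))%:E < +oo.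

Lemma measurable_filt_Ft t (A : set (spined_tree W)) : (0 <= t)%R ->
  filt_Ft t A -> measurable (A : set Ftinf).
Proof. by move=> t0 mA; apply: sub_sigma_algebra; exists t. Qed.

(** Both sides are carried to [P] by the spine measure. On the left [fertility] cancels against its
    inverse and the discount remains; on the right the inverse of [fertility] remains; [many_to_one]
    equates the two. *)
Lemma spine_weight_integral t A : (0 <= t)%R -> filt_G t A ->
  \int[Pt]_w (spine_weight t (node w t) w * \1_A w)%R%:E = Pt A.
Proof.
move=> t0 GA; have [E mE AE] := filt_G_path t0 GA.
have mA : measurable (A : set Ftinf) by apply: (measurable_filt_Ft t0); exact: filt_G_Ft.
(* [A] is given in terms of the spine. [B u] is its counterpart for the particle [u], measurable for
   [filt_F t] and equivalent to [A] when [u] is the spine node. *)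
pose B u := [set w : spined_tree W | population w t u /\ E (tree_path w u)].
have mB u : measurable_fun setT (\1_(B u) : FT t -> R).
  by apply: measurable_indic; exact: measurable_tree_path_alive.
have BE w u : population w t u -> \1_(B u) w = \1_E (tree_path w u) :> R.
  move=> pu; rewrite !indicE; congr (_%:R); congr nat_of_bool.
  by apply/idP/idP => /set_mem H; apply/mem_set; [case: H|split].
have BA w : \1_(B (node w t)) w = \1_A w :> R.
  by rewrite BE ?AE ?indicE; [congr (_%:R); congr nat_of_bool; apply/idP/idP => /set_mem H; apply/mem_set|exact: population_node].
transitivity (\int[Pt]_w (\1_A w : R)%:E); last by rewrite integral_indic ?setIT.
transitivity (\int[Pt]_w (\1_(B (node w t)) w : R)%:E); last by apply: eq_integral => w _; rewrite BA.
rewrite (@spine_measure_integral t (fun u => \1_(B u))) //.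
transitivity (\int[Pt]_w (spine_weight t (node w t) w * \1_(B (node w t)) w)%R%:E).
  by apply: eq_integral => w _; rewrite BA.
rewrite (@spine_measure_integral t (fun u w => spine_weight t u w * \1_(B u) w)%R) //; last 2 first.
- by move=> u; apply: measurable_funM => //; exact: measurable_spine_weight.
- by move=> w; rewrite mulr_ge0 // ltW // spine_weight_gt0.
transitivity (\int[P]_w (\sum_(u \in population w t) (\1_E (tree_path w u) *
     expR (- \int[leb]_(s in `[0%R, t]) mean_rate rate p (position w u s))))%R%:E); last first.
  apply: (etrans (many_to_one HW mrate rate_ge0 Hp HXi HP Hfin t0 mE)).
  by apply: eq_integral => w _; congr EFin; apply: eq_fsbigr => u /set_mem pu; rewrite BE.
apply: eq_integral => w _; congr EFin; apply: eq_fsbigr => u /set_mem pu.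
rewrite /spine_weight indicE mem_set // mul1r BE // -/(discount t u w).
by rewrite mulrAC (mulrAC (fertility u w)) fertilityV mul1r mulrC.
Qed.

End SpineMeasure.

Lemma measurable_fun_div {R : realType} d (T : measurableType d) (f g : T -> R) :
  measurable_fun setT f -> measurable_fun setT g -> (forall z, 0 < g z) ->
  measurable_fun setT (fun z => f z / g z).
Proof.
move=> mf mg g0; rewrite (_ : (fun z => _) = fun z => f z * expR (- ln (g z))).
  apply: measurable_funM => //; apply: measurableT_comp => //.
  apply: measurableT_comp => //; exact: measurableT_comp (@measurable_ln R) mg.
by apply/funext => z; rewrite expRN lnK // posrE.
Qed.

Lemma patch_EFinE {R : realType} (T : Type) (A : set T) (f : T -> R) w :
  ((fun z => (f z)%:E) \_ A) w = (\1_A w * f w)%:E.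
Proof. by rewrite patchE indicE; case: ifP => _; rewrite ?mul1r ?mul0r. Qed.

(** The two measures live on different sigma-algebras, so they are compared through maps into a
    common space [S]. A weight [D] that reproduces [nu] on the events of [S] does so against every
    nonnegative function measurable for [S]: the use made here of a conditional expectation given
    [S]. *)
Lemma eq_weighted_integral {R : realType} d d1 d2 (S : measurableType d)
    (T1 : measurableType d1) (T2 : measurableType d2)
    (mu : {measure set T1 -> \bar R}) (nu : {measure set T2 -> \bar R})
    (rho1 : T1 -> S) (rho2 : T2 -> S) (D : T1 -> R) (A : set S) (f : S -> R) :
  measurable_fun setT rho1 -> measurable_fun setT rho2 ->
  measurable_fun setT D -> (forall z, 0 <= D z) ->
  (forall B, measurable B -> (\int[mu]_z (D z * \1_B (rho1 z))%:E = nu (rho2 @^-1` B))%E) ->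
  measurable A -> measurable_fun setT f -> (forall y, 0 <= f y) ->
  (\int[mu]_(z in rho1 @^-1` A) (D z * f (rho1 z))%:E =
   \int[nu]_(z in rho2 @^-1` A) (f (rho2 z))%:E)%E.
Proof.
move=> m1 m2 mD D0 munu mA mf f0.
pose g : S -> \bar R := (fun y => (f y)%:E) \_ A.
have mg : measurable_fun setT g.
  by apply: (measurable_restrictT (fun y => (f y)%:E) mA).1; apply/measurable_EFinP; exact: measurable_funTS.
have g0 y : (0 <= g y)%E by rewrite /g patch_EFinE lee_fin mulr_ge0.
transitivity (\int[mu]_z ((D z)%:E * g (rho1 z)))%E.
  rewrite integral_mkcond; apply: eq_integral => z _.
  by rewrite patch_EFinE /g patch_EFinE -EFinM mulrCA.
transitivity (\int[nu]_z g (rho2 z))%E; last first.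
  by rewrite [RHS]integral_mkcond; apply: eq_integral => z _; rewrite patch_EFinE /g patch_EFinE.
apply: (@intf_eq_fun _ _ S (fun h => \int[mu]_z ((D z)%:E * h (rho1 z)))%E
  (fun h => \int[nu]_z h (rho2 z))%E _ _ _ g mg g0).
- apply: (@intf_weighted _ _ _ S T1 mu (fun z => (D z)%:E) rho1) => //.
  exact/measurable_EFinP.
- exact: intf_integral.
move=> B mB; have -> := integral_indic_comp nu measurableT m2 mB.
by rewrite setTI -munu.
Qed.

Section PopulationMeasurability.
Context {R : realType} {d : measure_display} {J : measurableType d}.
Variable W : path_class R J.
Local Notation FT t := (g_sigma_algebraType (@filt_F_generators R d J W t)).

(** The index set is random but finite, hence takes countably many values. The space is cut
    according to them, each given by duplicate-free lists, and on each piece the sum has a fixed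
    finite index. *)
Lemma measurable_population_sum t (g : seq nat -> spined_tree W -> R) : 0 <= t ->
  (forall u, measurable_fun ([set w | population w t u] : set (FT t)) (g u)) ->
  measurable_fun setT (fun w : FT t => \sum_(u \in population w t) g u w).
Proof.
move=> t0 mg _ Y mY; rewrite setTI.
pose D (s : seq (seq nat)) : set (FT t) :=
  \bigcap_u (if u \in s then [set w : spined_tree W | population w t u]
             else ~` [set w : spined_tree W | population w t u]).
have mpop u : measurable ([set w : spined_tree W | population w t u] : set (FT t)).
  exact: measurable_population.
have mD s : measurable (D s).
  rewrite /D -[X in measurable X]setCK setC_bigcap; apply: measurableC.
  apply: countable_bigcupT_measurable => [|u]; first exact: countableP.
  by apply: measurableC; case: ifP => // _; exact: measurableC.
have DE s w : D s w -> population w t = [set` s].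
  move=> Dw; apply/seteqP; split=> u /=; have := Dw u I; case: ifP => //.
pose F s : set (FT t) := if uniq s then D s `&` (fun w => \sum_(u <- s) g u w) @^-1` Y else set0.
rewrite (_ : _ @^-1` Y = \bigcup_s F s).
  apply: countable_bigcupT_measurable => [|s]; first exact: countableP.
  rewrite /F; case: ifP => // us.
  suff : measurable_fun (D s) (fun w : FT t => \sum_(u <- s) g u w) by apply.
  rewrite (_ : (fun w => _) = fun w => \sum_(u <- s) (if u \in s then g u w else 0)); last first.
    by apply/funext => w; apply: eq_big_seq => u ->.
  apply: measurable_sum => u; case: (boolP (u \in s)) => us'; last exact: measurable_cst.
  apply: measurable_funS (mpop u) _ (mg u) => w Dw.
  by have := Dw u I; rewrite us'.
apply/seteqP; split=> w.
  move=> Yw; have popfin := finite_population w t0.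
  exists (finmap.enum_fset (fset_set (population w t))) => //.
  have us := finmap.fset_uniq (fset_set (population w t)).
  rewrite /F us; split; last by move: Yw; rewrite /= fsbig_finite.
  move=> u _; case: ifPn; rewrite in_fset_set //; first by move=> /set_mem.
  by move=> /negP H pu; apply: H; exact/mem_set.
move=> [s _]; rewrite /F; case: ifP => // us [Dw /=].
by rewrite (DE _ _ Dw) fsbig_seq.
Qed.

End PopulationMeasurability.

Theorem theorem6p4 (R : realType) (d : measure_display) (J : measurableType d)
    (W : path_class R J) (HW : progressively_measurable W)
    (Xi : R.-pker J ~> pathT W) (HXi : is_markov_process Xi)
    (rate : J -> R) (Hrate : measurable_fun setT rate)
    (rate_ge0 : forall y, 0 <= rate y)
    (p : nat -> J -> R) (Hp : is_offspring_law p)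
    (x : J)
    (P : probability (g_sigma_algebraType (at_infinity (@filt_F R d J W))) R)
    (HP : is_branching_markov Xi rate p x P)
    (Pt : probability (g_sigma_algebraType (at_infinity (@filt_Ft R d J W))) R)
    (HPt : is_spine_measure P Pt)
    (PP : probability (g_sigma_algebraType (at_infinity (@filt_G R d J W))) R)
    (HPP : restricts_to <<s at_infinity (@filt_G R d J W) >> Pt PP)
    (zeta : R -> spined_tree W -> R)
    (zeta_u : R -> seq nat -> spined_tree W -> R)
    (zeta_gt0 : forall t w, 0 <= t -> 0 < zeta t w)
    (Hzeta : is_martingale Pt (@filt_G R d J W) zeta)
    (Hzeta_u : forall t, 0 <= t -> spine_representation t (zeta t) (zeta_u t))
    (Hfin : forall (w : spined_tree W) t u, 0 <= t -> population w t u ->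
       (\int[lebesgue_measure]_(s in `[0%R, t]%classic)
           (mean_rate rate p (position w u s))%:E < +oo)%E)
    (Qt : probability (g_sigma_algebraType (at_infinity (@filt_Ft R d J W))) R)
    (HQt : forall t, 0 <= t -> is_density (filt_Ft t) Pt Qt
       (fun w => spine_martingale rate p zeta t w /
                 spine_martingale rate p zeta 0 w))
    (Q : probability (g_sigma_algebraType (at_infinity (@filt_F R d J W))) R)
    (HQ : restricts_to <<s at_infinity (@filt_F R d J W) >> Qt Q)
    (Ph : probability (g_sigma_algebraType (at_infinity (@filt_G R d J W))) R)
    (HPh : restricts_to <<s at_infinity (@filt_G R d J W) >> Qt Ph)
    (t : R) (ht : 0 <= t) :
  is_density (filt_F t) P Q
    (fun w => additive_martingale rate p zeta_u t w /
              additive_martingale rate p zeta_u 0 w) /\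
  is_density (filt_G t) PP Ph (fun w => zeta t w / zeta 0 w).
Proof.
have zetaE s w : 0 <= s -> zeta s w = zeta_u s (node w s) w.
  by move=> s0; rewrite (Hzeta_u _ s0).2 (node_sum w (fun u => zeta_u s u w)).
have mzeta_u s u : 0 <= s ->
    measurable_fun setT (zeta_u s u : g_sigma_algebraType (@filt_F_generators R d J W s) -> R).
  by move=> s0 _ B mB; rewrite setTI; exact: (Hzeta_u _ s0).1.
(* The root is alone at time 0, so the three normalising denominators all equal [zeta_u 0 [::]],
   which unlike [zeta 0] makes no reference to the spine. *)
have zeta0E w : zeta 0 w = zeta_u 0 [::] w by rewrite zetaE // node0.
have Z0 w : additive_martingale rate p zeta_u 0 w = zeta_u 0 [::] w.
  rewrite /additive_martingale population0 fsbig_set1.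
  by rewrite set_itv1 /Rintegral integral_set1 oppr0 expR0 mul1r.
have mzeta_u0 : measurable_fun setT
    (zeta_u 0 [::] : g_sigma_algebraType (@filt_F_generators R d J W t) -> R).
  by move=> _ B mB; rewrite setTI; apply: filt_F_ge0 => //; exact: (Hzeta_u _ (lexx 0)).1.
have zeta_u0_gt0 w : 0 < zeta_u 0 [::] w by rewrite -zeta0E zeta_gt0.
split.
  rewrite (_ : (fun w => _) = fun w => additive_martingale rate p zeta_u t w / zeta_u 0 [::] w); last first.
    by apply/funext => w; rewrite Z0.
  split.
    have mZ : measurable_fun setT (additive_martingale rate p zeta_u t :
        g_sigma_algebraType (@filt_F_generators R d J W t) -> R).
      apply: (@measurable_population_sum _ _ _ _ t (fun u w => discount rate p t u w * zeta_u t u w)) => // u.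
      apply: measurable_funM; first exact: measurable_discount.
      exact: measurable_funTS (mzeta_u t u ht).
    have := measurable_fun_div mZ mzeta_u0 zeta_u0_gt0.
    by move=> mr B mB; have := mr measurableT B mB; rewrite setTI.
  move=> A FA; rewrite HQ; last by apply: sub_sigma_algebra; exists t.
  rewrite (HQt _ ht).2; last exact: filt_F_Ft.
  (* The integrand with the spine node replaced by an arbitrary [u]: the family, measurable for
     [filt_F t], to which the definition of the spine measure applies. *)
  pose F u w := \1_A w * (spine_weight rate p t u w * (zeta_u t u w / zeta_u 0 [::] w)).
  transitivity (\int[Pt]_w (F (node w t) w)%:E)%E.
    rewrite integral_mkcond; apply: eq_integral => w _.
    rewrite (patch_EFinE A (fun w => spine_martingale rate p zeta t w / spine_martingale rate p zeta 0 w)).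
    rewrite spine_martingale0 zeta0E (spine_martingaleE _ _ _ _ ht) (zetaE _ _ ht).
    by rewrite /F mulrA.
  rewrite (spine_measure_integral HPt ht (F := F)); last 2 first.
  - move=> u; apply: measurable_funM; first by apply: measurable_indic; exact: FA.
    apply: measurable_funM; first exact: measurable_spine_weight.
    exact: measurable_fun_div (mzeta_u t u ht) mzeta_u0 zeta_u0_gt0.
  - move=> w; rewrite /F mulr_ge0 // mulr_ge0 //; first exact/ltW/spine_weight_gt0.
    by rewrite -zetaE // divr_ge0 ?ltW // zeta_gt0.
  rewrite [RHS]integral_mkcond; apply: eq_integral => w _; rewrite patch_EFinE; congr EFin.
  have popfin := finite_population w ht.
  rewrite /additive_martingale !fsbig_finite // mulr_suml mulr_sumr.
  rewrite big_seq [RHS]big_seq; apply: eq_bigr => u; rewrite in_fset_set // => /set_mem pu.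
  have pu1 : \1_[set w : spined_tree W | population w t u] w = 1 :> R.
    by rewrite indicE mem_set.
  rewrite -/(discount rate p t u w) /F /spine_weight pu1 mul1r -[LHS]mulrA; congr (_ * _).
  by rewrite mulrAC (mulrAC (fertility u w)) fertilityV mul1r mulrA.
have mG s (B : set R) : 0 <= s <= t -> measurable B -> filt_G t (zeta s @^-1` B).
  move=> /andP[s0 st] mB; apply: (filt_G_le st).
  by have [m _ _] := Hzeta; exact: m.
pose S := g_sigma_algebraType [set E | exists s (B : set J), [/\ 0 <= s <= t, measurable B &
         E = [set w : spined_tree W | B (spine_position w s)]]].
have mzeta s : 0 <= s <= t -> measurable_fun setT (zeta s : S -> R).
  by move=> st _ B mB; rewrite setTI; exact: mG.
have zeta0_gt0 (w : S) : 0 < zeta 0 w by exact: zeta_gt0.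
have mrho : measurable_fun setT (fun w : S => zeta t w / zeta 0 w).
  by apply: measurable_fun_div => //; apply: mzeta; rewrite ?ht ?lexx.
split; first by move=> B mB; have := mrho measurableT B mB; rewrite setTI.
move=> A GA; rewrite HPh; last by apply: sub_sigma_algebra; exists t.
rewrite (HQt _ ht).2; last exact: filt_G_Ft.
(* The ratio [zeta t / zeta 0] is measurable for [filt_G t], so the weight in front of it may be
   integrated out: by [spine_weight_integral] it reproduces [Pt] on the events of [filt_G t]. *)
transitivity (\int[Pt]_(w in A)
    (spine_weight rate p t (node w t) w * (zeta t w / zeta 0 w))%:E)%E.
  apply: eq_integral => w _; rewrite spine_martingale0 (spine_martingaleE _ _ _ _ ht).
  by rewrite mulrA.
apply: (@eq_weighted_integral _ _ _ _ S _ _ Pt PP idfun idfun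
  (fun w => spine_weight rate p t (node w t) w) A (fun w => zeta t w / zeta 0 w)) => //.
- move=> _ B mB; rewrite setTI; apply: (measurable_filt_Ft ht); exact: filt_G_Ft.
- by move=> _ B mB; rewrite setTI; apply: sub_sigma_algebra; exists t.
- move=> _ B mB; rewrite setTI; apply: (measurable_filt_Ft ht).
  apply: (measurable_node_fun (F := spine_weight rate p t)) => // u.
  exact: measurable_spine_weight.
- by move=> w; exact/ltW/spine_weight_gt0.
- move=> B mB; transitivity (Pt B).
    exact: (spine_weight_integral HW Hrate rate_ge0 Hp HPt HXi HP Hfin ht mB).
  have HB : <<s at_infinity (@filt_G R d J W) >> B by apply: sub_sigma_algebra; exists t.
  exact/esym/(HPP B HB).
- by move=> w; rewrite divr_ge0 // ltW // zeta_gt0.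
Qed.
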